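(* Assume all the standing assumptions (C1)--(C14) listed in the context, and assume further that $f\in W^{1,1}(0,T;H)$. Let $h_0\in(0,1)$ be such that for every $h=T/N\in(0,h_0)$, $N\in\mathbb{N}$, the discrete problem $(\mathrm{P})_n$ of the context has a unique solution $(\theta_{n+1},\varphi_{n+1})$ with $\theta_{n+1}\in D(A_1)$, $\varphi_{n+1}\in D(B)\cap D(A_2)$ for $n=0,\dots,N-1$. Let $(\theta,\varphi)$ be the unique solution of problem $(\mathrm{P})$ of the context and put $v=\frac{d\varphi}{dt}$. Then there exist constants $h_{00}\in(0,h_0)$ and $M=M(T)>0$ such that $$\|L^{1/2}(\widehat v_h-v)\|_{L^\infty(0,T;H)}+\|B^{1/2}(\overline v_h-v)\|_{L^2(0,T;H)}+\|\widehat\varphi_h-\varphi\|_{L^\infty(0,T;V_2)}+\|\widehat\theta_h-\theta\|_{L^\infty(0,T;H)}+\|\overline\theta_h-\theta\|_{L^2(0,T;V_1)}\le Mh^{1/2}$$ for all $h=T/N\in(0,h_{00})$, where $\widehat v_h,\overline v_h,\widehat\varphi_h,\widehat\theta_h,\overline\theta_h$ are the time-interpolants of the discrete solution defined in the context.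
   Context: Fix $T>0$. Standing assumptions: (C1) $V$ and $H$ are real Hilbert spaces with $V\subset H$, the embedding being dense, continuous and compact; $H$ is identified with its dual, so $V\subset H\subset V^*$. (C2) $V_1,V_2$ are closed linear subspaces of $V$ (with the norm of $V$), dense in $H$ and reflexive. (C3) $L:H\to H$ is bounded linear, $(Lw,z)_H=(w,Lz)_H$ for all $w,z\in H$, and $(Lw,w)_H\ge c_L\|w\|_H^2$ for all $w\in H$, with a constant $c_L>0$. (C4) $A_1:D(A_1)\subset H\to H$ is a linear maximal monotone selfadjoint operator, $D(A_1)$ is a linear subspace of $H$ and $D(A_1)\subset V_1$. There is a bounded linear monotone operator $A_1^*:V_1\to V_1^*$ with $\langle A_1^*w,z\rangle_{V_1^*,V_1}=\langle A_1^*z,w\rangle_{V_1^*,V_1}$ for all $w,z\in V_1$ and $A_1^*w=A_1w$ for all $w\in D(A_1)$. For every $\alpha>0$ there is $\sigma_\alpha>0$ with $\langle A_1^*w,w\rangle_{V_1^*,V_1}+\alpha\|w\|_H^2\ge\sigma_\alpha\|w\|_{V_1}^2$ for all $w\in V_1$. (C5) For all $g\in H$ and $a>0$: if $\theta\in V_1$ satisfies $\theta+aA_1^*\theta=g$ in $V_1^*$, then $\theta\in D(A_1)$ and $\theta+aA_1\theta=g$ in $H$. (C6) $B:D(B)\subset H\to H$ and $A_2:D(A_2)\subset H\to H$ are linear maximal monotone selfadjoint operators ($D(B),D(A_2)$ linear subspaces of $H$) with $D(B)\cap D(A_2)\ne\emptyset$; $(Bw,A_2w)_H\ge0$ for all $w\in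 D(B)\cap D(A_2)$; $(Bw,A_2z)_H=(Bz,A_2w)_H$ for all $w,z\in D(B)\cap D(A_2)$; and $D(A_2)\subset V_2$. (C7) $\Phi:D(\Phi)\subset H\to H$ is a (single-valued) maximal monotone operator with $\Phi(0)=0$, $V\subset D(\Phi)$, and there are constants $p,q,C_\Phi>0$ with $\|\Phi w-\Phi z\|_H\le C_\Phi(1+\|w\|_V^p+\|z\|_V^q)\|w-z\|_V$ for all $w,z\in V$. (C8) There is a function $i:V\to[0,\infty)$ with $(\Phi w,w-z)_H\ge i(w)-i(z)$ for all $w,z\in V$. (C9) For every $\lambda>0$, the Yosida approximation $\Phi_\lambda=\lambda^{-1}(I-(I+\lambda\Phi)^{-1}):H\to H$ satisfies $\Phi_\lambda(0)=0$, $(\Phi_\lambda w,Bw)_H\ge0$ for all $w\in D(B)$, and $(\Phi_\lambda w,A_2w)_H\ge0$ for all $w\in D(A_2)$. (C10) $B^*:V_2\to V_2^*$ is a bounded linear monotone operator with $\langle B^*w,z\rangle_{V_2^*,V_2}=\langle B^*z,w\rangle_{V_2^*,V_2}$ for all $w,z\in V_2$ and $B^*w=Bw$ for all $w\in D(B)\cap V_2$. (C11) $A_2^*:V_2\to V_2^*$ is a bounded linear monotone operator with $\langle A_2^*w,z\rangle_{V_2^*,V_2}=\langle A_2^*z,w\rangle_{V_2^*,V_2}$ for all $w,z\in V_2$ and $A_2^*w=A_2w$ for all $w\in D(A_2)$. For every $\alpha>0$ there is $\omega_\alpha>0$ with $\langle A_2^*w,w\rangle_{V_2^*,V_2}+\alpha\|w\|_H^2\ge\omega_\alpha\|w\|_{V_2}^2$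 for all $w\in V_2$. (C12) For all $g\in H$, $a,b,c,d>0$, $\lambda>0$: if $\varphi_\lambda\in V_2$ satisfies $L\varphi_\lambda+aB^*\varphi_\lambda+bA_2^*\varphi_\lambda+c\Phi_\lambda\varphi_\lambda+d\mathcal{L}\varphi_\lambda=g$ in $V_2^*$, then $\varphi_\lambda\in D(B)\cap D(A_2)$ and $L\varphi_\lambda+aB\varphi_\lambda+bA_2\varphi_\lambda+c\Phi_\lambda\varphi_\lambda+d\mathcal{L}\varphi_\lambda=g$ in $H$. (C13) $\mathcal{L}:H\to H$ is Lipschitz continuous with Lipschitz constant $C_{\mathcal{L}}>0$. (C14) $\theta_0\in V_1$, $\varphi_0\in D(B)\cap D(A_2)$, $v_0\in D(B)\cap V_2$, $f\in L^2(0,T;H)$. Problem $(\mathrm{P})$: $\frac{d\theta}{dt}+\frac{d\varphi}{dt}+A_1\theta=f$ and $L\frac{d^2\varphi}{dt^2}+B\frac{d\varphi}{dt}+A_2\varphi+\Phi\varphi+\mathcal{L}\varphi=\theta$ in $(0,T)$, with $\theta(0)=\theta_0$, $\varphi(0)=\varphi_0$, $\frac{d\varphi}{dt}(0)=v_0$. A solution is a pair with $\theta\in H^1(0,T;H)\cap L^\infty(0,T;V_1)\cap L^2(0,T;D(A_1))$, $\varphi\in W^{2,\infty}(0,T;H)\cap W^{1,\infty}(0,T;V_2)\cap L^2(0,T;D(A_2))$, $\frac{d\varphi}{dt}\in L^2(0,T;D(B))$, $\Phi\varphi\in L^\infty(0,T;H)$, satisfying the two equations in $H$ a.e. on $(0,T)$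 and the initial conditions in $H$. (Under the standing assumptions problem $(\mathrm{P})$ has a unique solution, and an $h_0$ as in the claim exists.) Discrete problem $(\mathrm{P})_n$. For $N\in\mathbb{N}$ put $h=T/N$ and $f_k:=\frac1h\int_{(k-1)h}^{kh}f(s)\,ds$, $k=1,\dots,N$. Starting from $\theta_0,\varphi_0,v_0$, for $n=0,\dots,N-1$ (equations in $H$): $$\delta_h\theta_n+\delta_h\varphi_n+A_1\theta_{n+1}=f_{n+1},\quad Lz_{n+1}+Bv_{n+1}+A_2\varphi_{n+1}+\Phi\varphi_{n+1}+\mathcal{L}\varphi_{n+1}=\theta_{n+1},$$ $$z_0=z_1,\quad z_{n+1}=\delta_hv_n,\quad v_{n+1}=\delta_h\varphi_n,$$ where $\delta_hx_n:=\frac{x_{n+1}-x_n}{h}$ for $x=\theta,\varphi,v$. Interpolants. $\widehat\theta_h,\widehat\varphi_h,\widehat v_h$ are the continuous piecewise linear functions on $[0,T]$ with $\widehat\theta_h(0)=\theta_0$, $\widehat\varphi_h(0)=\varphi_0$, $\widehat v_h(0)=v_0$ and derivatives $\delta_h\theta_n$, $\delta_h\varphi_n$, $\delta_hv_n$ on $(nh,(n+1)h)$; and $\overline\theta_h:=\theta_{n+1}$, $\overline v_h:=v_{n+1}$ on $(nh,(n+1)h)$, $n=0,\dots,N-1$. $M=M(T)$ denotes a constant independent of $h$. $L^{1/2},B^{1/2}$ are the nonnegative square roots. *)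

(* Defs.v *)
From HB Require Import structures.
From mathcomp Require Import all_boot all_order all_algebra.
From mathcomp Require Import all_classical all_reals all_analysis.

Set Implicit Arguments.
Unset Strict Implicit.
Unset Printing Implicit Defensive.

Import Order.TTheory GRing.Theory Num.Theory.
Import numFieldNormedType.Exports.

Local Open Scope classical_set_scope.
Local Open Scope ring_scope.

(** Every space of the problem (V, V_1, V_2, the domains D(A) with their graph
    norms, and H itself) is a linear subspace of H carrying its own norm.  It is
    represented by its underlying set and by a norm function on H whose values
    are meaningful on that set only. *)
Record nspace (R : realType) (H : Type) := NSpace {
  carrier : set H;
  nrm : H -> R }.

(** A possibly unbounded operator D(A) c H -> H; the values of the underlying
    function outside [dom] are irrelevant. *)
Record operator (H : Type) := Operator {
  dom : set H;
  op_fun :> H -> H }.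

Section Spaces.
Context {R : realType} {H : completeNormedModType R}.
Implicit Types (D V W : set H) (ip : H -> H -> R) (X : nspace R H).

Definition lin_subspace D : Prop :=
  D 0 /\ forall (a : R) x y, D x -> D y -> D (a *: x + y).

Definition inner_product_on D ip : Prop :=
  [/\ forall x y, D x -> D y -> ip x y = ip y x,
      forall (a : R) x y z, D x -> D y -> D z ->
        ip (a *: x + y) z = a * ip x z + ip y z,
      forall x, D x -> 0 <= ip x x
    & forall x, D x -> ip x x = 0 -> x = 0].

Definition whole : nspace R H := NSpace setT (fun x => `|x|).

Definition hilbert_space V (ipV : H -> H -> R) : nspace R H :=
  NSpace V (fun x => Num.sqrt (ipV x x)).

Definition graph_space (A : operator H) : nspace R H :=
  NSpace (dom A) (fun x => `|x| + `|A x|).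

Definition cvg_in X (u : nat -> H) (x : H) : Prop :=
  nrm X (u n - x) @[n --> \oo] --> (0 : R).

Definition complete_in X : Prop :=
  forall u : nat -> H, (forall n, carrier X (u n)) ->
    (forall e : R, 0 < e -> exists N : nat,
      forall m n, (N <= m)%N -> (N <= n)%N -> nrm X (u m - u n) < e) ->
    exists2 x, carrier X x & cvg_in X u x.

Definition closed_in X W : Prop :=
  forall (u : nat -> H) x, (forall n, W (u n)) -> carrier X x ->
    cvg_in X u x -> W x.

(** X^* consists of the functionals that are linear and bounded on X; two of
    them are equal in X^* when they agree on X. *)
Definition dual X : set (H -> R) := [set l |
  (forall (a : R) x y, carrier X x -> carrier X y ->
     l (a *: x + y) = a * l x + l y) /\
  exists C : R, forall x, carrier X x -> `|l x| <= C * nrm X x].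

Definition dual_eq X (l l' : H -> R) : Prop :=
  forall x, carrier X x -> l x = l' x.

Definition dual_norm X (l : H -> R) : R :=
  sup [set `|l x| | x in [set x | carrier X x /\ nrm X x <= 1]].

Definition reflexive_space X : Prop :=
  forall F : (H -> R) -> R,
    (forall (a : R) l l', dual X l -> dual X l' ->
       F (fun x => a * l x + l' x) = a * F l + F l') ->
    (exists C : R, forall l, dual X l -> `|F l| <= C * dual_norm X l) ->
    exists2 x, carrier X x & forall l, dual X l -> F l = l x.

(** Operators S : X -> X^*, where [S w z] is the duality pairing <S w, z>. *)
Definition bounded_linear_to_dual X (S : H -> H -> R) : Prop :=
  [/\ forall w, carrier X w -> dual X (S w),
      forall (a : R) w w', carrier X w -> carrier X w' ->
        dual_eq X (S (a *: w + w')) (fun z => a * S w z + S w' z)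
    & exists C : R, forall w, carrier X w ->
        dual_norm X (S w) <= C * nrm X w].

Definition monotone_to_dual X (S : H -> H -> R) : Prop :=
  forall w z, carrier X w -> carrier X z -> 0 <= S w (w - z) - S z (w - z).

Definition symmetric_to_dual X (S : H -> H -> R) : Prop :=
  forall w z, carrier X w -> carrier X z -> S w z = S z w.

(** [dual_eq X (S w) (ip (A w))] is the equation S w = A w in X^*, the space H
    being embedded in X^* by its inner product. *)
Definition extends_on ip X (S : H -> H -> R) (A : operator H) D : Prop :=
  forall w, D w -> dual_eq X (S w) (ip (A w)).

Definition coercive_mod_H X (S : H -> H -> R) : Prop :=
  forall alpha : R, 0 < alpha -> exists2 sigma : R, 0 < sigma &
    forall w, carrier X w -> S w w + alpha * `|w| ^+ 2 >= sigma * nrm X w ^+ 2.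

End Spaces.

Section Operators.
Context {R : realType} {H : completeNormedModType R}.
Variable ip : H -> H -> R.
Implicit Types (A B S : operator H).

Definition linear_operator A : Prop :=
  lin_subspace (dom A) /\
  forall (a : R) x y, dom A x -> dom A y -> A (a *: x + y) = a *: A x + A y.

Definition monotone_operator A : Prop :=
  forall x y, dom A x -> dom A y -> 0 <= ip (A x - A y) (x - y).

(** The graph of A has no proper monotone extension in H x H. *)
Definition maximal_monotone A : Prop :=
  monotone_operator A /\
  forall x y, (forall z, dom A z -> 0 <= ip (y - A z) (x - z)) ->
    dom A x /\ y = A x.

(** The right-hand side of the equivalence says that (x, y) is in the graph of
    A, the left-hand side that it is in the graph of the adjoint of A. *)
Definition selfadjoint A : Prop :=
  dense (dom A) /\
  forall x y, (forall z, dom A z -> ip (A z) x = ip z y) <->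
    (dom A x /\ y = A x).

Definition linear_maximal_monotone_selfadjoint A : Prop :=
  [/\ linear_operator A, maximal_monotone A & selfadjoint A].

(** S is the nonnegative square root of A, i.e. S^2 = A with equality of
    domains. *)
Definition nonneg_sqrt A S : Prop :=
  [/\ linear_operator S, selfadjoint S,
      forall x, dom S x -> 0 <= ip (S x) x,
      forall x, dom A x <-> (dom S x /\ dom S (S x))
    & forall x, dom A x -> S (S x) = A x].

(** (I + lambda A)^{-1} and lambda^{-1} (I - (I + lambda A)^{-1}); for a maximal
    monotone A the equation below has exactly one solution y. *)
Definition resolvent A (lambda : R) (x : H) : H :=
  xget 0 [set y | dom A y /\ y + lambda *: A y = x].

Definition yosida A (lambda : R) (x : H) : H :=
  lambda^-1 *: (x - resolvent A lambda x).

End Operators.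

Section StandingAssumptions.
Context {R : realType} {H : completeNormedModType R}.
Variables (ip : H -> H -> R).
Implicit Types (A B Phi : operator H) (X : nspace R H).

Definition gelfand_triple (V : set H) (ipV : H -> H -> R) : Prop :=
  let X := hilbert_space V ipV in
  [/\ inner_product_on setT ip /\ (forall x, `|x| ^+ 2 = ip x x),
      [/\ lin_subspace V, inner_product_on V ipV & complete_in X],
      dense V,
      exists C : R, forall x, V x -> `|x| <= C * nrm X x
    & precompact [set x | V x /\ nrm X x <= 1]].

Definition closed_dense_reflexive_subspace X (W : set H) : Prop :=
  [/\ lin_subspace W, W `<=` carrier X, closed_in X W, dense W
    & reflexive_space (NSpace W (nrm X))].

Definition bounded_symmetric_coercive (L : H -> H) : Prop :=
  [/\ linear L,
      exists C : R, forall w, `|L w| <= C * `|w|,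
      forall w z, ip (L w) z = ip w (L z)
    & exists2 c : R, 0 < c & forall w, c * `|w| ^+ 2 <= ip (L w) w].

Definition A1_assumption X1 A1 (A1s : H -> H -> R) : Prop :=
  [/\ linear_maximal_monotone_selfadjoint ip A1,
      dom A1 `<=` carrier X1,
      [/\ bounded_linear_to_dual X1 A1s, monotone_to_dual X1 A1s
        & symmetric_to_dual X1 A1s],
      extends_on ip X1 A1s A1 (dom A1)
    & coercive_mod_H X1 A1s].

Definition A1_regularity X1 A1 (A1s : H -> H -> R) : Prop :=
  forall (g theta : H) (a : R), 0 < a -> carrier X1 theta ->
    dual_eq X1 (fun z => ip theta z + a * A1s theta z) (ip g) ->
    dom A1 theta /\ theta + a *: A1 theta = g.

Definition B_A2_assumption X2 B A2 : Prop :=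
  [/\ linear_maximal_monotone_selfadjoint ip B /\
        linear_maximal_monotone_selfadjoint ip A2,
      dom B `&` dom A2 !=set0,
      forall w, (dom B `&` dom A2) w -> 0 <= ip (B w) (A2 w),
      forall w z, (dom B `&` dom A2) w -> (dom B `&` dom A2) z ->
        ip (B w) (A2 z) = ip (B z) (A2 w)
    & dom A2 `<=` carrier X2].

Definition Phi_growth_assumption X Phi : Prop :=
  [/\ maximal_monotone ip Phi, dom Phi 0 /\ Phi 0 = 0,
      carrier X `<=` dom Phi
    & exists p q C : R, [/\ 0 < p, 0 < q, 0 < C &
        forall w z, carrier X w -> carrier X z ->
          `|Phi w - Phi z|
            <= C * (1 + nrm X w `^ p + nrm X z `^ q) * nrm X (w - z)]].

Definition Phi_potential_assumption X Phi : Prop :=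
  exists i : H -> R, (forall w, carrier X w -> 0 <= i w) /\
    forall w z, carrier X w -> carrier X z -> i w - i z <= ip (Phi w) (w - z).

Definition yosida_assumption Phi B A2 : Prop :=
  forall lambda : R, 0 < lambda ->
    [/\ yosida Phi lambda 0 = 0,
        forall w, dom B w -> 0 <= ip (yosida Phi lambda w) (B w)
      & forall w, dom A2 w -> 0 <= ip (yosida Phi lambda w) (A2 w)].

Definition B_extension_assumption X2 B (Bs : H -> H -> R) : Prop :=
  [/\ bounded_linear_to_dual X2 Bs, monotone_to_dual X2 Bs,
      symmetric_to_dual X2 Bs
    & extends_on ip X2 Bs B (dom B `&` carrier X2)].

Definition A2_extension_assumption X2 A2 (A2s : H -> H -> R) : Prop :=
  [/\ bounded_linear_to_dual X2 A2s, monotone_to_dual X2 A2s,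
      symmetric_to_dual X2 A2s,
      extends_on ip X2 A2s A2 (dom A2)
    & coercive_mod_H X2 A2s].

Definition phi_regularity X2 (L : H -> H) B A2 (Bs A2s : H -> H -> R) Phi
    (cL : H -> H) : Prop :=
  forall (g phi : H) (a b c d lambda : R),
    0 < a -> 0 < b -> 0 < c -> 0 < d -> 0 < lambda -> carrier X2 phi ->
    dual_eq X2
      (fun z => ip (L phi) z + a * Bs phi z + b * A2s phi z
                + c * ip (yosida Phi lambda phi) z + d * ip (cL phi) z)
      (ip g) ->
    [/\ dom B phi, dom A2 phi
      & L phi + a *: B phi + b *: A2 phi + c *: yosida Phi lambda phi
        + d *: cL phi = g].

Definition lipschitz_assumption (cL : H -> H) : Prop :=
  exists2 C : R, 0 < C & C.-lipschitz cL.

End StandingAssumptions.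

(** Vector-valued functions on ]a, b[, Bochner integral, Sobolev spaces.  A
    function is given on the whole of R and only its values on ]a, b[ matter. *)
Section Bochner.
Context {R : realType} {H : completeNormedModType R}.
Implicit Types (X : nspace R H) (a b T : R) (p : \bar R) (u v w s : R -> H).

Local Notation mu := (@lebesgue_measure R).

Definition ae_on a b (P : R -> Prop) : Prop :=
  {ae mu, forall t, a < t < b -> P t}.

Definition simple_fun X s : Prop :=
  [/\ finite_set (range s),
      forall x, measurable (s @^-1` [set x])
    & forall t, carrier X (s t)].

Definition simple_integral a b s : H :=
  \sum_(x \in [set: H]) fine (mu (`]a, b[ `&` s @^-1` [set x])) *: x.

Definition strongly_measurable X a b u : Prop :=
  exists s_ : nat -> R -> H, (forall n, simple_fun X (s_ n)) /\
    ae_on a b (fun t => carrier X (u t) /\ cvg_in X (fun n => s_ n t) (u t)).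

(** The norm of L^p(a, b; X). *)
Definition LpN X p a b u : \bar R :=
  ('N[mu]_p[(EFin \o (nrm X \o u)) \_ `]a, b[])%E.

Definition Lp X p a b u : Prop :=
  strongly_measurable X a b u /\ (LpN X p a b u < +oo)%E.

Definition is_bochner_integral X a b u (x : H) : Prop :=
  [/\ strongly_measurable X a b u, carrier X x &
    exists s_ : nat -> R -> H,
      [/\ forall n, simple_fun X (s_ n),
          LpN X 1%E a b (fun t => u t - s_ n t) @[n --> \oo] --> 0%E
        & cvg_in X (fun n => simple_integral a b (s_ n)) x]].

Definition bochner_integral X a b u : H :=
  xget 0 [set x | is_bochner_integral X a b u x].

Definition test_function T (psi : R -> R) : Prop :=
  (forall n t, derivable (derive1n n psi) t 1) /\
  exists a b : R, [/\ 0 < a, b < T & forall t, ~~ (a <= t <= b) -> psi t = 0].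

(** u' is the weak derivative of u in L^1(0, T; X). *)
Definition weak_derivative X T u u' : Prop :=
  [/\ Lp X 1%E 0 T u, Lp X 1%E 0 T u' &
    forall psi, test_function T psi ->
      bochner_integral X 0 T (fun t => derive1 psi t *: u t)
        = - bochner_integral X 0 T (fun t => psi t *: u' t)].

(** u is in W^{1,p}(0, T; X), with derivative u'. *)
Definition W1p X p T u u' : Prop :=
  [/\ Lp X p 0 T u, Lp X p 0 T u' & weak_derivative X T u u'].

(** u(0) = u0, where u is a class of functions modulo equality a.e.: the value
    at 0 is that of the continuous representative. *)
Definition initial_value T u (u0 : H) : Prop :=
  exists w, [/\ {within `[0, T], continuous w},
                ae_on 0 T (fun t => w t = u t) & w 0 = u0].

End Bochner.

Section Problems.
Context {R : realType} {H : completeNormedModType R}.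
Variables (X1 X2 : nspace R H) (L : H -> H) (A1 B A2 Phi : operator H).
Variables (cL : H -> H) (T : R) (th0 ph0 v0 : H) (f : R -> H).

Let HH : nspace R H := whole.

Definition solution_P (theta phi : R -> H) : Prop :=
  exists theta' v v' : R -> H,
  [/\ [/\ W1p HH 2%:E T theta theta', Lp X1 +oo%E 0 T theta
        & Lp (graph_space A1) 2%:E 0 T theta],
      [/\ W1p HH +oo%E T phi v /\ W1p HH +oo%E T v v',
          W1p X2 +oo%E T phi v,
          Lp (graph_space A2) 2%:E 0 T phi,
          Lp (graph_space B) 2%:E 0 T v
        & Lp HH +oo%E 0 T (Phi \o phi)],
      ae_on 0 T (fun t => theta' t + v t + A1 (theta t) = f t),
      ae_on 0 T (fun t => L (v' t) + B (v t) + A2 (phi t) + Phi (phi t)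
                          + cL (phi t) = theta t)
    & [/\ initial_value T theta th0, initial_value T phi ph0
        & initial_value T v v0]].

Section Discrete.
Variables (h : R).
Implicit Types (x th ph : nat -> H).

Definition delta x (n : nat) : H := h^-1 *: (x n.+1 - x n).

Definition f_ (k : nat) : H :=
  h^-1 *: bochner_integral HH (k.-1%:R * h) (k%:R * h) f.

(** v_0 is given, v_{n+1} = delta_h phi_n, z_{n+1} = delta_h v_n, z_0 = z_1. *)
Definition discrete_v ph (n : nat) : H :=
  if n is m.+1 then delta ph m else v0.

Definition discrete_z ph (n : nat) : H := delta (discrete_v ph) n.-1.

Definition discrete_solution (N : nat) th ph : Prop :=
  [/\ th 0%N = th0, ph 0%N = ph0
    & forall n, (n < N)%N ->
      [/\ dom A1 (th n.+1), dom B (ph n.+1), dom A2 (ph n.+1),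
          delta th n + delta ph n + A1 (th n.+1) = f_ n.+1
        & L (discrete_z ph n.+1) + B (discrete_v ph n.+1) + A2 (ph n.+1)
          + Phi (ph n.+1) + cL (ph n.+1) = th n.+1]].

Definition discrete_uniquely_solvable (N : nat) : Prop :=
  (exists th ph, discrete_solution N th ph) /\
  forall th ph th' ph', discrete_solution N th ph ->
    discrete_solution N th' ph' ->
    forall n, (n <= N)%N -> th n = th' n /\ ph n = ph' n.

(** On ]nh, (n+1)h[ one has [Num.truncn (t / h) = n]. *)
Definition hat x (t : R) : H :=
  let n := Num.truncn (t / h) in x n + (t - n%:R * h) *: delta x n.

Definition bar x (t : R) : H := x (Num.truncn (t / h)).+1.

End Discrete.
End Problems.

(* Main.v *)
(** The scheme is compared with the equations averaged over a time step.  Put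
    E_n = v_n - v(nh), F_n = phi_n - phi(nh), G_n = theta_n - theta(nh).  Since
    phi' = v, the difference D of v_{n+1} and the average of v over the step is
    exactly (F_{n+1} - F_n)/h; since v is Lipschitz it is also E_{n+1} + O(h).
    Averaging commutes with L, B, A_2 and A_1, so these differences solve the
    scheme with a right-hand side consisting of consistency errors only, and no
    estimate of the second time derivative of the discrete solution is needed.
    Testing with D, and with the difference of theta_{n+1} and the average of
    theta, shows that
      S_n = (L E_n, E_n) + <A_2^* F_n, F_n> + |F_n|^2 + |G_n|^2
    satisfies S_{n+1} + d_n <= S_n + C h S_{n+1} + C h^2 + m_n^2, where d_n is the
    dissipation due to B and A_1 and m_n is the integral of |theta'| over the step,
    so that the m_n^2 sum up to O(h).  The nonlinearity is harmless because an
    energy estimate, based on the potential i of (C8), bounds phi_n in V_2, where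
    Phi is locally Lipschitz.  Gronwall's lemma gives S_n + sum d_k = O(h).  The L^2
    bounds follow from the sum of the d_k and from
    (B(vb - v), vb - v) <= |B(vb - v)| |vb - v|, where vb is the average of v over
    the step and the second factor is O(h), and similarly for A_1. *)

Require Import Defs.
From HB Require Import structures.
From mathcomp Require Import all_boot all_order all_algebra.
From mathcomp Require Import all_classical all_reals all_analysis.
From mathcomp Require Import finmap measurable_realfun ess_sup_inf ring lra.

Set Implicit Arguments.
Unset Strict Implicit.
Unset Printing Implicit Defensive.

Import Order.TTheory GRing.Theory Num.Theory.
Import numFieldNormedType.Exports.

Local Open Scope classical_set_scope.
Local Open Scope ring_scope.

(** * Nonnegative forms and normed subspaces *)

(** The equations hold only for almost every [t], and A_1 theta, B v and A_2 phi are known to be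
    square integrable in time only, so the equations cannot be sampled at the nodes: this is what
    forces averages. An average passes through an unbounded operator because a selfadjoint operator
    equals its adjoint, so that membership in its graph is tested by scalar integrals. The nodal
    errors still involve values of the continuous representatives, and phi(nh) is available as an
    element of V_2 only; hence the form of A_2^* in S_n. The pairing makes sense because its other
    factor, phi_{n+1} minus the average of phi, lies in D(A_2). The exponent 1/2 has two sources:
    theta' is only L^2 in time, and in the last estimates only one of the two factors is small, the
    other being merely integrable. Much of the development turns classes of functions into
    representatives defined at every [t]. The bridge is a fundamental theorem of calculus for weak
    derivatives, whose test functions have to be constructed. *)

Section Forms.
Context {R : realType} {H : completeNormedModType R}.
Implicit Types (D W : set H) (a ip : H -> H -> R) (X : nspace R H).

Lemma lin_subspaceD D x y : lin_subspace D -> D x -> D y -> D (x + y).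
Proof. by move=> [_ DL] Dx Dy; rewrite -[x]scale1r; apply: DL. Qed.

Lemma lin_subspaceZ D (c : R) x : lin_subspace D -> D x -> D (c *: x).
Proof. by move=> [D0 DL] Dx; rewrite -[_ *: _]addr0; apply: DL. Qed.

Lemma lin_subspaceN D x : lin_subspace D -> D x -> D (- x).
Proof. by move=> DD Dx; rewrite -scaleN1r; apply: lin_subspaceZ. Qed.

Lemma lin_subspaceB D x y : lin_subspace D -> D x -> D y -> D (x - y).
Proof.
by move=> DD Dx Dy; apply: lin_subspaceD => //; apply: lin_subspaceN.
Qed.

(** Definiteness is left out so that the forms of [B], [A1] and [A2s], which may have a kernel,
    share one calculus with the inner product and the form of [L]. The set [D] is part of the notion
    because the values of a form off its domain are meaningless. *)
Definition psd_form D a : Prop :=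
  [/\ lin_subspace D, forall x y, D x -> D y -> a x y = a y x,
      forall (c : R) x y z, D x -> D y -> D z ->
        a (c *: x + y) z = c * a x z + a y z
    & forall x, D x -> 0 <= a x x].

Section Psd.
Variables (D : set H) (a : H -> H -> R).
Hypothesis aP : psd_form D a.

Let DD : lin_subspace D. Proof. by case: aP. Qed.

Lemma psdC x y : D x -> D y -> a x y = a y x.
Proof. by case: aP => _ aC _ _; exact: aC. Qed.

Lemma psd_ge0 x : D x -> 0 <= a x x.
Proof. by case: aP => _ _ _; exact. Qed.

Lemma psdDl x y z : D x -> D y -> D z -> a (x + y) z = a x z + a y z.
Proof.
by case: aP => _ _ aL _ Dx Dy Dz; rewrite -[x]scale1r aL// scale1r mul1r.
Qed.

Lemma psd0l z : D z -> a 0 z = 0.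
Proof.
move=> Dz; have D0 : D 0 by case: DD.
by have := psdDl D0 D0 Dz; rewrite addr0; lra.
Qed.

Lemma psdZl c x z : D x -> D z -> a (c *: x) z = c * a x z.
Proof.
case: aP => _ _ aL _ Dx Dz; rewrite -[c *: x]addr0 aL// ?psd0l ?addr0//.
by case: DD.
Qed.

Lemma psdNl x z : D x -> D z -> a (- x) z = - a x z.
Proof. by move=> Dx Dz; rewrite -scaleN1r psdZl// mulN1r. Qed.

Lemma psdBl x y z : D x -> D y -> D z -> a (x - y) z = a x z - a y z.
Proof.
by move=> Dx Dy Dz; rewrite psdDl// ?psdNl//; apply: lin_subspaceN.
Qed.

Lemma psdDr x y z : D x -> D y -> D z -> a z (x + y) = a z x + a z y.
Proof.
move=> Dx Dy Dz; rewrite psdC ?psdDl// 1?(psdC Dx) 1?(psdC Dy)//.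
exact: lin_subspaceD.
Qed.

Lemma psdZr c x z : D x -> D z -> a z (c *: x) = c * a z x.
Proof.
by move=> Dx Dz; rewrite psdC ?psdZl// 1?(psdC Dx)//; apply: lin_subspaceZ.
Qed.

Lemma psdNr x z : D x -> D z -> a z (- x) = - a z x.
Proof. by move=> Dx Dz; rewrite -scaleN1r psdZr// mulN1r. Qed.

Lemma psdBr x y z : D x -> D y -> D z -> a z (x - y) = a z x - a z y.
Proof.
by move=> Dx Dy Dz; rewrite psdDr// ?psdNr//; apply: lin_subspaceN.
Qed.

Lemma psd_sqrD x y : D x -> D y -> a (x + y) (x + y) = a x x + 2 * a x y + a y y.
Proof.
move=> Dx Dy; have Dxy := lin_subspaceD DD Dx Dy.
by rewrite psdDl// !psdDr// (psdC Dy Dx); ring.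
Qed.

Lemma psd_sqrB x y : D x -> D y -> a (x - y) (x - y) = a x x - 2 * a x y + a y y.
Proof.
move=> Dx Dy; have Dy' := lin_subspaceN DD Dy.
by rewrite psd_sqrD// !psdNr// psdNl//; ring.
Qed.

Lemma psd_sqrZ c x : D x -> a (c *: x) (c *: x) = c ^+ 2 * a x x.
Proof.
by move=> Dx; rewrite psdZl ?psdZr//; [ring | apply: lin_subspaceZ].
Qed.

Lemma psd_sqrD_le x y : D x -> D y ->
  a (x + y) (x + y) <= 2 * a x x + 2 * a y y.
Proof.
move=> Dx Dy; have := psd_ge0 (lin_subspaceB DD Dx Dy).
by rewrite psd_sqrB// psd_sqrD//; lra.
Qed.

(** The minimiser [- (a x y / a x x)] is available only if [a x x] is positive. If [a x x = 0], the
    form at [t x + y] is affine in [t] and nonnegative, hence has slope zero, that is,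
    [a x y = 0]. *)
Lemma psd_CS x y : D x -> D y -> (a x y) ^+ 2 <= a x x * a y y.
Proof.
move=> Dx Dy.
have := psd_ge0 Dx; rewrite le_eqVlt => /orP[/eqP x0|x0].
  have key t : 0 <= 2 * t * a x y + a y y.
    have Dt := lin_subspaceZ t DD Dx.
    have := psd_ge0 (lin_subspaceD DD Dt Dy).
    by rewrite psd_sqrD// psd_sqrZ// psdZl// -x0; lra.
  have -> : a x y = 0.
    apply/eqP; apply: contraT => axy.
    have := key (- (a y y + 1) / (2 * a x y)).
    rewrite (_ : 2 * _ * _ = - (a y y + 1)); last by field.
    by lra.
  by rewrite -x0 mul0r expr0n.
have Dt := lin_subspaceZ (- (a x y / a x x)) DD Dx.
have := psd_ge0 (lin_subspaceD DD Dt Dy).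
rewrite psd_sqrD// psd_sqrZ// psdZl//.
rewrite (_ : _ + _ = (a x x * a y y - a x y ^+ 2) / a x x); last first.
  by field; rewrite gt_eqF.
by rewrite pmulr_lge0 ?invr_gt0// subr_ge0.
Qed.

Lemma psd_le_sqrt x y : D x -> D y ->
  `|a x y| <= Num.sqrt (a x x) * Num.sqrt (a y y).
Proof.
move=> Dx Dy; rewrite -sqrtrM ?psd_ge0// -sqrtr_sqr ler_sqrt ?psd_CS//.
by rewrite mulr_ge0// psd_ge0.
Qed.

(* The implicit Euler inequality, with the test element shifted by a
   consistency error [y]. *)
Lemma psd_euler x x' y : D x -> D x' -> D y ->
  a x' x' - a x x - a y y <= 2 * a (x' - x) (x' + y).
Proof.
move=> Dx Dx' Dy; have Db := lin_subspaceB DD Dx' Dx.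
have := psd_ge0 (lin_subspaceD DD Db Dy).
rewrite psd_sqrD// psd_sqrB// (psdDr Dx' Dy Db) (psdBl Dx' Dx Dx').
by rewrite (psdC Dx Dx'); lra.
Qed.

End Psd.

(** The properties of the norm of a Banach space continuously embedded in H that
    do not involve completeness. *)
Definition normed_subspace X : Prop :=
  [/\ lin_subspace (carrier X),
      forall x, carrier X x -> 0 <= nrm X x,
      forall x y, carrier X x -> carrier X y -> nrm X (x + y) <= nrm X x + nrm X y
    & forall (c : R) x, carrier X x -> nrm X (c *: x) = `|c| * nrm X x].

Lemma normed_subspace_whole : normed_subspace (@whole R H).
Proof.
split=> //=; first by move=> x y _ _; exact: ler_normD.
by move=> c x _; exact: normrZ.
Qed.

Lemma normed_subspace_psd W D a : lin_subspace W -> W `<=` D ->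
  psd_form D a -> normed_subspace (NSpace W (fun x => Num.sqrt (a x x))).
Proof.
move=> WW WD aP; split=> //=.
  move=> x y /WD Dx /WD Dy.
  rewrite -(@ler_pXn2r _ 2)// ?nnegrE ?addr_ge0//.
  rewrite sqr_sqrtr; last first.
    by apply: (psd_ge0 aP); apply: lin_subspaceD => //; case: aP.
  rewrite (psd_sqrD aP)// sqrrD !sqr_sqrtr ?(psd_ge0 aP)//.
  have := psd_le_sqrt aP Dx Dy; have := ler_norm (a x y).
  by set s := Num.sqrt _; set t := Num.sqrt _; rewrite -mulr_natl; lra.
move=> c x /WD Dx; rewrite (psd_sqrZ aP)// sqrtrM ?sqr_ge0//.
by rewrite sqrtr_sqr.
Qed.

Section NormedSubspace.
Variable X : nspace R H.
Hypothesis XP : normed_subspace X.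

Lemma nrm_ge0 x : carrier X x -> 0 <= nrm X x.
Proof. by case: XP => _ + _ _; apply. Qed.

Lemma nrmD x y : carrier X x -> carrier X y -> nrm X (x + y) <= nrm X x + nrm X y.
Proof. by case: XP => _ _ + _; apply. Qed.

Lemma nrmZ (c : R) x : carrier X x -> nrm X (c *: x) = `|c| * nrm X x.
Proof. by case: XP => _ _ _; apply. Qed.

Lemma nrmN x : carrier X x -> nrm X (- x) = nrm X x.
Proof. by move=> Xx; rewrite -scaleN1r nrmZ// normrN1 mul1r. Qed.

Lemma carrier_lin : lin_subspace (carrier X).
Proof. by case: XP. Qed.

Lemma nrmB x y : carrier X x -> carrier X y -> nrm X (x - y) <= nrm X x + nrm X y.
Proof.
move=> Xx Xy; rewrite -(nrmN Xy); apply: nrmD => //.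
exact: lin_subspaceN carrier_lin Xy.
Qed.

Lemma nrmC x y : carrier X x -> carrier X y -> nrm X (x - y) = nrm X (y - x).
Proof.
move=> Xx Xy; rewrite -[in LHS]opprB nrmN//.
exact: lin_subspaceB carrier_lin Xy Xx.
Qed.

Lemma nrm0 : nrm X 0 = 0.
Proof.
by rewrite -(scale0r 0) nrmZ ?normr0 ?mul0r//; case: carrier_lin.
Qed.

Lemma nrm_triangle x y z : carrier X x -> carrier X y -> carrier X z ->
  nrm X (x - z) <= nrm X (x - y) + nrm X (y - z).
Proof.
move=> Xx Xy Xz; have -> : x - z = (x - y) + (y - z) by rewrite addrA subrK.
by apply: nrmD; apply: lin_subspaceB => //; exact: carrier_lin.
Qed.

(** The dual norm is a supremum over the unit ball, so [z] is normalised. Since [nrm X z = 0] does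
    not force [z = 0] in a [normed_subspace], that case is settled by the boundedness of the
    functional [S w], which also makes the supremum finite. *)
Lemma to_dual_bound (S : H -> H -> R) : bounded_linear_to_dual X S ->
  exists2 C : R, 0 <= C & forall w z, carrier X w -> carrier X z ->
    `|S w z| <= C * nrm X w * nrm X z.
Proof.
move=> [Sd _ [C CP]]; exists `|C| => // w z Xw Xz.
apply: (@le_trans _ _ (dual_norm X (S w) * nrm X z)); last first.
  rewrite ler_wpM2r ?nrm_ge0//; apply: le_trans (CP _ Xw) _.
  by rewrite ler_wpM2r ?nrm_ge0// ler_norm.
have [lin [K KP]] := Sd _ Xw.
have S0 : S w 0 = 0.
  have X0 : carrier X 0 by case: carrier_lin.
  by have := KP _ X0; rewrite nrm0 mulr0 normr_le0 => /eqP.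
have SZ c y : carrier X y -> S w (c *: y) = c * S w y.
  move=> Xy; rewrite -[c *: y]addr0 lin// ?S0 ?addr0//.
  by case: carrier_lin.
have [z0|z0] := eqVneq (nrm X z) 0.
  by have := KP _ Xz; rewrite z0 !mulr0.
have zp : 0 < nrm X z by rewrite lt_neqAle eq_sym z0 nrm_ge0.
rewrite -ler_pdivrMr//.
have -> : `|S w z| / nrm X z = `|S w ((nrm X z)^-1 *: z)|.
  by rewrite SZ// normrM mulrC ger0_norm// invr_ge0 nrm_ge0.
apply: ub_le_sup.
  exists `|K| => _ [y [Xy y1] <-]; apply: le_trans (KP _ Xy) _.
  apply: (@le_trans _ _ (`|K| * nrm X y)).
    by rewrite ler_wpM2r ?nrm_ge0// ler_norm.
  by rewrite ler_piMr.
exists ((nrm X z)^-1 *: z) => //; split.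
  exact: lin_subspaceZ carrier_lin Xz.
by rewrite nrmZ// ger0_norm ?invr_ge0 ?nrm_ge0// mulVf.
Qed.

Lemma to_dual_psd (S : H -> H -> R) : bounded_linear_to_dual X S ->
  monotone_to_dual X S -> symmetric_to_dual X S -> psd_form (carrier X) S.
Proof.
move=> [Sd Slin _] Smon Ssym; have X0 : carrier X 0 by case: carrier_lin.
split=> //; first exact: carrier_lin.
  by move=> c x y z Xx Xy Xz; rewrite Slin.
move=> x Xx; have := Smon _ _ Xx X0; rewrite subr0.
have := Slin 0 0 0 X0 X0 _ Xx; rewrite scale0r addr0 mul0r add0r => e.
have := Slin 1 0 0 X0 X0 _ Xx; rewrite scale1r addr0 mul1r => e'.
by rewrite (_ : S 0 x = 0) ?subr0//; lra.
Qed.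

End NormedSubspace.

End Forms.

(** * Integrals over an interval *)

Section AeIntegral.
Local Open Scope ereal_scope.
Context d (T : measurableType d) (R : realType).
Variable mu : {measure set T -> \bar R}.
Import HBNNSimple.

(* No measurability is assumed: the integral of a nonnegative function is a
   supremum over the simple functions below it. *)
Lemma ae_le_nnintegral (D : set T) (f g : T -> \bar R) :
  (forall x, D x -> 0 <= f x) -> (forall x, D x -> 0 <= g x) ->
  {ae mu, forall x, D x -> f x <= g x} ->
  \int[mu]_(x in D) f x <= \int[mu]_(x in D) g x.
Proof.
move=> f0 g0 [N [mN N0 fgN]]; rewrite !ge0_integralE//.
apply: ge_ereal_sup => _ [h /= hf <-].
(* Cutting [h] off on the null set [N] keeps its integral and puts it below [g] everywhere, so it
   competes in the supremum that defines the integral of [g]. *)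
pose h' := proj_nnsfun h (measurableC mN).
apply: (@le_trans _ _ (sintegral mu h')).
  rewrite -!integralT_nnsfun le_eqVlt; apply/orP; left; apply/eqP.
  apply: ge0_ae_eq_integral => //.
  - exact/measurable_EFinP.
  - exact/measurable_EFinP.
  - by move=> x _; rewrite lee_fin.
  - by move=> x _; rewrite lee_fin.
  exists N; split => // x /=; apply: contraPP => Nx; apply/not_implyP.
  move=> [_]; apply; congr EFin; rewrite /h' /=.
  by rewrite mindicE mem_set//= mulr1.
apply: ereal_sup_ubound; exists h' => // x; rewrite /h' /= mindicE.
have [xN|xN] := boolP (x \in ~` N); last first.
  by rewrite mulr0 /patch; case: ifPn => // /set_mem/g0.
rewrite mulr1; apply: le_trans (hf x) _; rewrite /patch; case: ifPn => // /set_mem Dx.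
apply: contrapT => nfg; apply: (set_mem xN); apply: fgN => /= h1.
by apply: nfg; exact: h1.
Qed.

Lemma ae_eq_nnintegral (D : set T) (f g : T -> \bar R) :
  (forall x, D x -> 0 <= f x) -> (forall x, D x -> 0 <= g x) ->
  {ae mu, forall x, D x -> f x = g x} ->
  \int[mu]_(x in D) f x = \int[mu]_(x in D) g x.
Proof.
move=> f0 g0 fg; apply/eqP; rewrite eq_le.
by apply/andP; split; apply: ae_le_nnintegral => //;
  apply: filterS fg => x fg /fg ->.
Qed.

End AeIntegral.

(** * Functions of finite range with measurable fibres *)

Section FiniteRange.
Context {R : realType}.
Local Notation mu := (@lebesgue_measure R).

(** The codomain is an arbitrary type without any measurable structure, so pairs of simple functions
    and their images under any map are again of this kind. *)
Definition fin_meas (A : Type) (s : R -> A) : Prop :=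
  finite_set (range s) /\ forall x, measurable (s @^-1` [set x]).

Lemma fin_meas_preimage A (s : R -> A) (E : set A) :
  fin_meas s -> measurable (s @^-1` E).
Proof.
move=> [fs ms].
have -> : s @^-1` E = \bigcup_(x in range s `&` E) s @^-1` [set x].
  apply/seteqP; split=> [t st|t [x [_ Ex] stx]]; last first.
    by rewrite /preimage/= stx.
  by exists (s t) => //; split=> //; exists t.
by apply: fin_bigcup_measurable => //; exact: finite_setIl.
Qed.

Lemma fin_meas_cst (A : Type) (x : A) : fin_meas (fun _ : R => x).
Proof.
split; last by move=> y; rewrite preimage_cst; case: ifP.
by apply: (@sub_finite_set _ _ [set x]) => // _ [t _ <-].
Qed.

Lemma fin_meas_pair A B (s : R -> A) (s' : R -> B) :
  fin_meas s -> fin_meas s' -> fin_meas (fun t => (s t, s' t)).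
Proof.
move=> fs fs'; split.
  apply: (@sub_finite_set _ _ (range s `*` range s')).
    by move=> _ [t _ <-]; split; exists t.
  by apply: finite_setX; [case: fs | case: fs'].
move=> [x y].
have -> : (fun t => (s t, s' t)) @^-1` [set (x, y)]
    = s @^-1` [set x] `&` s' @^-1` [set y].
  by apply/seteqP; split=> t /=; [case=> -> -> | case=> -> ->].
by apply: measurableI; [case: fs | case: fs'].
Qed.

Lemma fin_meas_comp A B (s : R -> A) (g : A -> B) :
  fin_meas s -> fin_meas (g \o s).
Proof.
move=> fs; split; last first.
  by move=> x; exact: (fin_meas_preimage (g @^-1` [set x]) fs).
have -> : range (g \o s) = g @` range s by rewrite image_comp.
by apply: finite_image; case: fs.
Qed.

Lemma fin_meas_op A B C (g : A -> B -> C) (s : R -> A) (s' : R -> B) :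
  fin_meas s -> fin_meas s' -> fin_meas (fun t => g (s t) (s' t)).
Proof.
move=> fs fs'.
exact: (fin_meas_comp (fun p => g p.1 p.2) (fin_meas_pair fs fs')).
Qed.

Lemma fin_meas_indic (D : set R) : measurable D ->
  fin_meas (fun t => t \in D).
Proof.
move=> mD; split; first exact: finite_finset.
move=> [].
  rewrite (_ : _ @^-1` _ = D)//.
  by apply/seteqP; split=> t /= => [/set_mem//|Dt]; rewrite mem_set.
rewrite (_ : _ @^-1` _ = ~` D); first exact: measurableC.
apply/seteqP; split=> t /= => [tD Dt|Dt].
  by move: tD; rewrite mem_set.
by apply/negbTE/negP => /set_mem.
Qed.

Lemma fin_meas_measurable_fun (s : R -> R) : fin_meas s ->
  measurable_fun setT s.
Proof.
by move=> fs _ Y mY; rewrite setTI; exact: fin_meas_preimage.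
Qed.

Lemma fin_meas_bounded (s : R -> R) : fin_meas s ->
  exists M, forall t, `|s t| <= M.
Proof.
move=> [fs _]; exists (\sum_(x <- fset_set (range s)) `|x|) => t.
have sF : s t \in fset_set (range s) by rewrite in_fset_set//; apply/mem_set; exists t.
by rewrite (big_fsetD1 _ sF)/= lerDl; apply: sumr_ge0.
Qed.

Lemma fin_meas_integrable (s : R -> R) (D : set R) : fin_meas s ->
  measurable D -> (mu D < +oo)%E -> mu.-integrable D (EFin \o s).
Proof.
move=> fs mD muD.
have [M sM] := fin_meas_bounded fs.
apply: measurable_bounded_integrable => //.
  by apply: measurable_funTS; exact: fin_meas_measurable_fun.
by exists M; split; [exact: num_real|move=> N MN t _; apply: le_trans (sM t) (ltW MN)].
Qed.

Lemma fin_meas_Rintegral (A : choiceType) (s : R -> A) (g : A -> R) (D : set R) :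
  fin_meas s -> measurable D -> (mu D < +oo)%E ->
  \int[mu]_(t in D) g (s t)
    = \sum_(x <- fset_set (range s)) fine (mu (D `&` s @^-1` [set x])) * g x.
Proof.
move=> fs mD muD; have [fins ms] := fs.
have E t : g (s t) = \sum_(x <- fset_set (range s)) g x * \1_(s @^-1` [set x]) t.
  have sF : s t \in fset_set (range s).
    by rewrite in_fset_set//; apply/mem_set; exists t.
  rewrite (big_fsetD1 _ sF)/= indicE mem_set//= mulr1 big_seq big1 ?addr0//.
  move=> x; rewrite !inE => /andP[xs _]; rewrite indicE.
  rewrite memNset ?mulr0//= => /eqP; rewrite eq_sym; exact/negP.
have fi x : mu.-integrable D (fun t => (g x * \1_(s @^-1` [set x]) t)%:E).
  apply: (@fin_meas_integrable (fun t => g x * \1_(s @^-1` [set x]) t)) => //.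
  exact: (fin_meas_comp (fun b : bool => g x * b%:R) (fin_meas_indic (ms x))).
rewrite /Rintegral.
under eq_integral => t _ do rewrite E -sumEFin.
rewrite (@integral_sum _ _ _ mu D mD _ _ fi)//.
have -> : (\sum_(i <- fset_set (range s)) \int[mu]_(x in D) (g i * \1_(s @^-1` [set i]) x)%:E)%E
  = (\sum_(i <- fset_set (range s)) (fine (mu (D `&` s @^-1` [set i])) * g i)%:E)%E.
  apply: eq_bigr => x _.
  have mf : mu (D `&` s @^-1` [set x]) \is a fin_num.
    have mI : measurable (D `&` s @^-1` [set x]) by apply: measurableI.
    rewrite ge0_fin_numE//; apply: le_lt_trans muD.
    by apply: le_measure; [exact/mem_set|exact/mem_set|].
  under eq_integral do rewrite EFinM.
  rewrite integralZl//.
    by rewrite (@integral_indic _ _ _ mu D mD _ (ms x)) setIC EFinM fineK// muleC.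
  exact: (@fin_meas_integrable (fun t => \1_(s @^-1` [set x]) t) D
    (fin_meas_comp (fun b : bool => b%:R) (fin_meas_indic (ms x))) mD muD).
by rewrite sumEFin.
Qed.

End FiniteRange.

#[global] Instance ae_lebesgue_filter (R : realType) :
  Filter (nbhs (almost_everywhere (@lebesgue_measure R))) :=
  ae_filter_ringOfSetsType _.

Section AeOn.
Context {R : realType}.
Implicit Types (a b : R) (P Q : R -> Prop).

Lemma ae_onW a b P : (forall t, a < t < b -> P t) -> ae_on a b P.
Proof. by move=> aP; apply: aeW. Qed.

Lemma ae_onS a b P Q : (forall t, a < t < b -> P t -> Q t) ->
  ae_on a b P -> ae_on a b Q.
Proof. by rewrite /ae_on => PQ; apply: filterS => t Pt abt; apply: PQ => //; exact: Pt. Qed.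

Lemma ae_onS2 a b P1 P2 Q : (forall t, a < t < b -> P1 t -> P2 t -> Q t) ->
  ae_on a b P1 -> ae_on a b P2 -> ae_on a b Q.
Proof.
by rewrite /ae_on => PQ; apply: filterS2 => t P1t P2t abt; apply: PQ => //; [exact: P1t|exact: P2t].
Qed.

Lemma ae_onS3 a b P1 P2 P3 Q :
  (forall t, a < t < b -> P1 t -> P2 t -> P3 t -> Q t) ->
  ae_on a b P1 -> ae_on a b P2 -> ae_on a b P3 -> ae_on a b Q.
Proof.
rewrite /ae_on => PQ; apply: filterS3 => t P1t P2t P3t abt.
by apply: PQ => //; [exact: P1t|exact: P2t|exact: P3t].
Qed.

Lemma ae_on_sub a b c d P : a <= c -> d <= b -> ae_on a b P -> ae_on c d P.
Proof.
rewrite /ae_on => ac db; apply: filterS => t + /andP[ct td]; apply.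
by rewrite (le_lt_trans ac ct) (lt_le_trans td db).
Qed.

End AeOn.

Section Scalar.
Context {R : realType}.
Local Notation mu := (@lebesgue_measure R).
Implicit Types (a b : R) (g G : R -> R).

Definition integrable_oo a b g : Prop := mu.-integrable `]a, b[ (EFin \o g).

Lemma measurable_oo a b : measurable (`]a, b[%classic : set (measurableTypeR R)).
Proof. exact: measurable_itv. Qed.

Lemma mu_oo_lty a b : (mu `]a, b[%classic < +oo)%E.
Proof. by rewrite lebesgue_measure_itv/=; case: ifP => //; rewrite -EFinB ltry. Qed.

Lemma fine_mu_oo a b : a <= b -> fine (mu `]a, b[%classic) = b - a.
Proof.
move=> ab; rewrite lebesgue_measure_itv/= lte_fin.
case: ltP => // ba; have -> : a = b by apply/le_anti/andP.
by rewrite subrr.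
Qed.

Lemma in_oo a b t : (t \in (`]a, b[%classic : set R)) = (a < t < b).
Proof. by apply/idP/idP => [/set_mem|?]; [|apply/mem_set]; rewrite /= in_itv. Qed.

Lemma integrable_oo_le a b g G : measurable_fun setT g ->
  integrable_oo a b G -> (forall t, a < t < b -> `|g t| <= G t) ->
  integrable_oo a b g.
Proof.
move=> mg iG gG; apply: (le_integrable (measurable_oo a b) _ _ iG).
  by apply/measurable_EFinP; apply: measurable_funTS; exact: mg.
move=> t /=; rewrite in_itv/= => abt; rewrite lee_fin.
by apply: le_trans (gG _ abt) _; exact: ler_norm.
Qed.

Lemma integrable_oo_cst a b (c : R) : integrable_oo a b (fun=> c).
Proof.
apply: (@fin_meas_integrable _ (fun=> c)); first exact: fin_meas_cst.
  exact: measurable_oo.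
exact: mu_oo_lty.
Qed.

Lemma integrable_oo_bounded a b g (M : R) : measurable_fun setT g ->
  (forall t, a < t < b -> `|g t| <= M) -> integrable_oo a b g.
Proof. by move=> mg gM; apply: (integrable_oo_le mg (integrable_oo_cst a b M)). Qed.

Lemma integrable_ooD a b g G : integrable_oo a b g -> integrable_oo a b G ->
  integrable_oo a b (fun t => g t + G t).
Proof. by move=> ig iG; exact: (integrableD (measurable_oo a b) ig iG). Qed.

Lemma integrable_ooZ a b g c : integrable_oo a b g ->
  integrable_oo a b (fun t => c * g t).
Proof. by move=> ig; exact: (integrableZl (measurable_oo a b) c ig). Qed.

Lemma integrable_ooB a b g G : integrable_oo a b g -> integrable_oo a b G ->
  integrable_oo a b (fun t => g t - G t).
Proof. by move=> ig iG; exact: (integrableB (measurable_oo a b) ig iG). Qed.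

Lemma integrable_ooS a b c d g : a <= c -> d <= b ->
  integrable_oo a b g -> integrable_oo c d g.
Proof.
move=> ac db ig; apply: (integrableS (measurable_oo a b) (measurable_oo c d) _ ig).
by move=> t /=; rewrite !in_itv/= => /andP[? ?]; apply/andP; split; lra.
Qed.

Lemma Rintegral_oo_le a b g G : integrable_oo a b g -> integrable_oo a b G ->
  (forall t, a < t < b -> g t <= G t) ->
  \int[mu]_(t in `]a, b[) g t <= \int[mu]_(t in `]a, b[) G t.
Proof.
move=> ig iG gG; apply: (le_Rintegral (measurable_oo a b) ig iG).
by move=> t; rewrite /= in_itv; exact: gG.
Qed.

Lemma Rintegral_oo_eq a b g G : (forall t, a < t < b -> g t = G t) ->
  \int[mu]_(t in `]a, b[) g t = \int[mu]_(t in `]a, b[) G t.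
Proof.
by move=> gG; apply: eq_Rintegral => t; rewrite in_oo; exact: gG.
Qed.

Lemma Rintegral_ooD a b g G : integrable_oo a b g -> integrable_oo a b G ->
  \int[mu]_(t in `]a, b[) (g t + G t)
    = \int[mu]_(t in `]a, b[) g t + \int[mu]_(t in `]a, b[) G t.
Proof. by move=> ig iG; apply: RintegralD => //; exact: measurable_oo. Qed.

Lemma Rintegral_ooB a b g G : integrable_oo a b g -> integrable_oo a b G ->
  \int[mu]_(t in `]a, b[) (g t - G t)
    = \int[mu]_(t in `]a, b[) g t - \int[mu]_(t in `]a, b[) G t.
Proof. by move=> ig iG; apply: RintegralB => //; exact: measurable_oo. Qed.

Lemma Rintegral_ooZ a b c g : integrable_oo a b g ->
  \int[mu]_(t in `]a, b[) (c * g t) = c * \int[mu]_(t in `]a, b[) g t.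
Proof. by move=> ig; apply: RintegralZl => //; exact: measurable_oo. Qed.

Lemma Rintegral_oo_cst a b c : a <= b ->
  \int[mu]_(t in `]a, b[) c = (b - a) * c.
Proof.
move=> ab; rewrite Rintegral_cst; last exact: measurable_oo.
by rewrite mulrC -(fine_mu_oo ab).
Qed.

Lemma Rintegral_oo_norm a b g : integrable_oo a b g ->
  `|\int[mu]_(t in `]a, b[) g t| <= \int[mu]_(t in `]a, b[) `|g t|.
Proof. by move=> ig; apply: le_normr_Rintegral => //; exact: measurable_oo. Qed.

Lemma integrable_oo_norm a b g : integrable_oo a b g ->
  integrable_oo a b (fun t => `|g t|).
Proof. by move=> ig; apply: integrable_norm. Qed.

Lemma Rintegral_oo_norm_le a b g G : integrable_oo a b g -> integrable_oo a b G ->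
  (forall t, a < t < b -> `|g t| <= G t) ->
  `|\int[mu]_(t in `]a, b[) g t| <= \int[mu]_(t in `]a, b[) G t.
Proof.
move=> ig iG gG; apply: le_trans (Rintegral_oo_norm ig) _.
by apply: Rintegral_oo_le => //; exact: integrable_oo_norm.
Qed.

Lemma ae_Rintegral_oo_eq a b g G : integrable_oo a b g -> integrable_oo a b G ->
  ae_on a b (fun t => g t = G t) ->
  \int[mu]_(t in `]a, b[) g t = \int[mu]_(t in `]a, b[) G t.
Proof.
move=> ig iG gG.
have gG' : {ae mu, forall t, `]a, b[%classic t -> (EFin \o g) t = (EFin \o G) t}.
  by move: gG; rewrite /ae_on; apply: filterS => t + abt /= => ->//; move: abt; rewrite /= in_itv.
congr fine; apply: (@ae_eq_integral _ _ _ mu _ (EFin \o G) (EFin \o g)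
  (measurable_oo a b) _ _ gG').
  exact: measurable_int ig.
exact: measurable_int iG.
Qed.

Lemma Rintegral_oo_dct a b (g_ : nat -> R -> R) g G :
  (forall n, measurable_fun setT (g_ n)) -> measurable_fun setT g ->
  integrable_oo a b G ->
  (forall n t, a < t < b -> `|g_ n t| <= G t) ->
  (forall t, a < t < b -> g_ n t @[n --> \oo] --> g t) ->
  \int[mu]_(t in `]a, b[) g_ n t @[n --> \oo] --> \int[mu]_(t in `]a, b[) g t.
Proof.
move=> mg_ mg iG gG gg.
have [] := @dominated_convergence _ _ _ mu `]a, b[ (measurable_oo a b)
  (fun n => EFin \o g_ n) (EFin \o g) (EFin \o G).
- by move=> n; apply/measurable_EFinP; apply: measurable_funTS; exact: mg_.
- by apply/measurable_EFinP; apply: measurable_funTS; exact: mg.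
- apply: aeW => t /=; rewrite in_itv/= => abt.
  by apply: cvg_EFin; [exact: nearW|exact: gg].
- exact: iG.
- by apply: aeW => t n /=; rewrite in_itv/= => abt; rewrite lee_fin; exact: gG.
move=> ig _ cv; apply: fine_cvg; rewrite /Rintegral fineK//.
by apply: integrable_fin_num => //; exact: measurable_oo.
Qed.

(** The L^p norm with exponent [+oo] is an essential supremum only on a space of positive measure;
    this fact selects that branch of its definition. *)
Lemma mu_setT_gt0 : (0 < mu [set: R])%E.
Proof.
by rewrite -set_itvNyy lebesgue_measure_itv /= addye.
Qed.

Lemma ae_on_le_integral a b (f g : R -> \bar R) :
  (forall t, a < t < b -> (0 <= f t)%E) -> (forall t, a < t < b -> (0 <= g t)%E) ->
  ae_on a b (fun t => f t <= g t)%E ->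
  (\int[mu]_(t in `]a, b[) f t <= \int[mu]_(t in `]a, b[) g t)%E.
Proof.
move=> f0 g0 fg; apply: ae_le_nnintegral.
- by move=> t /=; rewrite in_itv/=; exact: f0.
- by move=> t /=; rewrite in_itv/=; exact: g0.
have fg' : {ae mu, forall t, `]a, b[%classic t -> (f t <= g t)%E}.
  move: fg; rewrite /ae_on; apply: filterS => t fgt /=.
  by rewrite in_itv/=; exact: fgt.
exact: fg'.
Qed.

Lemma ae_Rintegral_oo_le a b g G : integrable_oo a b g -> integrable_oo a b G ->
  (forall t, a < t < b -> 0 <= g t) -> (forall t, a < t < b -> 0 <= G t) ->
  ae_on a b (fun t => g t <= G t) ->
  \int[mu]_(t in `]a, b[) g t <= \int[mu]_(t in `]a, b[) G t.
Proof.
move=> ig iG g0 G0 gG; apply: fine_le.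
- by apply: integrable_fin_num => //; exact: measurable_oo.
- by apply: integrable_fin_num => //; exact: measurable_oo.
apply: ae_on_le_integral => [t tab|t tab|]; rewrite ?lee_fin; [exact: g0|exact: G0|].
by apply: ae_onS gG => t _; rewrite lee_fin.
Qed.

Lemma Rintegral_oo_subset a b c d g : a <= c -> d <= b -> integrable_oo a b g ->
  (forall t, 0 <= g t) ->
  \int[mu]_(t in `]c, d[) g t <= \int[mu]_(t in `]a, b[) g t.
Proof.
move=> ac db ig g0; have ig' := integrable_ooS ac db ig.
apply: fine_le.
- by apply: integrable_fin_num => //; exact: measurable_oo.
- by apply: integrable_fin_num => //; exact: measurable_oo.
have cdab : `]c, d[%classic `<=` (`]a, b[%classic : set R).
  by move=> t /=; rewrite !in_itv/= => /andP[? ?]; apply/andP; split; lra.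
apply: (@ge0_subset_integral _ _ _ mu _ _ (measurable_oo c d)
  (measurable_oo a b) (EFin \o g) _ _ cdab).
  exact: measurable_int ig.
by move=> t _; rewrite lee_fin.
Qed.

End Scalar.

(** * The Bochner integral *)

Section StrongMeasurability.
Context {R : realType} {H : completeNormedModType R}.
Local Notation mu := (@lebesgue_measure R).
Implicit Types (X Y : nspace R H) (u w : R -> H).

(** Strong measurability on the whole line, with convergence everywhere: a
    strongly measurable function has such a representative, whose norm is Borel
    measurable. *)
Definition smeas X u : Prop :=
  exists s_ : nat -> R -> H, (forall n, fin_meas (s_ n)) /\
    (forall n t, carrier X (s_ n t)) /\
    forall t, carrier X (u t) /\ cvg_in X (s_ ^~ t) (u t).

Lemma simple_funP X (s : R -> H) :
  simple_fun X s <-> fin_meas s /\ forall t, carrier X (s t).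
Proof. by split=> [[? ? ?]|[[? ?] ?]]; split. Qed.

Lemma smeas_carrier X u t : smeas X u -> carrier X (u t).
Proof. by move=> [s_ [_ [_ /(_ t)[]]]]. Qed.

Lemma smeas_strongly X a b u w : smeas X w -> ae_on a b (fun t => u t = w t) ->
  strongly_measurable X a b u.
Proof.
move=> [s_ [fs [Xs sw]]] uw; exists s_; split.
  by move=> n; apply/simple_funP.
by apply: ae_onS uw => t _ ->.
Qed.

Lemma smeas_if X u (D : set R) : normed_subspace X -> measurable D ->
  smeas X u -> smeas X (fun t => if t \in D then u t else 0).
Proof.
move=> XP mD [s_ [fs [Xs su]]]; have X0 : carrier X 0 by case: (carrier_lin XP).
exists (fun n t => if t \in D then s_ n t else 0); split=> [n|].
  exact: (fin_meas_op (fun (b : bool) x => if b then x else 0)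
    (fin_meas_indic mD) (fs n)).
split=> [n t|t]; first by case: ifP.
case: ifP => _; first exact: su.
split=> //; rewrite /cvg_in subrr (nrm0 XP); exact: cvg_cst.
Qed.

(** Putting [u] and its approximating simple functions to 0 outside []a, b[] minus a measurable null
    set turns convergence almost everywhere into convergence everywhere, and the functions cut in
    this way remain simple. *)
Lemma strongly_measurable_rep X a b u : normed_subspace X ->
  strongly_measurable X a b u ->
  exists2 w, smeas X w & ae_on a b (fun t => u t = w t).
Proof.
move=> XP [s_ [fs]]; rewrite /ae_on => -[N [mN N0 sN]].
pose D := `]a, b[%classic `&` ~` N.
have mD : measurable D.
  by apply: measurableI; [exact: measurable_itv|exact: measurableC].
have X0 : carrier X 0 by case: (carrier_lin XP).
exists (fun t => if t \in D then u t else 0).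
  exists (fun n t => if t \in D then s_ n t else 0); split=> [n|].
    have [fsn _] := (simple_funP X (s_ n)).1 (fs n).
    exact: (fin_meas_op (fun (b : bool) x => if b then x else 0)
      (fin_meas_indic mD) fsn).
  split=> [n t|t].
    by case: ifP => // _; have [_] := (simple_funP X (s_ n)).1 (fs n).
  case: ifPn => [/set_mem[]/=|_].
    rewrite in_itv/= => abt /(contra_notP (sN t)); apply.
    exact: abt.
  split=> //; rewrite /cvg_in subrr (nrm0 XP); exact: cvg_cst.
exists N; split=> // t /= /not_implyP[abt ne]; apply: contrapT => Nt; apply: ne.
by rewrite mem_set//; split=> //; rewrite /= in_itv.
Qed.

Lemma smeas_lipschitz X Y u (g : H -> H) (C : R) : normed_subspace X ->
  normed_subspace Y ->
  (forall x, carrier X x -> carrier Y (g x)) ->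
  (forall x y, carrier X x -> carrier X y ->
     nrm Y (g x - g y) <= C * nrm X (x - y)) ->
  smeas X u -> smeas Y (g \o u).
Proof.
move=> XP YP XY gC [s_ [fs [Xs su]]].
exists (fun n => g \o s_ n); split=> [n|]; first exact: fin_meas_comp.
split=> [n t|t]; first exact: XY.
have [Xu cu] := su t; split; first exact: XY.
apply: (@squeeze_cvgr _ _ _ _ (fun=> 0) (fun n => C * nrm X (s_ n t - u t))).
- apply: nearW => n /=; rewrite gC// andbT nrm_ge0//.
  by apply: lin_subspaceB; [exact: carrier_lin|exact: XY|exact: XY].
- exact: cvg_cst.
- by rewrite -[X in _ --> X](mulr0 C); apply: cvgM => //; exact: cvg_cst.
Qed.

Lemma smeas_lipschitz_fun X u (g : H -> R) (C : R) :
  (forall x y, carrier X x -> carrier X y ->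
     `|g x - g y| <= C * nrm X (x - y)) ->
  smeas X u -> measurable_fun setT (g \o u).
Proof.
move=> gC [s_ [fs [Xs su]]].
apply: (@measurable_fun_cvg _ _ _ setT (fun n => g \o s_ n)).
  by move=> n; apply: fin_meas_measurable_fun; exact: fin_meas_comp.
move=> t _; have [Xu cu] := su t.
apply/cvgrPdist_le => e e0 /=.
have C1 : 0 < `|C| + 1 by rewrite ltr_wpDl.
have /cvgrPdist_le/(_ _ (divr_gt0 e0 C1)) := cu.
apply: filterS => n /=; rewrite sub0r normrN => cn.
rewrite distrC; apply: le_trans (gC _ _ (Xs n t) Xu) _.
rewrite ler_pdivlMr// in cn; apply: le_trans cn.
apply: (@le_trans _ _ (`|C| * `|nrm X (s_ n t - u t)|)).
  by rewrite -normrM ler_norm.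
by rewrite mulrC ler_wpM2l// lerDl.
Qed.

Lemma smeas_op X u w (g : H -> H -> H) :
  (forall x y, carrier X x -> carrier X y -> carrier X (g x y)) ->
  (forall x y x' y', carrier X x -> carrier X y -> carrier X x' -> carrier X y' ->
     nrm X (g x y - g x' y') <= nrm X (x - x') + nrm X (y - y')) ->
  normed_subspace X -> smeas X u -> smeas X w -> smeas X (fun t => g (u t) (w t)).
Proof.
move=> gX gC XP [s_ [fs [Xs su]]] [r_ [fr [Xr rw]]].
exists (fun n t => g (s_ n t) (r_ n t)); split=> [n|]; first exact: fin_meas_op.
split=> [n t|t]; first exact: gX.
have [Xu cu] := su t; have [Xw cw] := rw t; split; first exact: gX.
apply: (@squeeze_cvgr _ _ _ _ (fun=> 0)
  (fun n => nrm X (s_ n t - u t) + nrm X (r_ n t - w t))).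
- apply: nearW => n /=; rewrite gC// andbT nrm_ge0//.
  by apply: lin_subspaceB; [exact: carrier_lin|exact: gX|exact: gX].
- exact: cvg_cst.
- by rewrite -[X in _ --> X](addr0 0); exact: (cvgD cu cw).
Qed.

Lemma smeasB X u w : normed_subspace X -> smeas X u -> smeas X w ->
  smeas X (fun t => u t - w t).
Proof.
move=> XP; have XL := carrier_lin XP; apply: (smeas_op (g := fun x y => x - y)) => //.
  by move=> x y Xx Xy; exact: lin_subspaceB.
move=> x y x' y' Xx Xy Xx' Xy'.
have -> : x - y - (x' - y') = (x - x') - (y - y').
  by rewrite !opprD !opprK addrACA.
by apply: nrmB => //; exact: lin_subspaceB.
Qed.

Lemma smeasD X u w : normed_subspace X -> smeas X u -> smeas X w ->
  smeas X (fun t => u t + w t).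
Proof.
move=> XP; have XL := carrier_lin XP; apply: (smeas_op (g := fun x y => x + y)) => //.
  by move=> x y Xx Xy; exact: lin_subspaceD.
move=> x y x' y' Xx Xy Xx' Xy'; rewrite opprD addrACA.
by apply: nrmD => //; exact: lin_subspaceB.
Qed.

Lemma smeas_cst X x : normed_subspace X -> carrier X x -> smeas X (fun=> x).
Proof.
move=> XP Xx; exists (fun n t => x); split=> [n|]; first exact: fin_meas_cst.
by split=> // t; split=> //; rewrite /cvg_in subrr (nrm0 XP); exact: cvg_cst.
Qed.

Import HBSimple.

Lemma smeas_scale X u (psi : R -> R) : normed_subspace X ->
  measurable_fun setT psi -> smeas X u -> smeas X (fun t => psi t *: u t).
Proof.
move=> XP mpsi [s_ [fs [Xs su]]]; have XL := carrier_lin XP.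
have [p_ pE] := approximation_sfun measurableT
  ((measurable_EFinP _ _).2 mpsi).
exists (fun n t => p_ n t *: s_ n t); split=> [n|].
  have fp : fin_meas (p_ n).
    split; first by have := @fimfunP _ _ (p_ n).
    by move=> x; exact: (@measurable_funPTI _ _ _ _ (p_ n) _ (measurable_set1 x)).
  exact: (fin_meas_op (fun (c : R) (x : H) => c *: x) fp (fs n)).
split=> [n t|t]; first exact: lin_subspaceZ.
have [Xu cu] := su t; split; first exact: lin_subspaceZ.
have cp : p_ n t @[n --> \oo] --> psi t.
  exact: (fine_cvg (pE t I : _ --> (psi t)%:E)).
apply: (@squeeze_cvgr _ _ _ _ (fun=> 0)
  (fun n => `|p_ n t| * nrm X (s_ n t - u t) + `|p_ n t - psi t| * nrm X (u t))).
- apply: nearW => n /=; apply/andP; split.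
    by apply: nrm_ge0 => //; apply: lin_subspaceB => //; exact: lin_subspaceZ.
  have -> : p_ n t *: s_ n t - psi t *: u t
    = p_ n t *: (s_ n t - u t) + (p_ n t - psi t) *: u t.
    by rewrite scalerBr scalerBl addrA subrK.
  rewrite -!(nrmZ XP)//; last exact: lin_subspaceB.
  by apply: nrmD => //; apply: lin_subspaceZ => //; exact: lin_subspaceB.
- exact: cvg_cst.
- rewrite -[X in _ --> X](addr0 0); apply: cvgD.
    rewrite -(mulr0 `|psi t|); apply: cvgM => //.
    exact: cvg_norm.
  rewrite -(mul0r (nrm X (u t))); apply: cvgMl => //.
  rewrite -(normr0 R) -(subrr (psi t)); apply: cvg_norm.
  by apply: cvgB => //; exact: cvg_cst.
Qed.

Lemma smeas_nrm X u : normed_subspace X -> smeas X u ->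
  measurable_fun setT (fun t => nrm X (u t)).
Proof.
move=> XP; apply: (smeas_lipschitz_fun (C := 1)) => x y Xx Xy.
have XL := carrier_lin XP; rewrite mul1r ler_norml.
have := nrm_triangle XP Xx Xy (XL.1); rewrite !subr0.
have := nrm_triangle XP Xy Xx (XL.1); rewrite !subr0 (nrmC XP Xy Xx).
by move=> ? ?; apply/andP; split; lra.
Qed.


End StrongMeasurability.

Section HilbertNorm.
Context {R : realType} {H : completeNormedModType R}.
Variable ip : H -> H -> R.
Hypothesis ipP : psd_form setT ip.
Hypothesis ipE : forall x, `|x| ^+ 2 = ip x x.

Lemma ip_norm_le x y : `|ip x y| <= `|x| * `|y|.
Proof.
have := psd_le_sqrt ipP (I : setT x) (I : setT y).
by rewrite -!ipE !sqrtr_sqr !normr_id.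
Qed.

Lemma ip_eq x y : (forall z, ip x z = ip y z) -> x = y.
Proof.
move=> xy; apply/eqP; rewrite -subr_eq0 -normr_eq0 -sqrf_eq0 ipE.
by rewrite (psdBl ipP)// xy subrr.
Qed.

Lemma ip_sum (I : Type) (r : seq I) (c : I -> R) (x : I -> H) z :
  ip (\sum_(i <- r) c i *: x i) z = \sum_(i <- r) c i * ip (x i) z.
Proof.
elim: r => [|i r IH]; first by rewrite !big_nil (psd0l ipP).
by rewrite !big_cons (psdDl ipP)// (psdZl ipP)// IH.
Qed.

End HilbertNorm.

Section SimpleIntegral.
Context {R : realType} {H : completeNormedModType R}.
Local Notation mu := (@lebesgue_measure R).
Implicit Types (X : nspace R H) (a b : R) (s u w : R -> H).

Lemma simple_integralE a b s : fin_meas s ->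
  simple_integral a b s
    = \sum_(x <- fset_set (range s)) fine (mu (`]a, b[ `&` s @^-1` [set x])) *: x.
Proof.
move=> [fs _]; rewrite /simple_integral.
rewrite -(fsbig_widen (range s) setT)//; first by rewrite fsbig_finite.
move=> x [_ /= sx]; rewrite preimage10 ?setI0 ?measure0 ?scale0r//.
Qed.

Lemma simple_integral_carrier X a b s : normed_subspace X ->
  fin_meas s -> (forall t, carrier X (s t)) -> carrier X (simple_integral a b s).
Proof.
move=> XP fs Xs; have XL := carrier_lin XP; rewrite simple_integralE// big_seq.
elim/big_ind : _ => //; first by case: XL.
  by move=> x y; exact: lin_subspaceD.
move=> x; rewrite in_fset_set; last by case: fs.
by move=> /set_mem[t _ <-]; exact: lin_subspaceZ.
Qed.

Lemma simple_integral_nrm X a b s : normed_subspace X ->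
  fin_meas s -> (forall t, carrier X (s t)) ->
  nrm X (simple_integral a b s) <= \int[mu]_(t in `]a, b[) nrm X (s t).
Proof.
move=> XP fs Xs; have XL := carrier_lin XP; rewrite simple_integralE//.
rewrite (fin_meas_Rintegral (nrm X) fs (measurable_oo a b) (mu_oo_lty a b)).
have : forall x, x \in enum_fset (fset_set (range s)) -> carrier X x.
  move=> x; rewrite -[_ \in _]/(x \in fset_set (range s)) in_fset_set; last by case: fs.
  by move=> /set_mem[t _ <-].
elim: (enum_fset (fset_set (range s))) => [|x r IH] Xr.
  by rewrite !big_nil (nrm0 XP).
rewrite !big_cons; apply: le_trans (nrmD XP _ _) _.
- by apply: lin_subspaceZ => //; apply: Xr; rewrite mem_head.
- rewrite big_seq; elim/big_ind : _ => //; first by case: XL.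
    by move=> y z; exact: lin_subspaceD.
  by move=> y yr; apply: lin_subspaceZ => //; apply: Xr; rewrite inE yr orbT.
apply: lerD.
  rewrite (nrmZ XP); last by apply: Xr; rewrite mem_head.
  by rewrite ger0_norm// fine_ge0.
by apply: IH => y yr; apply: Xr; rewrite inE yr orbT.
Qed.

Variable ip : H -> H -> R.
Hypothesis ipP : psd_form setT ip.
Hypothesis ipE : forall x, `|x| ^+ 2 = ip x x.

Lemma simple_integral_ip a b s z : fin_meas s ->
  ip (simple_integral a b s) z = \int[mu]_(t in `]a, b[) ip (s t) z.
Proof.
move=> fs; rewrite simple_integralE// (ip_sum ipP).
by rewrite (fin_meas_Rintegral (ip ^~ z) fs (measurable_oo a b) (mu_oo_lty a b)).
Qed.

(** Testing against every [z] reduces this to additivity of the scalar integral and replaces the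
    common refinement of the two partitions. *)
Lemma simple_integralB a b s s' : fin_meas s -> fin_meas s' ->
  simple_integral a b s - simple_integral a b s'
    = simple_integral a b (fun t => s t - s' t).
Proof.
move=> fs fs'; apply: (ip_eq ipP ipE) => z.
have fss' := fin_meas_op (fun x y : H => x - y) fs fs'.
have fi r : fin_meas r -> integrable_oo a b (fun t => ip (r t) z).
  move=> fr; apply: fin_meas_integrable; last exact: mu_oo_lty.
    exact: (fin_meas_comp (ip ^~ z) fr).
  exact: measurable_oo.
rewrite (psdBl ipP)// !simple_integral_ip// -Rintegral_ooB; try exact: fi.
by apply: Rintegral_oo_eq => t _; rewrite (psdBl ipP).
Qed.

End SimpleIntegral.

Section BochnerIntegral.
Context {R : realType} {H : completeNormedModType R}.
Local Notation mu := (@lebesgue_measure R).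
Variable ip : H -> H -> R.
Hypothesis ipP : psd_form setT ip.
Hypothesis ipE : forall x, `|x| ^+ 2 = ip x x.
Variables (X : nspace R H) (C : R).
Hypothesis XP : normed_subspace X.
Hypothesis XC : forall x, carrier X x -> `|x| <= C * nrm X x.
Variables (a b : R) (u w : R -> H).
Hypothesis Xw : smeas X w.
Hypothesis iw : integrable_oo a b (fun t => nrm X (w t)).
Hypothesis uw : ae_on a b (fun t => u t = w t).

Let XL : lin_subspace (carrier X) := carrier_lin XP.

Lemma smeas_ip z : measurable_fun setT (fun t => ip (w t) z).
Proof.
apply: (smeas_lipschitz_fun (X := X) (g := ip ^~ z) (C := C * `|z|)) => //.
move=> x y Xx Xy; rewrite -(psdBl ipP)//; apply: le_trans (ip_norm_le ipP ipE _ _) _.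
by rewrite mulrAC ler_wpM2r// XC//; exact: lin_subspaceB.
Qed.

Lemma integrable_oo_ip z : integrable_oo a b (fun t => ip (w t) z).
Proof.
apply: (integrable_oo_le (smeas_ip z) (integrable_ooZ (C * `|z|) iw)) => t _.
apply: le_trans (ip_norm_le ipP ipE _ _) _.
by rewrite mulrAC ler_wpM2r// XC//; exact: smeas_carrier Xw.
Qed.

Lemma fin_meas_smeas s : fin_meas s -> (forall t, carrier X (s t)) -> smeas X s.
Proof.
move=> fs Xs; exists (fun=> s); split=> //; split=> // t; split=> //.
by rewrite /cvg_in subrr (nrm0 XP); exact: cvg_cst.
Qed.

Lemma fin_meas_nrm_integrable s : fin_meas s ->
  integrable_oo a b (fun t => nrm X (s t)).
Proof.
move=> fs; apply: (fin_meas_integrable (s := fun t => nrm X (s t))).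
- exact: (fin_meas_comp (nrm X) fs).
- exact: measurable_oo.
- exact: mu_oo_lty.
Qed.

Lemma nrm_sub_integrable s : fin_meas s -> (forall t, carrier X (s t)) ->
  integrable_oo a b (fun t => nrm X (w t - s t)).
Proof.
move=> fs Xs; have Xws := smeasB XP Xw (fin_meas_smeas fs Xs).
apply: (integrable_oo_le (smeas_nrm XP Xws)
  (integrable_ooD iw (fin_meas_nrm_integrable fs))) => t _.
rewrite ger0_norm; last by apply: nrm_ge0 => //; exact: smeas_carrier Xws.
by apply: nrmB => //; exact: smeas_carrier Xw.
Qed.

Lemma LpN1_sub s : fin_meas s -> (forall t, carrier X (s t)) ->
  LpN X 1%E a b (fun t => u t - s t)
    = (\int[mu]_(t in `]a, b[) nrm X (w t - s t))%:E.
Proof.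
move=> fs Xs; have Xws := smeasB XP Xw (fin_meas_smeas fs Xs).
have ws0 t : 0 <= nrm X (w t - s t).
  by apply: nrm_ge0 => //; exact: smeas_carrier Xws.
rewrite /LpN Lnorm1 /Rintegral fineK; last first.
  apply: integrable_fin_num; first exact: measurable_oo.
  exact: nrm_sub_integrable.
rewrite [RHS]integral_mkcond; apply: ae_eq_nnintegral => //.
  by move=> t _; rewrite /patch; case: ifP => // _; rewrite lee_fin.
move: uw; rewrite /ae_on; apply: filterS => t uwt _.
rewrite /patch; case: ifPn => [|_]; last by rewrite abse0.
by rewrite in_oo => /uwt /= ->; rewrite ger0_norm.
Qed.

(** Pointwise convergence does not give convergence in L^1. Discarding [r_ n t] wherever its norm
    exceeds [nrm X (w t) + 1] provides the dominating function [2 * nrm X (w t) + 1], and at each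
    fixed [t] nothing is discarded once [n] is large. *)
Lemma simple_approx_L1 : exists s_ : nat -> R -> H,
  [/\ forall n, fin_meas (s_ n), forall n t, carrier X (s_ n t)
    & \int[mu]_(t in `]a, b[) nrm X (w t - s_ n t) @[n --> \oo] --> (0 : R)].
Proof.
have [r_ [fr [Xr rw]]] := Xw.
have mD n : measurable [set t | nrm X (r_ n t) <= nrm X (w t) + 1].
  have := @measurable_fun_le _ _ _ setT (fun t => nrm X (r_ n t))
    (fun t => nrm X (w t) + 1) measurableT.
  rewrite setTI; apply.
    by apply: fin_meas_measurable_fun; exact: (fin_meas_comp (nrm X) (fr n)).
  by apply: measurable_funD => //; exact: smeas_nrm.
pose s_ n t := if t \in [set t | nrm X (r_ n t) <= nrm X (w t) + 1]
               then r_ n t else 0.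
have fs n : fin_meas (s_ n).
  exact: (fin_meas_op (fun (b : bool) x => if b then x else 0)
    (fin_meas_indic (mD n)) (fr n)).
have Xs n t : carrier X (s_ n t) by rewrite /s_; case: ifP => // _; case: XL.
exists s_; split=> //.
have Xw' t : carrier X (w t) by exact: smeas_carrier Xw.
have sw n t : nrm X (s_ n t) <= nrm X (w t) + 1.
  rewrite /s_; case: ifPn => [/set_mem//|_]; rewrite (nrm0 XP).
  by have := nrm_ge0 XP (Xw' t); lra.
have ms n : measurable_fun setT (fun t => nrm X (w t - s_ n t)).
  by apply: smeas_nrm => //; apply: smeasB => //; exact: fin_meas_smeas.
have Xws n t : carrier X (w t - s_ n t) by exact: lin_subspaceB.
rewrite -[X in _ --> X](_ : \int[mu]_(t in `]a, b[) (0 : R) = _); last first.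
  by rewrite /Rintegral integral0.
apply: (Rintegral_oo_dct (G := fun t => 2 * nrm X (w t) + 1)) => //.
- by apply: integrable_ooD; [exact: integrable_ooZ|exact: integrable_oo_cst].
- move=> n t _; rewrite ger0_norm; last exact: nrm_ge0.
  by apply: le_trans (nrmB XP (Xw' t) (Xs n t)) _; have := sw n t; lra.
move=> t _; have [_ /cvgrPdist_le rt] := rw t.
have rt1 := rt 1 ltr01; apply/cvgrPdist_le => e e0.
near=> n.
have r1 : `|0 - nrm X (r_ n t - w t)| <= 1 by near: n.
have re : `|0 - nrm X (r_ n t - w t)| <= e by near: n; exact: rt.
rewrite sub0r normrN ger0_norm in r1; last by apply: nrm_ge0 => //; exact: lin_subspaceB.
suff -> : s_ n t = r_ n t by rewrite (nrmC XP).
rewrite /s_ mem_set//=.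
have -> : r_ n t = (r_ n t - w t) + w t by rewrite subrK.
apply: le_trans (nrmD XP _ _) _ => //; first exact: lin_subspaceB.
by rewrite addrC lerD2l.
Unshelve. all: by end_near. Qed.

(** The inner products of the simple integrals with [z] converge both to that of [x] and to the
    scalar integral. In particular the value of the Bochner integral does not depend on the
    approximating sequence. *)
Lemma is_bochner_ip x z : is_bochner_integral X a b u x ->
  ip x z = \int[mu]_(t in `]a, b[) ip (w t) z.
Proof.
move=> [_ Xx [s_ [fs sL sx]]].
have {fs}[fs Xs] : (forall n, fin_meas (s_ n)) /\ forall n t, carrier X (s_ n t).
  by split=> n; have [] := (simple_funP X (s_ n)).1 (fs n).
have c1 : ip (simple_integral a b (s_ n)) z @[n --> \oo] --> ip x z.
  apply/cvgrPdist_le => e e0.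
  have K0 : 0 < `|C| * `|z| + 1 by rewrite ltr_wpDl// mulr_ge0.
  move/cvgrPdist_le : sx => /(_ _ (divr_gt0 e0 K0)); apply: filterS => n /=.
  have XSI := simple_integral_carrier a b XP (fs n) (Xs n).
  rewrite sub0r normrN ler_pdivlMr// => sx; apply: le_trans sx.
  rewrite -(psdBl ipP)// (le_trans (ip_norm_le ipP ipE _ _))//.
  rewrite distrC; have Xd := lin_subspaceB XL XSI Xx.
  rewrite ger0_norm ?nrm_ge0//.
  apply: (@le_trans _ _ (`|C| * nrm X (simple_integral a b (s_ n) - x) * `|z|)).
    rewrite ler_wpM2r//; apply: le_trans (XC Xd) _.
    by rewrite ler_wpM2r ?nrm_ge0// ler_norm.
  by rewrite mulrAC mulrC ler_wpM2l ?nrm_ge0// lerDl.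
have c2 : ip (simple_integral a b (s_ n)) z @[n --> \oo]
    --> \int[mu]_(t in `]a, b[) ip (w t) z.
  apply/cvgrPdist_le => e e0.
  have K0 : 0 < `|C| * `|z| + 1 by rewrite ltr_wpDl// mulr_ge0.
  have sL' : \int[mu]_(t in `]a, b[) nrm X (w t - s_ n t) @[n --> \oo] --> (0 : R).
    apply: cvg_trans (fine_cvg sL).
    by apply: near_eq_cvg; apply: nearW => n /=; rewrite LpN1_sub.
  move/cvgrPdist_le : sL' => /(_ _ (divr_gt0 e0 K0)); apply: filterS => n /=.
  rewrite sub0r normrN ler_pdivlMr// => sxn; apply: le_trans sxn.
  have is_ : integrable_oo a b (fun t => ip (s_ n t) z).
    apply: fin_meas_integrable; last exact: mu_oo_lty.
      exact: (fin_meas_comp (ip ^~ z) (fs n)).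
    exact: measurable_oo.
  rewrite (simple_integral_ip ipP)// -Rintegral_ooB//; last exact: integrable_oo_ip.
  have iws := nrm_sub_integrable (fs n) (Xs n).
  have Xd t : carrier X (w t - s_ n t).
    by apply: lin_subspaceB => //; exact: smeas_carrier Xw.
  apply: (@le_trans _ _ (\int[mu]_(t in `]a, b[) (`|C| * `|z| * nrm X (w t - s_ n t)))).
    apply: Rintegral_oo_norm_le.
    - exact: integrable_ooB (integrable_oo_ip z) is_.
    - exact: integrable_ooZ.
    move=> t _; rewrite -(psdBl ipP)// (le_trans (ip_norm_le ipP ipE _ _))//.
    rewrite mulrAC ler_wpM2r//; apply: le_trans (XC (Xd t)) _.
    by rewrite ler_wpM2r ?nrm_ge0// ler_norm.
  rewrite Rintegral_ooZ// mulrC ler_pM ?mulr_ge0// ?lerDl ?ler_norm//.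
  by apply: Rintegral_ge0 => t _; exact: nrm_ge0.
by rewrite -(cvg_lim _ c1)// (cvg_lim _ c2).
Qed.

Lemma is_bochner_nrm x : is_bochner_integral X a b u x ->
  nrm X x <= \int[mu]_(t in `]a, b[) nrm X (w t).
Proof.
move=> [_ Xx [s_ [fs sL sx]]].
have {fs}[fs Xs] : (forall n, fin_meas (s_ n)) /\ forall n t, carrier X (s_ n t).
  by split=> n; have [] := (simple_funP X (s_ n)).1 (fs n).
have sL' : \int[mu]_(t in `]a, b[) nrm X (w t - s_ n t) @[n --> \oo] --> (0 : R).
  apply: cvg_trans (fine_cvg sL).
  by apply: near_eq_cvg; apply: nearW => n /=; rewrite LpN1_sub.
apply/ler_addgt0Pr => e e0; have e2 : 0 < e / 2 by rewrite divr_gt0.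
have [n []] : exists n, `|0 - nrm X (simple_integral a b (s_ n) - x)| <= e / 2 /\
    `|0 - \int[mu]_(t in `]a, b[) nrm X (w t - s_ n t)| <= e / 2.
  move/cvgrPdist_le : sL' => /(_ _ e2) => h1.
  move/cvgrPdist_le : sx => /(_ _ e2) => h2.
  by have [N _ /(_ N (leqnn N))[? ?]] := filterI h2 h1; exists N.
rewrite !sub0r !normrN => h1 h2.
have XSI := simple_integral_carrier a b XP (fs n) (Xs n).
have hx : nrm X x <= nrm X (simple_integral a b (s_ n))
    + nrm X (simple_integral a b (s_ n) - x).
  rewrite -[in leLHS](subKr (simple_integral a b (s_ n)) x).
  by apply: nrmB => //; exact: lin_subspaceB.
have hs := simple_integral_nrm a b XP (fs n) (Xs n).
have iws := nrm_sub_integrable (fs n) (Xs n).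
have : \int[mu]_(t in `]a, b[) nrm X (s_ n t)
    <= \int[mu]_(t in `]a, b[) (nrm X (w t) + nrm X (w t - s_ n t)).
  apply: Rintegral_oo_le; first exact: fin_meas_nrm_integrable.
    exact: integrable_ooD.
  move=> t _; rewrite -[in leLHS](subKr (w t) (s_ n t)).
  have Xwt : carrier X (w t) by exact: smeas_carrier Xw.
  by apply: nrmB => //; exact: lin_subspaceB.
rewrite Rintegral_ooD// => hi.
have := ler_norm (nrm X (simple_integral a b (s_ n) - x)).
have := ler_norm (\int[mu]_(t in `]a, b[) nrm X (w t - s_ n t)).
by lra.
Qed.

Hypothesis Xc : complete_in X.

Lemma is_bochner_ex : exists x, is_bochner_integral X a b u x.
Proof.
have [s_ [fs Xs sL]] := simple_approx_L1.
have Xd n t : carrier X (w t - s_ n t).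
  by apply: lin_subspaceB => //; exact: smeas_carrier Xw.
have XSI n := simple_integral_carrier a b XP (fs n) (Xs n).
have [x Xx sx] : exists2 x, carrier X x &
    cvg_in X (fun n => simple_integral a b (s_ n)) x.
  apply: Xc => // e e0; have e2 : 0 < e / 3 by rewrite divr_gt0.
  move/cvgrPdist_le : sL => /(_ _ e2) [N _ sN]; exists N => m n Nm Nn.
  rewrite (simple_integralB ipP ipE)//.
  have fmn := fin_meas_op (fun x y : H => x - y) (fs m) (fs n).
  have Xmn t : carrier X (s_ m t - s_ n t) by exact: lin_subspaceB.
  apply: le_lt_trans (simple_integral_nrm a b XP fmn Xmn) _.
  have im := nrm_sub_integrable (fs m) (Xs m).
  have in_ := nrm_sub_integrable (fs n) (Xs n).
  have : \int[mu]_(t in `]a, b[) nrm X (s_ m t - s_ n t)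
    <= \int[mu]_(t in `]a, b[) (nrm X (w t - s_ m t) + nrm X (w t - s_ n t)).
    apply: Rintegral_oo_le; first exact: fin_meas_nrm_integrable.
      exact: integrable_ooD.
    move=> t _; rewrite (nrmC XP (smeas_carrier t Xw) (Xs m t)).
    by apply: nrm_triangle => //; exact: smeas_carrier Xw.
  rewrite Rintegral_ooD//.
  have := sN _ Nm; have := sN _ Nn; rewrite /= !sub0r !normrN.
  have := ler_norm (\int[mu]_(t in `]a, b[) nrm X (w t - s_ m t)).
  have := ler_norm (\int[mu]_(t in `]a, b[) nrm X (w t - s_ n t)).
  by lra.
exists x; split=> //; first exact: smeas_strongly uw.
exists s_; split=> //; first by move=> n; apply/simple_funP.
under eq_fun do rewrite LpN1_sub//.
by apply: cvg_EFin => //; exact: nearW.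
Qed.

(** [bochner_integral] is a choice with default value 0, so it carries information only once
    existence is established, which is where completeness of [X] enters. *)
Lemma bochner_integralP : is_bochner_integral X a b u (bochner_integral X a b u).
Proof. by have [x xP] := is_bochner_ex; exact: (xgetPex 0 is_bochner_ex). Qed.

End BochnerIntegral.

(** * Weak derivatives *)

Section Smooth.
Context {R : realType}.
Implicit Types (f g : R -> R).

(** With the derivative given existentially, closure under sums, products and inverses follows by
    induction on [n], without any formula for iterated derivatives. *)
Fixpoint smoothn (n : nat) f : Prop :=
  if n is m.+1 then
    exists2 f', (forall x : R, is_derive x 1 f (f' x)) & smoothn m f'
  else True.

Lemma smoothn_derivable n f : (forall n, smoothn n f) ->
  forall x, derivable (derive1n n f) x 1.
Proof.
elim: n f => [|n IH] f sf x.
  by have [f' df _] := sf 1%N; have [] := df x.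
rewrite derive1Sn; apply: IH => m; have [f' df sf'] := sf m.+1.
rewrite (_ : derive1 f = f')//; apply/funext => y; rewrite derive1E.
by have := df y => -[_ ->].
Qed.

Lemma smoothnS n f : smoothn n.+1 f -> smoothn n f.
Proof.
elim: n f => [//|n IH] f [f' df sf]; exists f' => //.
exact: IH.
Qed.

Lemma smoothn_cst n c : smoothn n (fun=> c).
Proof. by elim: n c => [//|n IH] c; exists (fun=> 0) => // x; exact: is_derive_cst. Qed.

Lemma smoothnD n f g : smoothn n f -> smoothn n g -> smoothn n (fun x => f x + g x).
Proof.
elim: n f g => [//|n IH] f g [f' df sf] [g' dg sg].
by exists (fun x => f' x + g' x); [move=> x; exact: is_deriveD|exact: IH].
Qed.

Lemma smoothnM n f g : smoothn n f -> smoothn n g -> smoothn n (fun x => f x * g x).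
Proof.
elim: n f g => [//|n IH] f g sf sg.
have [f' df sf'] := sf; have [g' dg sg'] := sg.
exists (fun x => f x * g' x + f' x * g x).
  move=> x; apply: is_derive_eq (is_deriveM (df x) (dg x)) _.
  by rewrite /GRing.scale/= [g x * _]mulrC.
by apply: smoothnD; apply: IH => //; exact: smoothnS.
Qed.

Lemma smoothnB n f g : smoothn n f -> smoothn n g -> smoothn n (fun x => f x - g x).
Proof.
move=> sf sg; have := smoothnD sf (smoothnM (smoothn_cst n (-1)) sg).
by under eq_fun do rewrite mulN1r.
Qed.

Lemma is_derive_affine (f : R -> R) (c d x df : R) :
  is_derive (c * x + d) 1 f df -> is_derive x 1 (fun y => f (c * y + d)) (df * c).
Proof.
move=> Hf; have := @is_derive1_comp R f (fun y => c * y + d) x df c Hf.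
apply; apply: is_derive_eq (is_deriveD (is_deriveZ c (is_derive_id x 1))
  (is_derive_cst d x 1)) _.
by rewrite /GRing.scale/= addr0 mulr1.
Qed.

Lemma smoothn_affine n f c d : smoothn n f -> smoothn n (fun x => f (c * x + d)).
Proof.
elim: n f => [//|n IH] f [f' df sf].
exists (fun x => f' (c * x + d) * c); first by move=> x; exact: is_derive_affine.
by apply: smoothnM; [exact: IH|exact: smoothn_cst].
Qed.

Lemma smoothnV n f : (forall x, f x != 0) -> smoothn n f ->
  smoothn n (fun x => (f x)^-1).
Proof.
move=> f0; elim: n => [//|n IH] sf; have [f' df sf'] := sf.
exists (fun x => -1 * ((f x)^-1 * (f x)^-1) * f' x).
  move=> x; apply: is_derive_eq (is_deriveV (f0 x) (df x)) _.
  by rewrite /GRing.scale/= expr2 invfM mulN1r.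
have sV := IH (smoothnS sf).
apply: smoothnM => //; apply: smoothnM; first exact: smoothn_cst.
exact: smoothnM.
Qed.

(** The functions x^{-k} e^{-1/x}, extended by 0. The index [k] is there because the derivative of a
    member is a linear combination of members, so that all orders of smoothness are obtained at
    once. *)
Definition flat (k : nat) (x : R) : R :=
  if 0 < x then x^-1 ^+ k * expR (- x^-1) else 0.

Lemma flat_ge0 k x : 0 <= flat k x.
Proof.
rewrite /flat; case: ifP => // x0.
by rewrite mulr_ge0 ?expR_ge0// exprn_ge0// invr_ge0 ltW.
Qed.

Lemma flat_gt0 k x : 0 < x -> 0 < flat k x.
Proof. by move=> x0; rewrite /flat x0 mulr_gt0 ?expR_gt0// exprn_gt0// invr_gt0. Qed.

Lemma flat_le0 k x : x <= 0 -> flat k x = 0.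
Proof. by move=> x0; rewrite /flat ltNge x0. Qed.

(** One term of the exponential series bounds e^{1/x} from below. The bound serves for the
    derivative at 0: there the difference quotient of [flat k] is [flat k.+1], which must tend to
    0. *)
Lemma flat_le k x : 0 < x -> flat k x <= k.+1`!%:R * x.
Proof.
move=> x0; rewrite /flat x0 expRN.
have y0 : 0 < x^-1 by rewrite invr_gt0.
have := expR_ge1Dxn k (ltW y0) => h.
rewrite ler_pdivrMr ?expR_gt0//.
have : x^-1 ^+ k.+1 / k.+1`!%:R <= expR x^-1 by apply: le_trans h; rewrite lerDr.
have f0 : 0 < k.+1`!%:R :> R by rewrite ltr0n fact_gt0.
rewrite ler_pdivrMr// exprS => {}h.
rewrite -(@ler_pM2l _ x^-1)//; apply: le_trans h _.
by rewrite mulrA [k.+1`!%:R * x]mulrC mulrA mulVf ?gt_eqF// mul1r mulrC.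
Qed.

Lemma is_derive_flat k (x : R) :
  is_derive x 1 (flat k : R -> R) (flat k.+2 x - k%:R * flat k.+1 x).
Proof.
have [x0|x0|->] := ltrgtP x 0.
- rewrite !flat_le0 ?ltW// mulr0 subr0.
  apply: (@near_eq_is_derive _ _ _ (cst 0) (flat k) x 1 0).
  by near=> y; rewrite flat_le0// ltW//; near: y; exact: lt_nbhsl.
- have xn0 : x != 0 by rewrite gt_eqF.
  have dV : is_derive x 1 (fun y : R => y^-1) (- x ^- 2).
    apply: is_derive_eq (@is_deriveV _ (@id R) x 1 1 xn0 (is_derive_id x 1)) _.
    by rewrite /GRing.scale/= mulr1.
  have dN := is_deriveN dV.
  have dE := @is_derive1_comp R expR (fun y => - y^-1) x _ _ (is_derive_expR _) dN.
  have := @is_deriveX _ _ (fun y : R => y^-1) k x 1 _ dV.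
  rewrite exprfctE => dX.
  have dd : is_derive x 1 (fun y : R => y^-1 ^+ k * expR (- y^-1))
      (flat k.+2 x - k%:R * flat k.+1 x).
    apply: is_derive_eq (is_deriveM dX dE) _.
    rewrite /flat x0 opprK /GRing.scale/= -exprVn.
    by case: k {dX} => [|k] /=; [rewrite !expr0|rewrite !exprS]; ring.
  apply: near_eq_is_derive dd.
  by near=> y; rewrite /flat ifT//; near: y; exact: lt_nbhsr.
- rewrite !flat_le0// mulr0 subr0.
  have cv : h^-1 *: (flat k (h *: 1 + 0) - flat k 0) @[h --> 0^'] --> (0 : R).
    rewrite flat_le0//.
    apply: (@squeeze_cvgr _ _ _ _ (fun=> 0) (fun h : R => k.+2`!%:R * `|h|)).
    - near=> h; rewrite subr0 addr0 [h *: 1]mulr1.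
      have [h0|h0] := ltP 0 h; last first.
        by rewrite flat_le0// scaler0 lexx/= mulr_ge0.
      have -> : h^-1 *: flat k h = flat k.+1 h.
        by rewrite /flat h0 exprS /= -mulrA.
      by rewrite flat_ge0/= gtr0_norm// flat_le.
    - exact: cvg_cst.
    - rewrite -[X in _ --> X](mulr0 k.+2`!%:R).
      apply: cvgM; first exact: cvg_cst.
      have c0 : (fun h : R => h) h @[h --> 0^'] --> (0 : R) by exact: cvg_within.
      by have := cvg_norm c0; rewrite normr0; apply; apply: dnbhs_filter.
  by split; [apply/cvg_ex; exists 0|apply: cvg_lim].
Unshelve. all: by end_near. Qed.

Lemma smoothn_flat n k : smoothn n (flat k).
Proof.
elim: n k => [//|n IH] k; exists (fun x => flat k.+2 x - k%:R * flat k.+1 x).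
  by move=> x; exact: is_derive_flat.
by apply: smoothnB => //; apply: smoothnM => //; exact: smoothn_cst.
Qed.

End Smooth.

(** * A smooth transition from 0 to 1 *)

Section Step.
Context {R : realType}.
Local Notation mu := (@lebesgue_measure R).
Implicit Types (x : R).

(** The denominator never vanishes, since [x] and [1 - x] cannot both be nonpositive. *)
Definition smooth_step x : R := flat 0 x / (flat 0 x + flat 0 (1 - x)).

Let den x := flat 0 x + flat 0 (1 - x) : R.

Let den_gt0 x : 0 < den x.
Proof.
rewrite /den; have [x0|x0] := ltP 0 x.
  by apply: ltr_pwDl; [exact: flat_gt0|exact: flat_ge0].
by rewrite flat_le0// add0r flat_gt0// subr_gt0; lra.
Qed.

Lemma smooth_step0 x : x <= 0 -> smooth_step x = 0.
Proof. by move=> x0; rewrite /smooth_step flat_le0// mul0r. Qed.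

Lemma smooth_step1 x : 1 <= x -> smooth_step x = 1.
Proof.
move=> x1; rewrite /smooth_step [flat 0 (1 - x)]flat_le0 ?addr0 ?subr_le0//.
by rewrite divff// gt_eqF// flat_gt0//; lra.
Qed.

Lemma smooth_step_itv x : 0 <= smooth_step x <= 1.
Proof.
have := flat_ge0 0 x; have := flat_ge0 0 (1 - x); have := den_gt0 x.
rewrite /smooth_step -/(den x) => d0 ? ?; apply/andP; split.
  by rewrite divr_ge0// ltW.
by rewrite ler_pdivrMr// mul1r /den; lra.
Qed.

Lemma smoothn_smooth_step n : smoothn n smooth_step.
Proof.
have s1 : smoothn n (flat 0 : R -> R) by exact: smoothn_flat.
have s2 : smoothn n (fun x : R => flat 0 (1 - x)).
  have := smoothn_affine (-1) 1 s1.
  by under eq_fun do rewrite mulN1r addrC.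
apply: smoothnM => //; apply: smoothnV; last exact: smoothnD.
by move=> x; rewrite gt_eqF// den_gt0.
Qed.

Definition smooth_bump : R -> R := derive1 smooth_step.

Lemma is_derive_smooth_step x : is_derive x 1 smooth_step (smooth_bump x).
Proof.
have [s' ds _] := smoothn_smooth_step 1.
have [d1 d2] := ds x; split=> //.
by rewrite /smooth_bump derive1E.
Qed.

Lemma continuous_smooth_bump : continuous smooth_bump.
Proof.
have [s' ds [s'' ds' _]] := smoothn_smooth_step 2.
have -> : smooth_bump = s'.
  by apply/funext => x; rewrite /smooth_bump derive1E; have [_ ->] := ds x.
by move=> x; apply: differentiable_continuous; apply/derivable1_diffP; have [] := ds' x.
Qed.

(** The quotient rule, with [flat 2] as the derivative of [flat 0]. The explicit form makes the sign
    and the support visible. *)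
Lemma smooth_bumpE x : smooth_bump x =
  (flat 2 x * flat 0 (1 - x) + flat 0 x * flat 2 (1 - x)) / den x ^+ 2.
Proof.
have d1 : is_derive x 1 (flat 0 : R -> R) (flat 2 x).
  by apply: is_derive_eq (is_derive_flat 0 x) _; rewrite mul0r subr0.
have d2 : is_derive x 1 (fun x : R => flat 0 (1 - x)) (- flat 2 (1 - x)).
  have d : is_derive (-1 * x + 1) 1 (flat 0 : R -> R) (flat 2 (1 - x)).
    apply: is_derive_eq (is_derive_flat 0 _) _.
    by rewrite mul0r subr0; congr flat; ring.
  have := is_derive_affine d; rewrite mulrN1.
  by under eq_fun do rewrite mulN1r addrC.
have dn : den x != 0 by rewrite gt_eqF// den_gt0.
have dV : is_derive x 1 (fun x => (den x)^-1)
    (- (den x) ^- 2 *: (flat 2 x - flat 2 (1 - x))).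
  exact: (is_deriveV dn (is_deriveD d1 d2)).
have [_] := is_deriveM d1 dV; rewrite /smooth_bump derive1E => ->.
rewrite /GRing.scale/=; move: dn; rewrite /den => dn; field.
exact: dn.
Qed.

Lemma smooth_bump_ge0 x : 0 <= smooth_bump x.
Proof.
by rewrite smooth_bumpE divr_ge0 ?sqr_ge0// addr_ge0// mulr_ge0// flat_ge0.
Qed.

Lemma smooth_bump_out x : x <= 0 \/ 1 <= x -> smooth_bump x = 0.
Proof.
rewrite smooth_bumpE => -[x0|x1].
  by rewrite !(flat_le0 _ x0) !mul0r addr0 mul0r.
by rewrite !(flat_le0 _ (_ : 1 - x <= 0)) ?subr_le0// !mulr0 addr0 mul0r.
Qed.

End Step.

(** * From weak derivatives to increments, for scalar functions *)

Section WeakDerivative.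
Context {R : realType}.
Local Notation mu := (@lebesgue_measure R).
Implicit Types (g : R -> R) (p e x : R).

(** Smooth transition from 0 to 1 on [p, p + e]. *)
Definition ramp p e x : R := smooth_step (e^-1 * x + - (p / e)).

Definition ramp' p e x : R := smooth_bump (e^-1 * x + - (p / e)) * e^-1.

Let rampE p e x : 0 < e -> e^-1 * x + - (p / e) = (x - p) / e.
Proof. by move=> e0; field; rewrite gt_eqF. Qed.

Lemma is_derive_ramp p e x : is_derive x 1 (ramp p e) (ramp' p e x).
Proof. exact: (is_derive_affine (is_derive_smooth_step _)). Qed.

Lemma smoothn_ramp p e n : smoothn n (ramp p e).
Proof. exact: smoothn_affine (smoothn_smooth_step n). Qed.

Lemma ramp0 p e x : 0 < e -> x <= p -> ramp p e x = 0.
Proof.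
move=> e0 xp; rewrite /ramp rampE// smooth_step0//.
by rewrite pmulr_lle0 ?invr_gt0// subr_le0.
Qed.

Lemma ramp1 p e x : 0 < e -> p + e <= x -> ramp p e x = 1.
Proof.
move=> e0 xp; rewrite /ramp rampE// smooth_step1//.
by rewrite ler_pdivlMr// mul1r; lra.
Qed.

Lemma ramp_itv p e x : 0 <= ramp p e x <= 1.
Proof. exact: smooth_step_itv. Qed.

Lemma ramp'_ge0 p e x : 0 < e -> 0 <= ramp' p e x.
Proof. by move=> e0; rewrite mulr_ge0 ?smooth_bump_ge0// invr_ge0 ltW. Qed.

Lemma ramp'_out p e x : 0 < e -> ~~ (p <= x <= p + e) -> ramp' p e x = 0.
Proof.
move=> e0 xp; rewrite /ramp' rampE// smooth_bump_out ?mul0r//.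
move: xp; rewrite negb_and -!ltNge => /orP[xp|xp]; [left|right].
  by rewrite pmulr_lle0 ?invr_gt0//; lra.
by rewrite ler_pdivlMr// mul1r; lra.
Qed.

Lemma continuous_ramp' p e : continuous (ramp' p e).
Proof.
move=> x; apply: cvgM; last exact: cvg_cst.
apply: (@continuous_comp _ _ _ (fun x => e^-1 * x + - (p / e)) smooth_bump).
  by apply: cvgD; [apply: cvgM; [exact: cvg_cst|exact: cvg_id]|exact: cvg_cst].
exact: continuous_smooth_bump.
Qed.

Lemma continuous_ramp p e : continuous (ramp p e).
Proof.
move=> x; apply: differentiable_continuous; apply/derivable1_diffP.
by have [] := is_derive_ramp p e x.
Qed.

Lemma continuous_measurable g : continuous g -> measurable_fun setT g.
Proof. by move=> cg; exact: continuous_measurable_fun. Qed.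

Lemma continuous_integrable_oo a b g : continuous g -> integrable_oo a b g.
Proof.
move=> cg.
have ic := @continuous_compact_integrable _ g `[a, b] (@segment_compact _ a b)
  (continuous_subspaceT cg).
apply: (integrableS _ (measurable_oo a b) _ ic) => //.
by move=> x /=; rewrite !in_itv/= => /andP[? ?]; apply/andP; split; exact: ltW.
Qed.

Lemma ramp'_Rintegral p e T : 0 < e -> 0 <= p -> p + e <= T ->
  \int[mu]_(x in `]0, T[) ramp' p e x = 1.
Proof.
move=> e0 p0 pT; have T0 : 0 < T by lra.
have cr := @continuous_ramp p e.
have := @continuous_FTC2 R (ramp' p e) (ramp p e) 0 T T0
  (continuous_subspaceT (@continuous_ramp' p e)) _ _.
have -> : ramp p e T = 1 by rewrite ramp1.
have -> : ramp p e 0 = 0 by rewrite ramp0.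
rewrite /Rintegral integral_itv_bndoo; last first.
  by apply/measurable_EFinP; apply: measurable_funTS;
    exact: continuous_measurable (@continuous_ramp' p e).
move=> ->; first by rewrite sube0.
  split; [|exact/cvg_at_right_filter/cr|exact/cvg_at_left_filter/cr].
  by move=> x _; have [] := is_derive_ramp p e x.
by move=> x _; rewrite derive1E; have [_ ->] := is_derive_ramp p e x.
Qed.

(** [ramp' p e] is a probability density carried by [[p, p + e]], so integrating against it is a
    weighted mean over that interval. *)
Lemma ramp'_average p e T g (c d : R) : 0 < e -> 0 <= p -> p + e <= T ->
  continuous g -> (forall x, p <= x <= p + e -> `|g x - c| <= d) ->
  `|\int[mu]_(x in `]0, T[) (ramp' p e x * g x) - c| <= d.
Proof.
move=> e0 p0 pT cg gc.
have cr := @continuous_ramp' p e.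
have crg : continuous (fun x => ramp' p e x * g x).
  by move=> x; apply: cvgM; [exact: cr|exact: cg].
have d0 : 0 <= d by apply: le_trans (gc p _) => //; rewrite lexx/= lerDl ltW.
have E x : ramp' p e x * c = c * ramp' p e x by rewrite mulrC.
have ic : c = \int[mu]_(x in `]0, T[) (c * ramp' p e x).
  by rewrite Rintegral_ooZ ?ramp'_Rintegral ?mulr1//; exact: continuous_integrable_oo.
have id : d = \int[mu]_(x in `]0, T[) (d * ramp' p e x).
  by rewrite Rintegral_ooZ ?ramp'_Rintegral ?mulr1//; exact: continuous_integrable_oo.
have iZ k : integrable_oo 0 T (fun x => k * ramp' p e x).
  by apply: integrable_ooZ; exact: continuous_integrable_oo.
rewrite [in leLHS]ic [in leRHS]id -Rintegral_ooB//; last exact: continuous_integrable_oo.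
apply: Rintegral_oo_norm_le => //.
  by apply: integrable_ooB => //; exact: continuous_integrable_oo.
move=> x _; have r0 := ramp'_ge0 p x e0.
rewrite mulrC -mulrBl normrM (ger0_norm r0).
have [xp|xp] := boolP (p <= x <= p + e); first by rewrite ler_wpM2r// gc.
by rewrite ramp'_out// !mulr0.
Qed.

Lemma dist_sub_le (a b c d e : R) : `|a - c| <= e / 2 -> `|b - d| <= e / 2 ->
  `|c - d - (a - b)| <= e.
Proof.
rewrite !ler_norml => /andP[? ?] /andP[? ?]; apply/andP; split; lra.
Qed.

(** The test functions approximate the indicator of []s, t[]. Their derivatives concentrate at [s]
    with mass 1 and at [t] with mass -1, which produces [g s - g t] by continuity of [g]; the
    integral with [g'] converges by domination. *)
Lemma weak_derivative_FTC T g g' : continuous g -> measurable_fun setT g' ->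
  integrable_oo 0 T g' ->
  (forall psi, test_function T psi ->
     \int[mu]_(x in `]0, T[) (derive1 psi x * g x)
       = - \int[mu]_(x in `]0, T[) (psi x * g' x)) ->
  forall s t, 0 <= s -> s < t -> t <= T ->
    g t - g s = \int[mu]_(x in `]s, t[) g' x.
Proof.
move=> cg mg' ig' gg' s t s0 st tT.
(* The ramps will occupy [[s + e, s + 2 e]] and [[t - 2 e, t - e]]. As [4 e <= t - s] they do not
   overlap, and the support stays strictly inside []0, T[] even for [s = 0] and [t = T]. *)
pose e (n : nat) := (t - s) / (4 * n.+1%:R).
have n0 n : 0 < (n.+1%:R : R) by [].
have e0 n : 0 < e n by rewrite divr_gt0 ?subr_gt0// mulr_gt0.
have e4 n : 4 * e n <= t - s.
  rewrite (_ : 4 * e n = (t - s) / n.+1%:R); last by rewrite /e; field; exact: lt0r_neq0.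
  by rewrite ler_pdivrMr// ler_peMr ?subr_ge0 ?(ltW st)// ler1n.
have ec : e n @[n --> \oo] --> (0 : R).
  rewrite -[X in _ --> X](mulr0 ((t - s) / 4)).
  have -> : e = fun n => (t - s) / 4 * harmonic n.
    by apply/funext => n; rewrite /e /harmonic /=; field; exact: lt0r_neq0.
  by apply: cvgM; [exact: cvg_cst|exact: cvg_harmonic].
pose psi n x := ramp (s + e n) (e n) x - ramp (t - 2 * e n) (e n) x.
pose psi' n x := ramp' (s + e n) (e n) x - ramp' (t - 2 * e n) (e n) x.
have dpsi n x : is_derive x 1 (psi n) (psi' n x).
  exact: (is_deriveB (is_derive_ramp _ _ _) (is_derive_ramp _ _ _)).
have psi'E n : derive1 (psi n) = psi' n.
  by apply/funext => x; rewrite derive1E; have [_ ->] := dpsi n x.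
have tpsi n : test_function T (psi n).
  split.
    by move=> k x; apply: smoothn_derivable => m; apply: smoothnB; exact: smoothn_ramp.
  have := e0 n; have := e4 n => e4n e0n.
  exists (s + e n), (t - e n); split; [lra|lra|move=> x].
  rewrite negb_and -!ltNge /psi => /orP[xs|xt].
    by rewrite !ramp0 ?subrr//; lra.
  by rewrite !ramp1 ?subrr//; lra.
have cpsi n : continuous (psi n).
  by move=> x; apply: cvgB; exact: continuous_ramp.
have cA : \int[mu]_(x in `]0, T[) (derive1 (psi n) x * g x) @[n --> \oo] --> g s - g t.
  apply/cvgrPdist_le => d d0; have d2 : 0 < d / 2 by rewrite divr_gt0.
  have /cvgrPdist_le/(_ _ d2)/nbhs_ballP[r1 /= r10 gs] := cg s.
  have /cvgrPdist_le/(_ _ d2)/nbhs_ballP[r2 /= r20 gt] := cg t.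
  have r10' : 0 < r1 / 2 by rewrite divr_gt0.
  have r20' : 0 < r2 / 2 by rewrite divr_gt0.
  near=> n.
  have en1 : `|0 - e n| < r1 / 2.
    by near: n; move/cvgrPdist_lt : ec => /(_ _ r10').
  have en2 : `|0 - e n| < r2 / 2.
    by near: n; move/cvgrPdist_lt : ec => /(_ _ r20').
  have := e0 n; have := e4 n => e4n e0n.
  rewrite !sub0r !normrN !gtr0_norm// in en1 en2.
  rewrite psi'E.
  have cr p : continuous (fun x => ramp' p (e n) x * g x).
    by move=> x; apply: cvgM; [exact: continuous_ramp'|exact: cg].
  have -> : \int[mu]_(x in `]0, T[) (psi' n x * g x) =
      \int[mu]_(x in `]0, T[) (ramp' (s + e n) (e n) x * g x)
      - \int[mu]_(x in `]0, T[) (ramp' (t - 2 * e n) (e n) x * g x).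
    rewrite -Rintegral_ooB; try exact: continuous_integrable_oo.
    by apply: Rintegral_oo_eq => x _; rewrite mulrBl.
  have h1 : `|\int[mu]_(x in `]0, T[) (ramp' (s + e n) (e n) x * g x) - g s| <= d / 2.
    apply: ramp'_average => //; [lra|lra|move=> x /andP[x1 x2]].
    by rewrite distrC; apply: gs; rewrite /ball/= ltr_norml; apply/andP; split; lra.
  have h2 : `|\int[mu]_(x in `]0, T[) (ramp' (t - 2 * e n) (e n) x * g x) - g t| <= d / 2.
    apply: ramp'_average => //; [lra|lra|move=> x /andP[x1 x2]].
    by rewrite distrC; apply: gt; rewrite /ball/= ltr_norml; apply/andP; split; lra.
  exact: dist_sub_le h1 h2.
have cB : \int[mu]_(x in `]0, T[) (psi n x * g' x) @[n --> \oo]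
    --> \int[mu]_(x in `]s, t[) g' x.
  have -> : \int[mu]_(x in `]s, t[) g' x = \int[mu]_(x in `]0, T[) (g' \_ `]s, t[) x.
    rewrite -Rintegral_mkcondr; congr (Rintegral _ _ _).
    apply/seteqP; split=> x /=; rewrite !in_itv/=; last by case.
    by move=> /andP[? ?]; split=> //; apply/andP; split; lra.
  apply: (Rintegral_oo_dct (G := fun x => `|g' x|)).
  - move=> n; apply: measurable_funM => //.
    exact: continuous_measurable (cpsi n).
  - apply/(measurable_restrictT _ _).1 => //.
    exact: measurable_funTS.
  - exact: integrable_oo_norm.
  - move=> n x _; rewrite normrM ler_piMl//.
    have /andP[? ?] := ramp_itv (s + e n) (e n) x.
    have /andP[? ?] := ramp_itv (t - 2 * e n) (e n) x.
    by rewrite ler_norml /psi; apply/andP; split; lra.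
  move=> x _; rewrite /patch; case: ifPn; rewrite in_oo => sxt.
    have /andP[sx xt] := sxt.
    apply: (@cvg_trans _ ((fun=> g' x) @ \oo)); last exact: cvg_cst.
    apply: near_eq_cvg; near=> n.
    have en1 : `|0 - e n| < (x - s) / 2.
      near: n; have x0 : 0 < (x - s) / 2 by rewrite divr_gt0// subr_gt0.
      by move/cvgrPdist_lt : ec => /(_ _ x0).
    have en2 : `|0 - e n| < (t - x) / 2.
      near: n; have x0 : 0 < (t - x) / 2 by rewrite divr_gt0// subr_gt0.
      by move/cvgrPdist_lt : ec => /(_ _ x0).
    have := e0 n; have := e4 n => e4n e0n.
    rewrite !sub0r !normrN !gtr0_norm// in en1 en2.
    by rewrite /psi ramp1 ?ramp0 ?subr0 ?mul1r//; lra.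
  apply: (@cvg_trans _ ((fun=> 0) @ \oo)); last exact: cvg_cst.
  apply: near_eq_cvg; apply: nearW => n.
  have := e0 n; have := e4 n => e4n e0n.
  move: sxt; rewrite negb_and -!leNgt /psi => /orP[xs|tx].
    by rewrite !ramp0 ?subrr ?mul0r//; lra.
  by rewrite !ramp1 ?subrr ?mul0r//; lra.
have cA' : \int[mu]_(x in `]0, T[) (derive1 (psi n) x * g x) @[n --> \oo]
    --> - \int[mu]_(x in `]s, t[) g' x.
  rewrite (_ : (fun n => _) = (fun n => - \int[mu]_(x in `]0, T[) (psi n x * g' x))).
    exact: cvgN cB.
  by apply/funext => n; rewrite gg'.
have := cvg_lim (@norm_hausdorff _ _) cA.
by rewrite (cvg_lim (@norm_hausdorff _ _) cA') => E; rewrite -opprB -E opprK.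
Unshelve. all: by end_near. Qed.

End WeakDerivative.

(** * Averages of the exact solution *)

Section LpRepresentatives.
Context {R : realType} {H : completeNormedModType R}.
Local Notation mu := (@lebesgue_measure R).
Variables (X : nspace R H) (a b : R).
Hypothesis XP : normed_subspace X.
Implicit Types (u w : R -> H).

Lemma LpN1E u : LpN X 1%E a b u = (\int[mu]_(t in `]a, b[) `|nrm X (u t)|%:E)%E.
Proof.
rewrite /LpN Lnorm1 [RHS]integral_mkcond; apply: eq_integral => t _.
by rewrite /patch; case: ifP; rewrite ?abse0.
Qed.

Lemma LpN2E u :
  LpN X 2%:E a b u = ((\int[mu]_(t in `]a, b[) (nrm X (u t) ^+ 2)%:E) `^ 2^-1)%E.
Proof.
rewrite /LpN unlock /=; congr poweR; rewrite [RHS]integral_mkcond.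
apply: eq_integral => t _; rewrite /patch; case: ifP => _ /=.
  by rewrite powR_mulrn// -normrX ger0_norm// sqr_ge0.
by rewrite normr0 powR0.
Qed.

Lemma LpN1_integrable u w : smeas X w -> ae_on a b (fun t => u t = w t) ->
  (LpN X 1%E a b u < +oo)%E -> integrable_oo a b (fun t => nrm X (w t)).
Proof.
move=> Xw uw uoo; have w0 t : 0 <= nrm X (w t).
  by apply: nrm_ge0 => //; exact: smeas_carrier Xw.
apply/integrableP; split.
  by apply/measurable_EFinP; apply: measurable_funTS; exact: smeas_nrm.
apply: le_lt_trans uoo; rewrite LpN1E; apply: ae_on_le_integral => //.
by apply: ae_onS uw => t _ ->.
Qed.

Lemma Lp1_rep u : Lp X 1%E a b u -> exists w,
  [/\ smeas X w, ae_on a b (fun t => u t = w t)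
    & integrable_oo a b (fun t => nrm X (w t))].
Proof.
move=> [/(strongly_measurable_rep XP)[w Xw uw] uoo].
by exists w; split => //; exact: LpN1_integrable uoo.
Qed.

Lemma integrable_oo_sqr w : smeas X w ->
  integrable_oo a b (fun t => nrm X (w t) ^+ 2) ->
  integrable_oo a b (fun t => nrm X (w t)).
Proof.
move=> Xw i2.
apply: (integrable_oo_le (smeas_nrm XP Xw)
  (integrable_ooD (integrable_oo_cst a b 1) i2)) => t _.
rewrite ger0_norm; last by apply: nrm_ge0 => //; exact: smeas_carrier Xw.
have : 0 <= (nrm X (w t) - 1) ^+ 2 + nrm X (w t) ^+ 2 + 1.
  by rewrite addr_ge0// addr_ge0 ?sqr_ge0.
by nra.
Qed.

Lemma Lp2_rep u : Lp X 2%:E a b u -> exists w,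
  [/\ smeas X w, ae_on a b (fun t => u t = w t)
    & integrable_oo a b (fun t => nrm X (w t) ^+ 2)].
Proof.
move=> [/(strongly_measurable_rep XP)[w Xw uw] uoo].
exists w; split => //; apply/integrableP; split.
  apply/measurable_EFinP; apply: measurable_funTS.
  by apply: measurable_funX; exact: smeas_nrm.
have : (LpN X 2%:E a b u `^ 2 < +oo)%E by apply: poweR_lty.
rewrite LpN2E -poweRrM mulVf// poweRe1; last first.
  by apply: integral_ge0 => t _; rewrite lee_fin sqr_ge0.
apply: le_lt_trans; apply: ae_on_le_integral => [t _|t _|].
- by rewrite lee_fin.
- by rewrite lee_fin sqr_ge0.
- by apply: ae_onS uw => t _ ->; rewrite /= ger0_norm// sqr_ge0.
Qed.

(** An essential bound becomes a bound at every [t] once the representative is put to 0 on the set,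
    null within []a, b[], where its norm exceeds [M]. *)
Lemma Lpoo_rep u : Lp X +oo%E a b u -> exists w M,
  [/\ smeas X w, ae_on a b (fun t => u t = w t), 0 <= M
    & forall t, nrm X (w t) <= M].
Proof.
move=> [/(strongly_measurable_rep XP)[w Xw uw]].
rewrite /LpN unlock mu_setT_gt0 => uoo.
have [M uM] : exists M : R, ae_on a b (fun t => nrm X (u t) <= M).
  set e := ess_sup _ _ in uoo.
  have eM : (e <= (fine (maxe e 0%E))%:E)%E.
    rewrite fineK ?le_max ?lexx// ge0_fin_numE; last by rewrite le_max lexx orbT.
    by rewrite gt_max uoo ltry.
  exists (fine (maxe e 0%E)); rewrite /ae_on.
  have := ess_sup_ge mu (abse \o (EFin \o (nrm X \o u)) \_ `]a, b[%classic).
  apply: filterS => t /= ut abt; rewrite -lee_fin; apply: le_trans eM.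
  apply: le_trans ut; rewrite /patch in_oo abt /=.
  by rewrite lee_fin ler_norm.
have mD : measurable [set t | nrm X (w t) <= M].
  have := @measurable_fun_le _ _ _ setT (fun t => nrm X (w t))
    (fun t => M) measurableT.
  by rewrite setTI; apply => //; exact: smeas_nrm.
exists (fun t => if t \in [set t | nrm X (w t) <= M] then w t else 0), (Num.max M 0).
split=> //.
- exact: smeas_if.
- apply: ae_onS2 uw uM => t _ -> wM.
  by rewrite mem_set.
- by rewrite le_max lexx orbT.
move=> t; case: ifPn => [/set_mem/= wM|_]; first by rewrite le_max wM.
by rewrite (nrm0 XP) le_max lexx orbT.
Qed.

End LpRepresentatives.

Section ZeroAverages.
Context {R : realType}.
Local Notation mu := (@lebesgue_measure R).

(** The primitive of [g] is constant on []0, T[], and by Lebesgue differentiation its derivative is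
    [g] almost everywhere. Extension by 0 makes [g] integrable on the whole line. *)
Lemma ae_eq0_Rintegral_oo (T : R) (g : R -> R) : measurable_fun setT g ->
  integrable_oo 0 T g ->
  (forall t, 0 < t -> t <= T -> \int[mu]_(x in `]0, t[) g x = 0) ->
  ae_on 0 T (fun t => g t = 0).
Proof.
move=> mg ig g0; pose G := g \_ `]0, T[.
have iG : mu.-integrable [set: R] (EFin \o G).
  have := (@integrable_mkcond _ _ _ mu `]0, T[ (EFin \o g) (measurable_oo 0 T)).1 ig.
  by rewrite -restrict_EFin.
have lG : locally_integrable [set: R] G.
  by apply: integrable_locally => //; exact: measurable_itv.
have iG' y : mu.-integrable [set` Interval (BLeft 0) (BRight y)] (EFin \o G).
  by apply: (integrableS measurableT _ _ iG) => //; exact: measurable_itv.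
have := FTC1 iG' lG; apply: filterS => t /= Ft /andP[t0 tT].
have t0' : (0%:E < t%:E)%E by rewrite lte_fin.
have [_ F't] := Ft t0'.
have -> : g t = G t by rewrite /G patchE mem_set//= in_itv/= t0 tT.
rewrite -{}F't derive1E.
have d0 : is_derive t 1 (cst 0 : R -> R) 0 by exact: is_derive_cst.
suff d : is_derive t 1 (fun x => \int[mu]_(t in [set` Interval (BLeft 0) (BRight x)]) G t) 0.
  by case: d.
apply: near_eq_is_derive d0.
have near_t : \forall x \near t, 0 < x < T.
  by near=> x; apply/andP; split; near: x; [exact: lt_nbhsr|exact: lt_nbhsl].
apply: filterS near_t => x /andP[x0 xT].
rewrite /Rintegral integral_itv_bndoo; last first.
  apply/measurable_EFinP/measurable_funTS.
  by apply/(measurable_restrictT _ _).1 => //; exact: measurable_funTS.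
rewrite -[LHS](g0 x x0 (ltW xT)); apply: Rintegral_oo_eq => y /andP[y0 yx].
by rewrite /G patchE mem_set//= in_itv/= y0 (lt_trans yx).
Unshelve. all: by end_near. Qed.

End ZeroAverages.

(** * Vector integrals characterised by their inner products *)

Section WeakIntegral.
Context {R : realType} {H : completeNormedModType R}.
Local Notation mu := (@lebesgue_measure R).
Variable ip : H -> H -> R.
Hypothesis ipP : psd_form setT ip.
Hypothesis ipE : forall x, `|x| ^+ 2 = ip x x.
Implicit Types (a b s t T : R) (u w : R -> H) (x y z : H).

Lemma complete_whole : complete_in (@whole R H).
Proof.
move=> u _ cu.
have : cauchy (u @ \oo).
  apply/cauchy_ballP => e e0; have [N uN] := cu _ e0.
  exists (u @` [set n | (N <= n)%N], u @` [set n | (N <= n)%N]).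
    by split; exists N => // n Nn; exists n.
  move=> [_ _] [[m Nm <-] [n Nn <-]]; rewrite -ball_normE /=.
  exact: uN.
move=> /cauchy_cvgP/cvg_ex[x ux]; exists x => //.
rewrite /cvg_in /= -(normr0 H); apply: cvg_norm.
by rewrite -(subrr x); apply: cvgB => //; exact: cvg_cst.
Qed.

(** The Pettis integral. Linearity and commutation with operators become scalar identities, while
    existence and norm bounds are taken from the Bochner integral. *)
Definition weak_integral a b u y : Prop :=
  forall z, ip y z = \int[mu]_(t in `]a, b[) ip (u t) z.

Lemma weak_integral_uniq a b u y y' :
  weak_integral a b u y -> weak_integral a b u y' -> y = y'.
Proof. by move=> uy uy'; apply: (ip_eq ipP ipE) => z; rewrite uy uy'. Qed.

Lemma weak_integral_ex (X : nspace R H) (C : R) a b u : normed_subspace X ->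
  complete_in X -> (forall x, carrier X x -> `|x| <= C * nrm X x) ->
  smeas X u -> integrable_oo a b (fun t => nrm X (u t)) ->
  exists y, [/\ carrier X y, weak_integral a b u y
    & nrm X y <= \int[mu]_(t in `]a, b[) nrm X (u t)].
Proof.
move=> XP Xc XC Xu iu.
have uu : ae_on a b (fun t => u t = u t) by exact: ae_onW.
have bP := bochner_integralP ipP ipE XP Xu iu uu Xc.
exists (bochner_integral X a b u); split.
- by case: bP.
- by move=> z; exact: (is_bochner_ip ipP ipE XP XC Xu iu uu).
- exact: (is_bochner_nrm XP Xu iu uu bP).
Qed.

Lemma weak_integral_norm a b u y : smeas whole u ->
  integrable_oo a b (fun t => `|u t|) -> weak_integral a b u y ->
  `|y| <= \int[mu]_(t in `]a, b[) `|u t|.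
Proof.
move=> mu_ iu uy.
have [] := weak_integral_ex (X := whole) (C := 1) (normed_subspace_whole) complete_whole
  _ mu_ iu; first by move=> x _; rewrite mul1r.
by move=> y' [_ uy']; rewrite (weak_integral_uniq uy uy').
Qed.

Lemma whole_ip_measurable u z : smeas whole u ->
  measurable_fun setT (fun t => ip (u t) z).
Proof.
move=> mu_; apply: (smeas_ip ipP ipE (X := whole) (C := 1) normed_subspace_whole) => //.
by move=> x _; rewrite mul1r.
Qed.

Lemma whole_ip_integrable a b u z : smeas whole u ->
  integrable_oo a b (fun t => `|u t|) -> integrable_oo a b (fun t => ip (u t) z).
Proof.
move=> mu_ iu; apply: (integrable_oo_ip ipP ipE (X := whole) (C := 1) normed_subspace_whole) => //.
by move=> x _; rewrite mul1r.
Qed.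

(* Self-adjoint operators are closed, hence commute with the integral. *)
Lemma weak_integral_selfadjoint a b (A : operator H) u w x y :
  selfadjoint ip A ->
  smeas whole u -> integrable_oo a b (fun t => `|u t|) ->
  smeas whole w -> integrable_oo a b (fun t => `|w t|) ->
  ae_on a b (fun t => dom A (u t) /\ w t = A (u t)) ->
  weak_integral a b u x -> weak_integral a b w y -> dom A x /\ y = A x.
Proof.
move=> [_ sA] mu_ iu mw iw uw ux wy; apply/sA => z Az.
rewrite (psdC ipP)// ux (psdC ipP)// wy.
apply: ae_Rintegral_oo_eq; try exact: whole_ip_integrable.
apply: ae_onS uw => t _ [Au wE].
by have := (sA (u t) (w t)).2 (conj Au wE) z Az => E; rewrite (psdC ipP)// E (psdC ipP).
Qed.

(** For each [z] the product [ip (u t) z] vanishes off a null set that depends on [z]. It is enough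
    to use the countably many values of the simple functions approximating [u]: their limit at [t]
    is [u t] itself, which gives [ip (u t) (u t) = 0]. *)
Lemma ae_eq0_weak_integral (T : R) u : smeas whole u ->
  integrable_oo 0 T (fun t => `|u t|) ->
  (forall t, 0 < t -> t <= T -> weak_integral 0 t u 0) ->
  ae_on 0 T (fun t => u t = 0).
Proof.
move=> mu_ iu u0.
have uz z : ae_on 0 T (fun t => ip (u t) z = 0).
  apply: ae_eq0_Rintegral_oo; [exact: whole_ip_measurable|exact: whole_ip_integrable|].
  by move=> t t0 tT; rewrite -(u0 t t0 tT z) (psd0l ipP).
have [s_ [fs [_ su]]] := mu_.
have : {ae mu, forall t n x, 0 < t < T ->
    x \in enum_fset (fset_set (range (s_ n))) -> ip (u t) x = 0}.
  apply: ae_foralln => n.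
  elim: (enum_fset _) => [|x r IH]; first by apply: aeW.
  move: IH (uz x); rewrite /ae_on; apply: filterS2 => t IH ux y tT.
  rewrite inE => /orP[/eqP ->|]; first exact: ux.
  exact: IH.
rewrite /ae_on; apply: filterS => t ut tT.
have [_ cu] := su t.
have : ip (u t) (s_ n t) @[n --> \oo] --> ip (u t) (u t).
  apply/cvgrPdist_le => e e0.
  have K0 : 0 < `|u t| + 1 by rewrite ltr_wpDl.
  move/cvgrPdist_le : cu => /(_ _ (divr_gt0 e0 K0)); apply: filterS => n /=.
  rewrite sub0r normrN normr_id ler_pdivlMr// => h; apply: le_trans h.
  rewrite -(psdBr ipP)// (le_trans (ip_norm_le ipP ipE _ _))// distrC mulrC.
  by rewrite ler_wpM2l// lerDl.
rewrite (_ : (fun n => _) = (fun=> 0)); last first.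
  apply/funext => n; apply: (ut n) => //.
  rewrite -[_ \in _]/(s_ n t \in fset_set (range (s_ n))) in_fset_set; last by case: (fs n).
  by apply/mem_set; exists t.
move=> /(cvg_lim (@norm_hausdorff _ _)); rewrite lim_cst// => /esym.
by rewrite -ipE => /eqP; rewrite sqrf_eq0 normr_eq0 => /eqP.
Qed.

End WeakIntegral.

Section WeakDerivativeH.
Context {R : realType} {H : completeNormedModType R}.
Local Notation mu := (@lebesgue_measure R).
Variable ip : H -> H -> R.
Hypothesis ipP : psd_form setT ip.
Hypothesis ipE : forall x, `|x| ^+ 2 = ip x x.
Implicit Types (a b s t T : R) (u w : R -> H) (x y z : H).

(** Composing with the projection of the line onto [[0, T]] keeps the values there and gives
    continuity on the whole line, as required by the fundamental theorem above. *)
Lemma continuous_extension T w : 0 < T -> {within `[0, T], continuous w} ->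
  exists2 w' : R -> H, continuous w' & forall t, 0 <= t <= T -> w' t = w t.
Proof.
move=> T0 cw; pose clip t := Num.max 0 (Num.min t T).
have clipI t : 0 <= clip t <= T.
  by rewrite /clip le_max lexx/= ge_max (ltW T0) ge_min lexx orbT.
exists (w \o clip); last first.
  move=> t /andP[t0 tT] /=; congr w; rewrite /clip.
  by rewrite (min_idPl tT) (max_idPr t0).
move=> t; have /subspace_continuousP := cw; move=> /(_ (clip t)).
rewrite /= in_itv/= => /(_ (clipI t)) cwt.
have ccl : {for t, continuous clip}.
  apply: (@continuous_max _ _ (cst 0) (id \min cst T)); first exact: cst_continuous.
  by apply: continuous_min; [exact: cvg_id|exact: cst_continuous].
apply: cvg_comp cwt => P [e/= e0 eP].
have : nbhs t (clip @^-1` ball (clip t) e) := ccl _ (nbhsx_ballx _ _ e0).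
apply: filterS => x xe; apply: eP; first exact: xe.
by rewrite /= in_itv/= clipI.
Qed.

Lemma continuous_ip w z : continuous w -> continuous (fun t => ip (w t) z).
Proof.
move=> cw t; apply/cvgrPdist_le => e e0.
have K0 : 0 < `|z| + 1 by rewrite ltr_wpDl.
have /cvgrPdist_le/(_ _ (divr_gt0 e0 K0)) := cw t; apply: filterS => x /=.
rewrite ler_pdivlMr// => h; apply: le_trans h.
rewrite -(psdBl ipP)// (le_trans (ip_norm_le ipP ipE _ _))//.
by rewrite ler_wpM2l// lerDl.
Qed.

Lemma test_function_smooth T (psi : R -> R) : test_function T psi ->
  [/\ continuous psi, continuous (derive1 psi)
    & exists K, forall t, 0 <= t <= T -> `|psi t| <= K /\ `|derive1 psi t| <= K].
Proof.
move=> [dpsi _].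
have c0 : continuous psi.
  by move=> t; apply: differentiable_continuous; apply/derivable1_diffP; exact: (dpsi 0%N).
have c1 : continuous (derive1 psi).
  by move=> t; apply: differentiable_continuous; apply/derivable1_diffP; exact: (dpsi 1%N).
split=> //; have [T0|T0] := leP 0 T; last first.
  by exists 0 => t /andP[t0 tT]; move: (le_lt_trans (le_trans t0 tT) T0); rewrite ltxx.
have cn (f : R -> R) : continuous f -> exists K, forall t, 0 <= t <= T -> `|f t| <= K.
  move=> cf; have [|c _ fc] := @EVT_max R (fun t => `|f t|) 0 T T0.
    by apply: continuous_subspaceT => t; apply: cvg_norm; exact: cf.
  by exists `|f c| => t tT; apply: fc; rewrite in_itv.
have [K1 k1] := cn _ c0; have [K2 k2] := cn _ c1.
exists (Num.max K1 K2) => t tT; rewrite !le_max k1// k2//.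
by rewrite orbT.
Qed.

Lemma bochner_scale_ip T u w (psi : R -> R) z : smeas whole w ->
  integrable_oo 0 T (fun t => `|w t|) -> ae_on 0 T (fun t => u t = w t) ->
  continuous psi -> (exists K, forall t, 0 <= t <= T -> `|psi t| <= K) ->
  ip (bochner_integral whole 0 T (fun t => psi t *: u t)) z
    = \int[mu]_(t in `]0, T[) (psi t * ip (w t) z).
Proof.
move=> mw iw uw cpsi [K psiK].
have mpsi := continuous_measurable cpsi.
have Xw := smeas_scale (@normed_subspace_whole R H) mpsi mw.
have ipw : integrable_oo 0 T (fun t => nrm whole (psi t *: w t)).
  apply: (integrable_oo_le (smeas_nrm (@normed_subspace_whole R H) Xw)
    (integrable_ooZ K iw)) => t /andP[t0 tT].
  rewrite ger0_norm//= normrZ ler_wpM2r//.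
  by apply: psiK; rewrite !ltW.
have puw : ae_on 0 T (fun t => psi t *: u t = psi t *: w t).
  by apply: ae_onS uw => t _ ->.
have X1 x : carrier whole x -> `|x| <= 1 * nrm (@whole R H) x by rewrite mul1r.
have bP := bochner_integralP ipP ipE (@normed_subspace_whole R H) Xw ipw puw complete_whole.
rewrite (is_bochner_ip ipP ipE (@normed_subspace_whole R H) X1 Xw ipw puw z bP).
by apply: Rintegral_oo_eq => t _; rewrite (psdZl ipP).
Qed.

Lemma initial_value_continuous T u (u0 : H) : 0 < T -> initial_value T u u0 ->
  exists w, [/\ continuous w, w 0 = u0 & ae_on 0 T (fun t => w t = u t)].
Proof.
move=> T0 [wi [cwi wiu wi0]].
have [w cw wE] := continuous_extension T0 cwi.
exists w; split=> //; first by rewrite wE// lexx ltW.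
by apply: ae_onS wiu => t /andP[t0 tT] <-; rewrite wE// !ltW.
Qed.

(** Pairing the vector identity with a fixed [z] reduces the claim to the scalar case for
    [ip (w t) z], where [w] is the continuous representative of [u]. *)
Lemma weak_derivative_integral T u u' w w' : weak_derivative whole T u u' ->
  continuous w -> ae_on 0 T (fun t => w t = u t) ->
  smeas whole w' -> integrable_oo 0 T (fun t => `|w' t|) ->
  ae_on 0 T (fun t => u' t = w' t) ->
  forall s t, 0 <= s -> s < t -> t <= T -> weak_integral ip s t w' (w t - w s).
Proof.
move=> [Lu _ uu'] cw wu mw' iw' uw' s t s0 st tT z; rewrite (psdBl ipP)//.
have [ur [mur uur iur]] := Lp1_rep (@normed_subspace_whole R H) Lu.
apply: (@weak_derivative_FTC _ T (fun t => ip (w t) z)) => //.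
- exact: continuous_ip.
- exact: whole_ip_measurable.
- exact: whole_ip_integrable.
move=> psi tpsi; have [c0 c1 [K psiK]] := test_function_smooth tpsi.
have e1 := bochner_scale_ip z mur iur uur c1 _.
have e2 := bochner_scale_ip z mw' iw' uw' c0 _.
have := uu' psi tpsi => /(congr1 (ip ^~ z)); rewrite (psdNl ipP)//.
rewrite e1; last by exists K => x xT; have [] := psiK x xT.
rewrite e2; last by exists K => x xT; have [] := psiK x xT.
move=> <-; apply: ae_Rintegral_oo_eq.
- apply: continuous_integrable_oo => x; apply: cvgM; first exact: c1.
  exact: continuous_ip.
- have m1 := continuous_measurable c1.
  have mi := whole_ip_measurable ipP ipE z mur.
  apply: (integrable_oo_le _ (integrable_ooZ K
    (integrable_oo_norm (whole_ip_integrable ipP ipE z mur iur)))).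
    exact: measurable_funM.
  move=> x /andP[x0 xT]; rewrite normrM ler_wpM2r//.
  by have [|_ k2] := psiK x; [rewrite (ltW x0) (ltW xT)|exact: k2].
by apply: ae_onS2 wu uur => x _ -> ->.
Qed.

End WeakDerivativeH.

Section L1Functions.
Context {R : realType} {H : completeNormedModType R}.
Local Notation mu := (@lebesgue_measure R).
Variable ip : H -> H -> R.
Hypothesis ipP : psd_form setT ip.
Hypothesis ipE : forall x, `|x| ^+ 2 = ip x x.
Implicit Types (a b c d : R) (u w : R -> H) (x y z : H).

Let NW := @normed_subspace_whole R H.

Definition L1_oo a b u : Prop :=
  smeas whole u /\ integrable_oo a b (fun t => `|u t|).

Lemma L1_ooS a b c d u : a <= c -> d <= b -> L1_oo a b u -> L1_oo c d u.
Proof. by move=> ac db [mu_ iu]; split=> //; exact: integrable_ooS iu. Qed.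

Lemma L1_oo_cst a b x : L1_oo a b (fun=> x).
Proof. by split; [exact: smeas_cst|exact: integrable_oo_cst]. Qed.

Lemma L1_oo_dom a b u (g : R -> R) : smeas whole u -> integrable_oo a b g ->
  (forall t, a < t < b -> `|u t| <= g t) -> L1_oo a b u.
Proof.
move=> mu_ ig ug; split=> //; apply: (integrable_oo_le (smeas_nrm NW mu_) ig).
by move=> t /ug; rewrite /= normr_id.
Qed.

Lemma L1_ooD a b u w : L1_oo a b u -> L1_oo a b w -> L1_oo a b (fun t => u t + w t).
Proof.
move=> [mu_ iu] [mw iw]; apply: (L1_oo_dom (smeasD NW mu_ mw) (integrable_ooD iu iw)).
by move=> t _; exact: ler_normD.
Qed.

Lemma L1_ooB a b u w : L1_oo a b u -> L1_oo a b w -> L1_oo a b (fun t => u t - w t).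
Proof.
move=> [mu_ iu] [mw iw]; apply: (L1_oo_dom (smeasB NW mu_ mw) (integrable_ooD iu iw)).
by move=> t _; exact: ler_normB.
Qed.

Lemma L1_oo_lin a b u (g : H -> H) C : (forall x y, `|g x - g y| <= C * `|x - y|) ->
  (forall x, `|g x| <= C * `|x|) -> L1_oo a b u -> L1_oo a b (g \o u).
Proof.
move=> gC gC0 [mu_ iu].
have mg : smeas whole (g \o u).
  by apply: (smeas_lipschitz (X := whole) (Y := whole) (C := C)) => // x y _ _; exact: gC.
by apply: (L1_oo_dom mg (integrable_ooZ C iu)) => t _; exact: gC0.
Qed.

Lemma L1_oo_ip a b u z : L1_oo a b u -> integrable_oo a b (fun t => ip (u t) z).
Proof. by move=> [mu_ iu]; exact: whole_ip_integrable. Qed.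

Lemma L1_weak_integral a b u : L1_oo a b u -> exists y, weak_integral ip a b u y.
Proof.
move=> [mu_ iu].
have [|y [_ uy _]] := weak_integral_ex ipP ipE (C := 1) NW (@complete_whole R H) _ mu_ iu.
  by move=> x _; rewrite mul1r.
by exists y.
Qed.

Lemma weak_integralD a b u w x y : L1_oo a b u -> L1_oo a b w ->
  weak_integral ip a b u x -> weak_integral ip a b w y ->
  weak_integral ip a b (fun t => u t + w t) (x + y).
Proof.
move=> Lu Lw ux wy z; rewrite (psdDl ipP)// ux wy -Rintegral_ooD; try exact: L1_oo_ip.
by apply: Rintegral_oo_eq => t _; rewrite (psdDl ipP).
Qed.

Lemma weak_integralB a b u w x y : L1_oo a b u -> L1_oo a b w ->
  weak_integral ip a b u x -> weak_integral ip a b w y ->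
  weak_integral ip a b (fun t => u t - w t) (x - y).
Proof.
move=> Lu Lw ux wy z; rewrite (psdBl ipP)// ux wy -Rintegral_ooB; try exact: L1_oo_ip.
by apply: Rintegral_oo_eq => t _; rewrite (psdBl ipP).
Qed.

Lemma weak_integral_cst a b x : a <= b ->
  weak_integral ip a b (fun=> x) ((b - a) *: x).
Proof. by move=> ab z; rewrite (psdZl ipP)// Rintegral_oo_cst. Qed.

Lemma weak_integral_ae a b u w x : L1_oo a b u -> L1_oo a b w ->
  ae_on a b (fun t => u t = w t) ->
  weak_integral ip a b u x -> weak_integral ip a b w x.
Proof.
move=> Lu Lw uw ux z; rewrite ux.
by apply: ae_Rintegral_oo_eq; [exact: L1_oo_ip|exact: L1_oo_ip|apply: ae_onS uw => t _ ->].
Qed.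

Lemma weak_integral_lin a b u x (g : H -> H) : (forall y z, ip (g y) z = ip y (g z)) ->
  weak_integral ip a b u x -> weak_integral ip a b (g \o u) (g x).
Proof.
by move=> gC ux z; rewrite gC ux; apply: Rintegral_oo_eq => t _ /=; rewrite gC.
Qed.

Lemma weak_integral_le a b u y (g : R -> R) : L1_oo a b u -> integrable_oo a b g ->
  (forall t, a < t < b -> 0 <= g t) ->
  weak_integral ip a b u y -> ae_on a b (fun t => `|u t| <= g t) ->
  `|y| <= \int[mu]_(t in `]a, b[) g t.
Proof.
move=> [mu_ iu] ig g0 uy ug; apply: le_trans (weak_integral_norm ipP ipE mu_ iu uy) _.
exact: ae_Rintegral_oo_le.
Qed.

Lemma weak_integral_le_cst a b u y M : a <= b -> 0 <= M -> L1_oo a b u ->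
  weak_integral ip a b u y -> ae_on a b (fun t => `|u t| <= M) ->
  `|y| <= (b - a) * M.
Proof.
move=> ab M0 Lu uy uM; rewrite -(Rintegral_oo_cst M ab).
by apply: (weak_integral_le Lu _ _ uy uM) => //; exact: integrable_oo_cst.
Qed.

(** The Bochner integral formed in [X] has the same inner products as [y], hence equals it. This is
    how increments and averages formed in [H] are recognised as elements of V_2 with a bound in its
    norm. *)
Lemma weak_integral_nrm_le_cst (X : nspace R H) C a b u y M :
  normed_subspace X -> complete_in X ->
  (forall x, carrier X x -> `|x| <= C * nrm X x) ->
  a <= b -> 0 <= M -> smeas X u -> integrable_oo a b (fun t => nrm X (u t)) ->
  ae_on a b (fun t => nrm X (u t) <= M) ->
  weak_integral ip a b u y -> carrier X y /\ nrm X y <= (b - a) * M.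
Proof.
move=> XP Xc XC ab M0 Xu iu uM uy.
have [y' [Xy' uy' yM]] := weak_integral_ex ipP ipE XP Xc XC Xu iu.
rewrite (weak_integral_uniq ipP ipE uy uy'); split=> //; apply: le_trans yM _.
rewrite -(Rintegral_oo_cst M ab); apply: ae_Rintegral_oo_le => //.
- exact: integrable_oo_cst.
- by move=> t _; apply: nrm_ge0 => //; exact: smeas_carrier Xu.
Qed.

End L1Functions.

Section CauchySchwarz.
Context {R : realType}.
Local Notation mu := (@lebesgue_measure R).

(** The difference of the two sides is, up to the factor [b - a], the integral of the squared
    deviation of [g] from its mean. *)
Lemma Rintegral_oo_sqr_le (a b : R) (g : R -> R) : a < b ->
  integrable_oo a b g -> integrable_oo a b (fun t => g t ^+ 2) ->
  (\int[mu]_(t in `]a, b[) g t) ^+ 2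
    <= (b - a) * \int[mu]_(t in `]a, b[) (g t ^+ 2).
Proof.
move=> ab ig ig2; set m := \int[mu]_(t in _) g t; set Q := \int[mu]_(t in _) _.
have ba : 0 < b - a by rewrite subr_gt0.
have : 0 <= \int[mu]_(t in `]a, b[) (g t ^+ 2 - (2 * m / (b - a) * g t - (m / (b - a)) ^+ 2)).
  apply: Rintegral_ge0 => t _.
  have -> : g t ^+ 2 - (2 * m / (b - a) * g t - (m / (b - a)) ^+ 2)
    = (g t - m / (b - a)) ^+ 2 by ring.
  exact: sqr_ge0.
have i1 := integrable_ooZ (2 * m / (b - a)) ig.
have i2 := integrable_oo_cst a b ((m / (b - a)) ^+ 2).
rewrite Rintegral_ooB//; last exact: integrable_ooB.
rewrite Rintegral_ooB// Rintegral_ooZ// (Rintegral_oo_cst _ (ltW ab)) -/m -/Q.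
have -> : Q - (2 * m / (b - a) * m - (b - a) * (m / (b - a)) ^+ 2)
  = Q - m ^+ 2 / (b - a) by field; rewrite gt_eqF.
by rewrite subr_ge0 ler_pdivrMr// mulrC.
Qed.

End CauchySchwarz.

Section LinearOperators.
Context {R : realType} {H : completeNormedModType R}.
Variable A : operator H.
Hypothesis AL : linear_operator A.

Lemma linop0 : A 0 = 0.
Proof.
have [[D0 _] AE] := AL.
by have := AE 1 0 0 D0 D0; rewrite !scale1r addr0 => /esym/eqP; rewrite addrC -subr_eq0 addrK => /eqP.
Qed.

Lemma linopZ (c : R) x : dom A x -> A (c *: x) = c *: A x.
Proof.
move=> Dx; have [[D0 _] AE] := AL.
by rewrite -[c *: x]addr0 AE// linop0 addr0.
Qed.

Lemma linopB x y : dom A x -> dom A y -> A (x - y) = A x - A y.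
Proof.
move=> Dx Dy; have [_ AE] := AL.
by rewrite addrC -scaleN1r AE// scaleN1r addrC.
Qed.

Lemma normed_graph_space : normed_subspace (graph_space A).
Proof.
have [DL AE] := AL; split=> [//|x _|x y Dx Dy|c x Dx] /=.
- by rewrite addr_ge0.
- have := AE 1 x y Dx Dy; rewrite !scale1r => ->.
  by rewrite addrACA lerD// ler_normD.
- by rewrite linopZ// !normrZ mulrDr.
Qed.

Lemma smeas_graph u : smeas (graph_space A) u ->
  smeas whole u /\ smeas whole (A \o u).
Proof.
move=> Au; have W := @normed_subspace_whole R H; have G := normed_graph_space.
split.
  apply: (smeas_lipschitz (g := id) (C := 1) G W) Au => //= x y Dx Dy.
  by rewrite mul1r lerDl.
apply: (smeas_lipschitz (C := 1) G W) Au => //= x y Dx Dy.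
by rewrite mul1r -linopB// lerDr.
Qed.

Variable ip : H -> H -> R.
Hypothesis ipP : psd_form setT ip.
Hypothesis Amm : maximal_monotone ip A.
Hypothesis Asa : selfadjoint ip A.

Lemma operator_psd : psd_form (dom A) (fun x y => ip (A x) y).
Proof.
have [DL AE] := AL; split=> //.
- move=> x y Dx Dy; have [_ sA] := Asa.
  by rewrite ((sA y (A y)).2 (conj Dy erefl) x Dx) (psdC ipP).
- by move=> c x y z Dx Dy Dz; rewrite AE// (psdDl ipP)// (psdZl ipP).
- move=> x Dx; have := Amm.1 x 0 Dx DL.1.
  by rewrite linop0 !subr0.
Qed.

End LinearOperators.

(** * The exact solution averaged over a time step *)

Section ExactSolution.
Context {R : realType} {H : completeNormedModType R}.
Local Notation mu := (@lebesgue_measure R).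
Variable ip : H -> H -> R.
Hypothesis ipP : psd_form setT ip.
Hypothesis ipE : forall x, `|x| ^+ 2 = ip x x.
Variables (X1 X2 : nspace R H) (L : H -> H) (A1 B A2 Phi : operator H).
Variables (cL : H -> H) (T : R) (th0 ph0 v0 : H) (f : R -> H).
Variables (theta phi v : R -> H).
Variables (C0 CL Ccl Cp p q : R).
Hypothesis T0 : 0 < T.
Hypothesis X2P : normed_subspace X2.
Hypothesis X2c : complete_in X2.
Hypothesis X2C : forall x, carrier X2 x -> `|x| <= C0 * nrm X2 x.
Hypothesis LL : linear L.
Hypothesis LC : forall x, `|L x| <= CL * `|x|.
Hypothesis Lsym : forall x y, ip (L x) y = ip x (L y).
Hypothesis A1P : linear_maximal_monotone_selfadjoint ip A1.
Hypothesis BP : linear_maximal_monotone_selfadjoint ip B.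
Hypothesis A2P : linear_maximal_monotone_selfadjoint ip A2.
Hypothesis Cp0 : 0 <= Cp.
Hypothesis p0 : 0 <= p.
Hypothesis q0 : 0 <= q.
Hypothesis PhiL : forall x y, carrier X2 x -> carrier X2 y ->
  `|Phi x - Phi y| <= Cp * (1 + nrm X2 x `^ p + nrm X2 y `^ q) * nrm X2 (x - y).
Hypothesis Ccl0 : 0 <= Ccl.
Hypothesis cLL : forall x y, `|cL x - cL y| <= Ccl * `|x - y|.
Hypothesis fL : Lp whole 2%:E 0 T f.
Hypothesis hsol : solution_P X1 X2 L A1 B A2 Phi cL T th0 ph0 v0 f theta phi.
Hypothesis X2ph0 : carrier X2 ph0.
Hypothesis C00 : 0 <= C0.
Hypothesis hv : weak_derivative whole T phi v.

Let NW := @normed_subspace_whole R H.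

Let W1 (x : H) : carrier whole x -> `|x| <= 1 * nrm (@whole R H) x.
Proof. by rewrite mul1r. Qed.

Lemma Lp2_L1 (u : R -> H) : Lp whole 2%:E 0 T u -> exists w : R -> H,
  [/\ ae_on 0 T (fun t => u t = w t), L1_oo 0 T w
    & integrable_oo 0 T (fun t => `|w t| ^+ 2)].
Proof.
move=> /(Lp2_rep NW)[w [mw uw iw]].
have iw1 := integrable_oo_sqr NW mw iw.
by exists w; split=> //; split.
Qed.

Lemma L1_oo_bounded (u : R -> H) M : smeas whole u -> (forall t, `|u t| <= M) -> L1_oo 0 T u.
Proof. by move=> mu_ uM; apply: (L1_oo_dom mu_ (integrable_oo_cst 0 T M)). Qed.

(** [wt], [wp], [wv] are the continuous representatives of theta, phi, v; [vb],
    [pb], [tb], [Pb] are the averages of v, phi, theta and Phi(phi) + cL(phi) over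
    ]s, t[; [gt], [gA], [gB] are the norms of theta', A1 theta and B v. *)
Record averaged_solution (wt wp wv : R -> H) (K : R) (gt gA gB : R -> R) (s t : R)
    (vb pb tb Pb : H) : Prop := AveragedSolution {
  avg_v : vb = (t - s)^-1 *: (wp t - wp s);
  avg_domB : dom B vb;
  avg_domA2 : dom A2 pb;
  avg_domA1 : dom A1 tb;
  avg_eq_v : (t - s)^-1 *: L (wv t - wv s) + B vb + A2 pb + Pb = tb;
  avg_eq_theta : (t - s)^-1 *: (wt t - wt s) + vb + A1 tb
                 = (t - s)^-1 *: bochner_integral whole s t f;
  avg_osc_v : forall x, s <= x <= t -> `|wv x - vb| <= K * (t - s);
  avg_osc_p : forall x, s <= x <= t ->
    carrier X2 (wp x - pb) /\ nrm X2 (wp x - pb) <= K * (t - s);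
  avg_osc_t : forall x, s <= x <= t ->
    `|wt x - tb| <= \int[mu]_(y in `]s, t[) gt y;
  avg_Bv : `|B vb| <= (t - s)^-1 * \int[mu]_(y in `]s, t[) gB y;
  avg_A1t : `|A1 tb| <= (t - s)^-1 * \int[mu]_(y in `]s, t[) gA y;
  avg_Phi : forall y r, carrier X2 y -> 0 <= r -> nrm X2 y <= r ->
    `|Phi y + cL y - Pb| <= (Cp * (1 + r `^ p + K `^ q) + Ccl * C0)
                              * (nrm X2 (y - wp t) + K * (t - s)) }.

Definition square_integrable (g : R -> R) : Prop :=
  [/\ forall t, 0 <= g t, integrable_oo 0 T g & integrable_oo 0 T (fun t => g t ^+ 2)].

Lemma norm_square_integrable (u : R -> H) : L1_oo 0 T u ->
  integrable_oo 0 T (fun t => `|u t| ^+ 2) -> square_integrable (fun t => `|u t|).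
Proof. by move=> [_ iu] iu2; split=> // t. Qed.

Lemma graph_rep (A : operator H) (u : R -> H) : linear_operator A ->
  Lp (graph_space A) 2%:E 0 T u -> exists w : R -> H,
  [/\ ae_on 0 T (fun t => u t = w t), forall t, dom A (w t), L1_oo 0 T w,
      L1_oo 0 T (A \o w) & integrable_oo 0 T (fun t => `|A (w t)| ^+ 2)].
Proof.
move=> AL /(Lp2_rep (normed_graph_space AL))[w [gw uw iw2]].
have iw := integrable_oo_sqr (normed_graph_space AL) gw iw2.
have [mw mAw] := smeas_graph AL gw.
exists w; split=> //.
- by move=> t; exact: smeas_carrier gw.
- by apply: (L1_oo_dom mw iw) => t _ /=; rewrite lerDl.
- by apply: (L1_oo_dom mAw iw) => t _ /=; rewrite lerDr.
apply: (integrable_oo_le _ iw2) => [|t _].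
  by apply: measurable_funX; exact: (smeas_nrm NW mAw).
rewrite ger0_norm ?sqr_ge0//= ler_pXn2r ?nnegrE ?addr_ge0//.
by rewrite lerDr.
Qed.

Lemma average_osc s t (u : R -> H) y x M : s < t -> 0 <= M -> L1_oo s t u ->
  weak_integral ip s t u y -> ae_on s t (fun r => `|x - u r| <= M) ->
  `|x - (t - s)^-1 *: y| <= M.
Proof.
move=> st M0 Lu uy uM; have ts : 0 < t - s by rewrite subr_gt0.
have xP := weak_integral_cst ipP x (ltW st).
have h := weak_integralB ipP ipE (L1_oo_cst s t x) Lu xP uy.
have : `|(t - s) *: x - y| <= (t - s) * M.
  apply: (weak_integral_le_cst ipP ipE (ltW st) M0 _ h) => //.
  by apply: L1_ooB => //; exact: L1_oo_cst.
have -> : x - (t - s)^-1 *: y = (t - s)^-1 *: ((t - s) *: x - y).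
  by rewrite scalerBr scalerA mulVf ?scale1r// gt_eqF.
by rewrite normrZ gtr0_norm ?invr_gt0// ler_pdivrMl.
Qed.

(** The interface between classes of functions and the scheme. Each class gets representatives
    suited to their use: continuous ones for the nodes, everywhere bounded ones for the Lipschitz
    estimates, and ones with values in an operator domain for the averages. They agree almost
    everywhere. *)
Lemma exact_solution : exists (wt wp wv : R -> H) (K : R) (gt gA gB : R -> R),
  [/\ [/\ wt 0 = th0, wp 0 = ph0, wv 0 = v0 & 0 <= K],
      [/\ square_integrable gt, square_integrable gA & square_integrable gB],
      ae_on 0 T (fun t => [/\ wt t = theta t, wp t = phi t, wv t = v t, dom B (v t)
        & `|B (v t)| = gB t]) /\
      ae_on 0 T (fun t => dom A1 (theta t) /\ `|A1 (theta t)| = gA t),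
      forall s t, 0 <= s -> s < t -> t <= T ->
        [/\ `|wv t - wv s| <= K * (t - s),
            carrier X2 (wp t - wp s), nrm X2 (wp t - wp s) <= K * (t - s)
          & `|wt t - wt s| <= \int[mu]_(y in `]s, t[) gt y]
    & forall s t, 0 <= s -> s < t -> t <= T -> exists vb pb tb Pb,
        averaged_solution wt wp wv K gt gA gB s t vb pb tb Pb].
Proof.
have [theta' [v1 [v' [S1 S2 E1 E2 [it ip_ iv]]]]] := hsol.
have [[_ Lt' wdt] _ Lgt] := S1.
have [[[_ _ wdp] [_ Lv' wdv]] [LX2p LX2v _] Lgp Lgv LPhi] := S2.
have [wt [cwt wt0 wtE]] := initial_value_continuous T0 it.
have [wp [cwp wp0 wpE]] := initial_value_continuous T0 ip_.
have [wv [cwv wv0 wvE]] := initial_value_continuous T0 iv.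
have [A1l A1mm A1sa] := A1P; have [Bl Bmm Bsa] := BP; have [A2l A2mm A2sa] := A2P.
have [t'r [t'E Lt'r it'2]] := Lp2_L1 Lt'.
have [v'r [Kv' [mv' v'E Kv'0 v'K]]] := Lpoo_rep NW Lv'.
have [v2 [Kv2 [mv2X v2E Kv20 v2K]]] := Lpoo_rep X2P LX2v.
have [p2 [Kp2 [mp2X p2E Kp20 p2K]]] := Lpoo_rep X2P LX2p.
have [tg [tgE tgA Ltg LAtg iAtg2]] := graph_rep A1l Lgt.
have [pg [pgE pgA Lpg LApg _]] := graph_rep A2l Lgp.
have [vg [vgE vgB Lvg LBvg iBvg2]] := graph_rep Bl Lgv.
have [Pr [KP [mP PE _ PK]]] := Lpoo_rep NW LPhi.
have [fr [fE Lfr _]] := Lp2_L1 fL.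
have LPr := L1_oo_bounded mP PK.
have Lv'r := L1_oo_bounded mv' v'K.
have mX2 (u : R -> H) : smeas X2 u -> smeas whole u.
  apply: (smeas_lipschitz (g := id) (C := C0) X2P NW) => //= x y Xx Xy.
  by apply: X2C; apply: lin_subspaceB => //; exact: carrier_lin.
have Lv2 : L1_oo 0 T v2.
  apply: (L1_oo_bounded (M := `|C0| * Kv2) (mX2 _ mv2X)) => t.
  have Xv := smeas_carrier t mv2X.
  apply: le_trans (X2C Xv) _; apply: le_trans (ler_norm _) _.
  by rewrite normrM ler_wpM2l// ger0_norm ?nrm_ge0.
have dt := weak_derivative_integral ipP ipE wdt cwt wtE Lt'r.1 Lt'r.2 t'E.
have dv := weak_derivative_integral ipP ipE wdv cwv wvE mv' Lv'r.2 v'E.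
have dp := weak_derivative_integral ipP ipE wdp cwp wpE Lv2.1 Lv2.2 v2E.
(* The given [v] and the derivative [v1] contained in [solution_P] are a priori different functions.
   Both integrate to the increments of [wp], so their difference has vanishing integrals over every
   []0, t[]. *)
have vv1 : ae_on 0 T (fun t => v t = v1 t).
  have [_ /(Lp1_rep NW)[vr [mvr vrE ivr]] _] := hv.
  have Lvr : L1_oo 0 T vr by split.
  have dp' := weak_derivative_integral ipP ipE hv cwp wpE mvr ivr vrE.
  have : ae_on 0 T (fun t => vr t - v2 t = 0).
    have LL' := L1_ooB Lvr Lv2.
    apply: (ae_eq0_weak_integral ipP ipE LL'.1 LL'.2) => t t0 tT.
    have := weak_integralB ipP ipE (L1_ooS (lexx 0) tT Lvr) (L1_ooS (lexx 0) tT Lv2)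
      (dp' 0 t (lexx 0) t0 tT) (dp 0 t (lexx 0) t0 tT).
    by rewrite subrr.
  by apply: ae_onS3 vrE v2E => t _ -> -> /eqP; rewrite subr_eq0 => /eqP.
(* One constant for three bounds: v' in [H], which makes [wv] Lipschitz; v in V_2, which makes [wp]
   Lipschitz there; and phi in V_2, which enters the local Lipschitz constant of [Phi]. *)
pose K := Num.max (Num.max Kv' Kv2) Kp2.
have K1 : Kv' <= K by rewrite /K !le_max lexx.
have K2 : Kv2 <= K by rewrite /K !le_max lexx orbT.
have K3 : Kp2 <= K by rewrite /K !le_max lexx orbT.
have K0 : 0 <= K by exact: le_trans K1.
exists wt, wp, wv, K, (fun t => `|t'r t|), (fun t => `|A1 (tg t)|), (fun t => `|B (vg t)|).
have osc s t : 0 <= s -> s < t -> t <= T ->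
    [/\ `|wv t - wv s| <= K * (t - s),
        carrier X2 (wp t - wp s), nrm X2 (wp t - wp s) <= K * (t - s)
      & `|wt t - wt s| <= \int[mu]_(y in `]s, t[) `|t'r y|].
  move=> s0 st tT; have ts : 0 < t - s by rewrite subr_gt0.
  have iv2 : integrable_oo s t (fun r => nrm X2 (v2 r)).
    apply: (integrable_oo_bounded (M := Kv2)); first exact: smeas_nrm.
    by move=> r _; rewrite ger0_norm// nrm_ge0//; exact: smeas_carrier mv2X.
  have [|Xw Xw'] := weak_integral_nrm_le_cst ipP ipE X2P X2c X2C (ltW st) Kv20 mv2X iv2 _ (dp s t s0 st tT).
    by apply: ae_onW => x _; exact: v2K.
  split=> //.
  - rewrite mulrC.
    apply: (weak_integral_le_cst ipP ipE (ltW st) K0 (L1_ooS s0 tT Lv'r) (dv s t s0 st tT)).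
    by apply: ae_onW => x _; apply: le_trans (v'K x) K1.
  - by apply: le_trans Xw' _; rewrite mulrC ler_wpM2r// ltW.
  - apply: (weak_integral_le ipP ipE (L1_ooS s0 tT Lt'r) _ _ (dt s t s0 st tT)) => //.
      exact: integrable_ooS s0 tT Lt'r.2.
    exact: ae_onW.
split=> //.
- by split; apply: norm_square_integrable.
- split.
    apply: ae_onS3 (_ : ae_on 0 T (fun t => wt t = theta t /\ wp t = phi t))
      (_ : ae_on 0 T (fun t => wv t = v1 t /\ v t = v1 t)) vgE.
    + by move=> t _ [-> ->] [-> ->] ->.
    + exact: ae_onS2 wtE wpE.
    + exact: ae_onS2 wvE vv1.
  by apply: ae_onS tgE => t _ ->.
have X2L := carrier_lin X2P.
(* Membership in V_2 is needed at every time, in particular at the nodes. It propagates from [ph0],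
   because the increments of [wp] are integrals of a function with values in V_2. *)
have Xwp x : 0 <= x -> x <= T -> carrier X2 (wp x).
  move=> x0 xT; have [<-|x0'] := eqVneq 0 x; first by rewrite wp0.
  have x1 : 0 < x by rewrite lt_neqAle x0' x0.
  have [_ Xx _ _] := osc 0 x (lexx 0) x1 xT.
  by rewrite -[wp x](subrK (wp 0)); apply: lin_subspaceD => //; rewrite wp0.
move=> s t s0 st tT; have ts : 0 < t - s by rewrite subr_gt0.
have osc_in x r : s <= x <= t -> s <= r <= t ->
    [/\ `|wv x - wv r| <= K * (t - s), nrm X2 (wp x - wp r) <= K * (t - s)
      & `|wt x - wt r| <= \int[mu]_(y in `]s, t[) `|t'r y|].
  wlog xr : x r / r <= x.
    move=> W xst rst; have [xr|xr] := leP r x; first exact: W.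
    have [h1 h2 h3] := W r x (ltW xr) rst xst.
    move/andP: xst => [sx xt]; move/andP: rst => [sr rt].
    rewrite distrC h1 (distrC (wt x)) h3 (nrmC X2P) ?h2//; apply: Xwp; lra.
  move=> /andP[sx xt] /andP[sr rt].
  have iK : 0 <= K * (t - s) by rewrite mulr_ge0// ltW.
  move: xr; rewrite le_eqVlt => /orP[/eqP <-|rx].
    by rewrite !subrr (nrm0 X2P) normr0; split=> //; apply: Rintegral_ge0.
  have [||h1 _ h2 h3] := osc r x _ rx _; [lra|lra|].
  have le : K * (x - r) <= K * (t - s) by rewrite ler_wpM2l//; lra.
  split; [exact: le_trans le|exact: le_trans le|].
  apply: le_trans h3 _; apply: Rintegral_oo_subset => //.
  exact: integrable_ooS s0 tT Lt'r.2.
have sub P : ae_on 0 T P -> ae_on s t P by exact: ae_on_sub.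
have v2vg : ae_on s t (fun r => v2 r = vg r).
  by apply: sub; apply: ae_onS2 v2E vgE => r _ <- <-.
have Lvg' := L1_ooS s0 tT Lvg; have LBvg' := L1_ooS s0 tT LBvg.
have Lpg' := L1_ooS s0 tT Lpg; have LApg' := L1_ooS s0 tT LApg.
have Ltg' := L1_ooS s0 tT Ltg; have LAtg' := L1_ooS s0 tT LAtg.
have Lv'r' := L1_ooS s0 tT Lv'r; have Lt'r' := L1_ooS s0 tT Lt'r.
have Lfr' := L1_ooS s0 tT Lfr.
have Wv : weak_integral ip s t vg (wp t - wp s).
  exact: (weak_integral_ae ipP ipE (L1_ooS s0 tT Lv2) Lvg' v2vg (dp s t s0 st tT)).
have [yB WB] := L1_weak_integral ipP ipE LBvg'.
(* An increment of phi lies in D(B), being the integral of v, although nothing places the values of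
   [wp] themselves in D(B) here. *)
have [DB EB] : dom B (wp t - wp s) /\ yB = B (wp t - wp s).
  apply: (weak_integral_selfadjoint ipP ipE Bsa Lvg'.1 Lvg'.2 LBvg'.1 LBvg'.2 _ Wv WB).
  by apply: ae_onW => r _; split.
have [yp Wp] := L1_weak_integral ipP ipE Lpg'.
have [yA2 WA2] := L1_weak_integral ipP ipE LApg'.
have [DA2 EA2] : dom A2 yp /\ yA2 = A2 yp.
  apply: (weak_integral_selfadjoint ipP ipE A2sa Lpg'.1 Lpg'.2 LApg'.1 LApg'.2 _ Wp WA2).
  by apply: ae_onW => r _; split.
have [yt Wt] := L1_weak_integral ipP ipE Ltg'.
have [yA1 WA1] := L1_weak_integral ipP ipE LAtg'.
have [DA1 EA1] : dom A1 yt /\ yA1 = A1 yt.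
  apply: (weak_integral_selfadjoint ipP ipE A1sa Ltg'.1 Ltg'.2 LAtg'.1 LAtg'.2 _ Wt WA1).
  by apply: ae_onW => r _; split.
have mcL : smeas whole (cL \o pg).
  by apply: (smeas_lipschitz (X := whole) (Y := whole) (C := Ccl) NW NW) Lpg.1 => // x y _ _; exact: cLL.
have LcL : L1_oo s t (cL \o pg).
  apply: (L1_oo_dom mcL (integrable_ooD (integrable_oo_cst s t `|cL 0|) (integrable_ooZ Ccl Lpg'.2))) => r _ /=.
  rewrite -[cL (pg r)](subrK (cL 0)) addrC; apply: le_trans (ler_normD _ _) _.
  by rewrite lerD2l; have := cLL (pg r) 0; rewrite subr0.
have LP := L1_ooD (L1_ooS s0 tT LPr) LcL.
have [yP WP] := L1_weak_integral ipP ipE LP.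
have LLv : L1_oo s t (L \o v'r).
  apply: (L1_oo_lin (C := CL)) Lv'r' => // x y.
  have -> : L x - L y = L (x - y).
    by rewrite [x - y]addrC -(scaleN1r y) LL scaleN1r addrC.
  exact: LC.
have WL := weak_integral_lin Lsym (dv s t s0 st tT).
have Wf : weak_integral ip s t fr (bochner_integral whole s t f).
  move=> z; have fE' := sub _ fE.
  have bP := bochner_integralP ipP ipE NW Lfr'.1 Lfr'.2 fE' (@complete_whole R H).
  exact: (is_bochner_ip ipP ipE NW W1 Lfr'.1 Lfr'.2 fE' z bP).
have eq2 : L (wv t - wv s) + yB + yA2 + yP = yt.
  have W := weak_integralD ipP ipE (L1_ooD (L1_ooD LLv LBvg') LApg') LP
    (weak_integralD ipP ipE (L1_ooD LLv LBvg') LApg'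
      (weak_integralD ipP ipE LLv LBvg' WL WB) WA2) WP.
  apply: (weak_integral_uniq ipP ipE W).
  apply: (weak_integral_ae ipP ipE Ltg' (L1_ooD (L1_ooD (L1_ooD LLv LBvg') LApg') LP) _ Wt).
  apply: sub; apply: ae_onS3
    (_ : ae_on 0 T (fun r => v' r = v'r r /\ v1 r = vg r))
    (_ : ae_on 0 T (fun r => phi r = pg r /\ Phi (phi r) = Pr r))
    (_ : ae_on 0 T (fun r => theta r = tg r /\ L (v' r) + B (v1 r) + A2 (phi r) + Phi (phi r)
                          + cL (phi r) = theta r)).
  + by move=> r _ [e1 e2] [e3 e4] [e5 e6] /=; rewrite -e1 -e2 -e3 -e4 -e5 -e6 addrA.
  + by apply: ae_onS2 v'E vgE.
  + by apply: ae_onS2 pgE PE.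
  + by apply: ae_onS2 tgE E2.
have eq1 : wt t - wt s + (wp t - wp s) + yA1 = bochner_integral whole s t f.
  have W := weak_integralD ipP ipE (L1_ooD Lt'r' Lvg') LAtg'
    (weak_integralD ipP ipE Lt'r' Lvg' (dt s t s0 st tT) Wv) WA1.
  apply: (weak_integral_uniq ipP ipE W).
  apply: (weak_integral_ae ipP ipE Lfr' (L1_ooD (L1_ooD Lt'r' Lvg') LAtg') _ Wf).
  apply: sub; apply: ae_onS3
    (_ : ae_on 0 T (fun r => theta' r = t'r r /\ v1 r = vg r))
    (_ : ae_on 0 T (fun r => theta r = tg r /\ f r = fr r)) E1.
  + by move=> r _ [e1 e2] [e3 e4] e5 /=; rewrite -e1 -e2 -e3 -e4 -e5.
  + by apply: ae_onS2 t'E vgE.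
  + by apply: ae_onS2 tgE fE.
exists ((t - s)^-1 *: (wp t - wp s)), ((t - s)^-1 *: yp), ((t - s)^-1 *: yt), ((t - s)^-1 *: yP).
have KT : 0 <= K * (t - s) by rewrite mulr_ge0// ltW.
split=> //.
- exact: lin_subspaceZ Bl.1 DB.
- exact: lin_subspaceZ A2l.1 DA2.
- exact: lin_subspaceZ A1l.1 DA1.
- by rewrite (linopZ Bl _ DB) (linopZ A2l _ DA2) -EB -EA2 -eq2 !scalerDr.
- by rewrite (linopZ A1l _ DA1) -EA1 -eq1 !scalerDr.
- move=> x xst; apply: (average_osc st KT Lvg' Wv).
  apply: ae_onS2 (sub _ wvE) (sub _ vgE) => r /andP[sr rt] e1 <-.
  by rewrite -e1; have [] := osc_in x r xst; rewrite ?(ltW sr) ?(ltW rt).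
- move=> x /[dup] xst /andP[sx xt].
  have Xx : carrier X2 (wp x) by apply: Xwp; lra.
  have mX := smeasB X2P (smeas_cst X2P Xx) mp2X.
  have iX : integrable_oo s t (fun r => nrm X2 (wp x - p2 r)).
    apply: (integrable_oo_bounded (M := nrm X2 (wp x) + Kp2)); first exact: smeas_nrm.
    move=> r _; have Xp := smeas_carrier r mp2X.
    rewrite ger0_norm; last by apply: nrm_ge0 => //; exact: lin_subspaceB.
    by apply: le_trans (nrmB X2P Xx Xp) _; rewrite lerD2l.
  have Lp2 : L1_oo s t p2.
    apply: (L1_oo_dom (mX2 _ mp2X) (integrable_oo_cst s t (C0 * Kp2))) => r _.
    have Xp := smeas_carrier r mp2X.
    by apply: le_trans (X2C Xp) _; rewrite ler_wpM2l.
  (* [pg] has its values in D(A_2) and defines the average, whereas [p2] is bounded in V_2. Their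
     agreement transfers the V_2 estimate to the average. *)
  have p2pg : ae_on s t (fun r => pg r = p2 r).
    by apply: sub; apply: ae_onS2 pgE p2E => r _ <- <-.
  have W := weak_integralB ipP ipE (L1_oo_cst s t (wp x)) Lp2
    (weak_integral_cst ipP (wp x) (ltW st)) (weak_integral_ae ipP ipE Lpg' Lp2 p2pg Wp).
  have [|Xy Xy'] := weak_integral_nrm_le_cst ipP ipE X2P X2c X2C (ltW st) KT mX iX _ W.
    apply: ae_onS2 (sub _ wpE) (sub _ p2E) => r /andP[sr rt] e1 e2.
    by rewrite -e2 -e1; have [] := osc_in x r xst; rewrite ?(ltW sr) ?(ltW rt).
  have -> : wp x - (t - s)^-1 *: yp = (t - s)^-1 *: ((t - s) *: wp x - yp).
    by rewrite scalerBr scalerA mulVf ?scale1r// gt_eqF.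
  split; first exact: lin_subspaceZ.
  by rewrite (nrmZ X2P)// gtr0_norm ?invr_gt0// ler_pdivrMl.
- move=> x xst; apply: (average_osc st _ Ltg' Wt); first exact: Rintegral_ge0.
  apply: ae_onS2 (sub _ wtE) (sub _ tgE) => r /andP[sr rt] <- <-.
  by have [] := osc_in x r xst; rewrite ?(ltW sr) ?(ltW rt).
- rewrite (linopZ Bl _ DB) -EB normrZ gtr0_norm ?invr_gt0// ler_wpM2l ?invr_ge0 ?(ltW ts)//.
  exact: (weak_integral_norm ipP ipE LBvg'.1 LBvg'.2 WB).
- rewrite (linopZ A1l _ DA1) -EA1 normrZ gtr0_norm ?invr_gt0// ler_wpM2l ?invr_ge0 ?(ltW ts)//.
  exact: (weak_integral_norm ipP ipE LAtg'.1 LAtg'.2 WA1).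
(* [Phi] is compared at [y] and at [p2 x] for each time [x] of the step: the first has norm at most
   [r], the second at most [K], so the local Lipschitz constant is uniform and only the resulting
   bound is averaged. *)
- move=> y r Xy r0 yr.
  have F0 : 0 <= Cp * (1 + r `^ p + K `^ q) + Ccl * C0.
    by rewrite addr_ge0 ?mulr_ge0// !addr_ge0// powR_ge0.
  have Xt : carrier X2 (wp t) by apply: Xwp; lra.
  have M0 : 0 <= nrm X2 (y - wp t) + K * (t - s).
    by rewrite addr_ge0// nrm_ge0//; exact: lin_subspaceB.
  apply: (average_osc st _ LP WP); first exact: mulr_ge0.
  apply: ae_onS3 (_ : ae_on s t (fun r => Pr r = Phi (phi r) /\ phi r = pg r))
    (sub _ wpE) (sub _ p2E); last first.
    by apply: sub; apply: ae_onS2 PE pgE => x _ <-.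
  move=> x /andP[sx xt] [e3 e4] e1 e2 /=; rewrite e3 -e4 e2.
  have Xp := smeas_carrier x mp2X.
  rewrite opprD addrACA.
  have d2 : nrm X2 (y - p2 x) <= nrm X2 (y - wp t) + K * (t - s).
    apply: le_trans (nrm_triangle X2P Xy Xt Xp) _; rewrite lerD2l -e2 -e1.
    by have [] := osc_in t x; rewrite ?lexx ?(ltW sx) ?(ltW xt) ?(ltW st).
  have Xd := lin_subspaceB X2L Xy Xp.
  have n0 := nrm_ge0 X2P Xd.
  apply: (@le_trans _ _ ((Cp * (1 + r `^ p + K `^ q) + Ccl * C0) * nrm X2 (y - p2 x))); last first.
    by rewrite ler_wpM2l.
  rewrite mulrDl; apply: le_trans (ler_normD _ _) _; apply: lerD.
    apply: le_trans (PhiL Xy Xp) _; rewrite ler_wpM2r// ler_wpM2l// lerD//.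
      by rewrite lerD2l ge0_ler_powR// nnegrE// nrm_ge0.
    by apply: ge0_ler_powR; rewrite ?nnegrE ?nrm_ge0 ?(le_trans (p2K x) K3).
  by apply: le_trans (cLL _ _) _; rewrite -mulrA ler_wpM2l// X2C.
Qed.

End ExactSolution.

(** * The discrete scheme *)

Section Gronwall.
Context {R : realType}.

(** The implicit term leaves a factor [1 - c] on the left, which e^{2c} compensates: (1 - c)(1 + 2c)
    = 1 + c(1 - 2c) is at least 1 for [c <= 2^-1]. The sums of [d] are carried through the induction
    together with [S]. *)
Lemma discrete_gronwall (N : nat) (S d b : nat -> R) (c : R) :
  0 <= c -> c <= 2^-1 -> 0 <= S 0 ->
  (forall n, 0 <= d n) -> (forall n, 0 <= b n) ->
  (forall n, (n < N)%N -> S n.+1 + d n <= S n + b n + c * S n.+1) ->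
  forall n, (n <= N)%N ->
    S n + \sum_(k < n) d k <= expR (2 * c * n%:R) * (S 0 + \sum_(k < n) b k).
Proof.
move=> c0 c12 S0 d0 b0 step; elim=> [_|n IH nN].
  by rewrite !big_ord0 !addr0 mulr0 expR0 mul1r.
have {}IH := IH (ltnW nN); have {}step := step n nN.
have D0 : 0 <= \sum_(k < n) d k by exact: sumr_ge0.
have B0 : 0 <= S 0 + \sum_(k < n) b k by rewrite addr_ge0 ?sumr_ge0.
have e1 : 1 <= expR (2 * c * n%:R).
  by rewrite -expR0 ler_expR !mulr_ge0.
rewrite !big_ord_recr /=.
set Sd := \sum_(k < n) d k in IH D0 *; set Sb := \sum_(k < n) b k in IH B0 *.
have ec : (1 - c) * expR (2 * c) >= 1.
  have : 1 + 2 * c <= expR (2 * c) by exact: expR_ge1Dx.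
  move=> h; apply: (@le_trans _ _ ((1 - c) * (1 + 2 * c))); first by nra.
  by rewrite ler_wpM2l//; lra.
have -> : 2 * c * n.+1%:R = 2 * c * n%:R + 2 * c by rewrite -natr1; ring.
rewrite expRD.
have le1 : (1 - c) * (S n.+1 + (Sd + d n))
    <= expR (2 * c * n%:R) * (S 0 + (Sb + b n)).
  apply: (@le_trans _ _ (S n + Sd + b n)).
    have := d0 n; have : 0 <= c * (Sd + d n) by rewrite mulr_ge0// addr_ge0.
    by lra.
  have : b n <= expR (2 * c * n%:R) * b n by rewrite ler_peMl.
  by lra.
have p1 : 0 < 1 - c by lra.
rewrite -(ler_pM2l p1); apply: le_trans le1 _.
have -> : (1 - c) * (expR (2 * c * n%:R) * expR (2 * c) * (S 0 + (Sb + b n)))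
  = (1 - c) * expR (2 * c) * (expR (2 * c * n%:R) * (S 0 + (Sb + b n))) by ring.
by rewrite ler_peMl// mulr_ge0 ?expR_ge0// addrA addr_ge0.
Qed.

End Gronwall.

Section SchemeStep.
Context {R : realType} {H : completeNormedModType R}.
Variables (ip : H -> H -> R) (W : set H) (a2 : H -> H -> R) (L : H -> H).
Hypothesis ipP : psd_form setT ip.
Hypothesis a2P : psd_form W a2.
Hypothesis LP : psd_form setT (fun x y => ip (L x) y).

(* The second equation is tested with D and the first one with Q, so that the
   coupling terms cancel. *)
Lemma scheme_step (h : R) (E E' rho F F' r G G' tau D Q BD A1Q A2P Psi g : H) :
  0 < h -> W F -> W F' -> W r ->
  D = h^-1 *: (F' - F) -> D = E' + rho -> Q = G' + tau ->
  h^-1 *: L (E' - E) + BD + A2P + Psi = Q ->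
  h^-1 *: (G' - G) + D + A1Q = g ->
  ip A2P (F' - F) = a2 (F' - F) (F' + r) ->
  ip (L E') E' - ip (L E) E - ip (L rho) rho + (a2 F' F' - a2 F F - a2 r r)
  + (ip G' G' - ip G G - ip tau tau) + 2 * h * ip BD D + 2 * h * ip A1Q Q
    <= 2 * h * ip g Q - 2 * h * ip Psi D.
Proof.
move=> h0 WF WF' Wr DF DE QG eq2 eq1 hA2.
have i1 := psd_euler LP (x := E) (x' := E') (y := rho) I I I.
have i2 := psd_euler a2P WF WF' Wr.
have i3 := psd_euler ipP (x := G) (x' := G') (y := tau) I I I.
rewrite -DE in i1; rewrite -QG in i3; rewrite -hA2 in i2.
have hD : h *: D = F' - F by rewrite DF scalerA mulfV ?scale1r// gt_eqF.
rewrite -hD (psdZr ipP)// in i2.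
have t2 : h^-1 * ip (L (E' - E)) D + ip BD D + ip A2P D + ip Psi D = ip Q D.
  by rewrite -eq2 !(psdDl ipP)// (psdZl ipP).
have t1 : h^-1 * ip (G' - G) Q + ip D Q + ip A1Q Q = ip g Q.
  by move: (G' - G) eq1 => dG <-; rewrite !(psdDl ipP)// (psdZl ipP).
rewrite (psdC ipP (I : setT Q) (I : setT D)) in t2.
have t2' : ip (L (E' - E)) D + h * ip BD D + h * ip A2P D + h * ip Psi D = h * ip D Q.
  by rewrite -t2; field; rewrite gt_eqF.
have t1' : ip (G' - G) Q + h * ip D Q + h * ip A1Q Q = h * ip g Q.
  by rewrite -t1; field; rewrite gt_eqF.
by lra.
Qed.

End SchemeStep.

(** * Splitting time into the cells of the grid *)

Section Cells.
Context {R : realType}.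
Local Notation mu := (@lebesgue_measure R).
Implicit Types (T h t : R) (k n N : nat).

Definition cell h k : set R := `]k%:R * h, k.+1%:R * h[%classic.

Lemma cellE h k t : cell h k t <-> k%:R * h < t < k.+1%:R * h.
Proof. by rewrite /cell /= in_itv. Qed.

Lemma truncn_cell h k t : 0 < h -> k%:R * h < t < k.+1%:R * h ->
  Num.truncn (t / h) = k.
Proof.
move=> h0 /andP[k1 k2]; apply: truncn_def.
by rewrite ler_pdivlMr// ltr_pdivrMr// k2 (ltW k1).
Qed.

Lemma cell_sub h k n : 0 < h -> (k < n)%N -> cell h k `<=` `]0, n%:R * h[.
Proof.
move=> h0 kn t /cellE/andP[kt tk]; rewrite /= in_itv /=; apply/andP; split.
  by apply: le_lt_trans kt; rewrite mulr_ge0// ltW.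
by apply: lt_le_trans tk _; rewrite ler_pM2r// ler_nat.
Qed.

(** The open cells miss only the nodes, which form a null set; any other [t] lies in the cell
    numbered by the integer part of [t / h]. *)
Lemma ae_cell h N (P : R -> Prop) : 0 < h ->
  (forall k, (k < N)%N -> ae_on (k%:R * h) (k.+1%:R * h) P) ->
  ae_on 0 (N%:R * h) P.
Proof.
move=> h0 cP.
have nodes : {ae mu, forall t k, t <> k%:R * h}.
  apply/ae_foralln => k; exists [set k%:R * h]; split => //.
    exact: lebesgue_measure_set1.
  by move=> t /= /contrapT.
have cells : {ae mu, forall t k, (k < N)%N -> k%:R * h < t < k.+1%:R * h -> P t}.
  apply/ae_foralln => k; have [kN|kN] := boolP (k < N)%N; last by apply: aeW.
  by move: (cP k kN); rewrite /ae_on; apply: filterS => t Pt _ /Pt.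
move: nodes cells; rewrite /ae_on; apply: filterS2 => t tn ct /andP[t0 tN].
have th0 : 0 <= t / h by rewrite divr_ge0// ltW.
have /andP[k1 k2] := truncn_itv th0.
rewrite ler_pdivlMr// ltr_pdivrMr// in k1 k2.
apply: (ct (Num.truncn (t / h))).
  by rewrite truncn_lt_nat// ltr_pdivrMr.
by rewrite k2 andbT lt_neqAle k1 andbT; apply/eqP => /esym; exact: tn.
Qed.

Lemma Rintegral_ooE (a b : R) (g : R -> R) : integrable_oo a b g ->
  (\int[mu]_(t in `]a, b[) (g t)%:E = (\int[mu]_(t in `]a, b[) g t)%:E)%E.
Proof.
move=> ig; rewrite /Rintegral fineK//.
by apply: integrable_fin_num => //; exact: measurable_oo.
Qed.

Lemma integral_cells h N (g : nat -> R -> R) : 0 < h ->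
  (forall k t, (k < N)%N -> 0 <= g k t) ->
  (forall k, (k < N)%N -> integrable_oo (k%:R * h) (k.+1%:R * h) (g k)) ->
  (\int[mu]_(t in `]0%R, (N%:R * h)%R[)
      \sum_(k < N) ((EFin \o g k) \_ (cell h k)) t
   = (\sum_(k < N) \int[mu]_(t in `]k%:R * h, k.+1%:R * h[) g k t)%:E)%E.
Proof.
move=> h0 g0 ig; rewrite ge0_integral_sum.
- rewrite -sumEFin; apply: eq_bigr => k _.
  rewrite -integral_mkcondr setIidr; last exact: cell_sub.
  by rewrite -Rintegral_ooE//; exact: ig.
- exact: measurable_oo.
- move=> k; apply/measurable_restrict; [exact: measurable_oo|exact: measurable_oo|].
  rewrite setIidr; last exact: cell_sub.
  by have /integrableP[] := ig k (ltn_ord k).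
- by move=> k t _; rewrite /patch; case: ifP => // _; rewrite lee_fin g0.
Qed.

Lemma sum_cells h N (g : nat -> R -> R) k t : 0 < h -> (k < N)%N ->
  k%:R * h < t < k.+1%:R * h ->
  (\sum_(j < N) ((EFin \o g j) \_ (cell h j)) t = (g k t)%:E)%E.
Proof.
move=> h0 kN kt; rewrite (bigD1 (Ordinal kN)) //= big1 ?adde0.
  by rewrite patchE mem_set//; apply/cellE.
move=> j jk; rewrite patchE memNset// => /cellE jt; move: jk.
by rewrite -val_eqE /= -(truncn_cell h0 jt) (truncn_cell h0 kt) eqxx.
Qed.

Lemma sum_Rintegral_cells T h N (g : R -> R) : 0 < h -> N%:R * h <= T ->
  (forall t, 0 <= g t) -> integrable_oo 0 T g ->
  \sum_(k < N) \int[mu]_(t in `]k%:R * h, k.+1%:R * h[) g t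
    <= \int[mu]_(t in `]0, T[) g t.
Proof.
move=> h0 NT g0 ig.
have ig' : integrable_oo 0 (N%:R * h) g by apply: integrable_ooS ig.
apply: le_trans (Rintegral_oo_subset (lexx _) NT ig g0).
rewrite -lee_fin -(Rintegral_ooE ig').
rewrite -(@integral_cells h N (fun=> g))//; last first.
  move=> k kN; apply: integrable_ooS ig'; first by rewrite mulr_ge0// ltW.
  by rewrite ler_pM2r// ler_nat.
apply: ae_on_le_integral.
- move=> t _; apply: sume_ge0 => k _.
  by rewrite patchE; case: ifP => // _; rewrite lee_fin.
- by move=> t _; rewrite lee_fin.
- by apply: ae_cell => // k kN; apply: ae_onW => t kt; rewrite (sum_cells _ h0 kN kt).
Qed.

(** The comparison is valid for any nonnegative [u], so squared error norms can be inserted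
    directly, and the majorant may have a different form on each cell. *)
Lemma integral_le_cells h N (u : R -> R) (g : nat -> R -> R) (c : nat -> R) :
  0 < h -> (forall t, 0 <= u t) -> (forall k t, (k < N)%N -> 0 <= g k t) ->
  (forall k, (k < N)%N -> integrable_oo (k%:R * h) (k.+1%:R * h) (g k)) ->
  (forall k, (k < N)%N ->
    ae_on (k%:R * h) (k.+1%:R * h) (fun t => u t <= g k t)) ->
  (forall k, (k < N)%N ->
    \int[mu]_(t in `]k%:R * h, k.+1%:R * h[) g k t <= c k) ->
  (\int[mu]_(t in `]0%R, (N%:R * h)%R[) (u t)%:E <= (\sum_(k < N) c k)%:E)%E.
Proof.
move=> h0 u0 g0 ig ug gc.
apply: (@le_trans _ _ (\sum_(k < N) \int[mu]_(t in `]k%:R * h, k.+1%:R * h[) g k t)%:E).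
  rewrite -(integral_cells h0 g0 ig); apply: ae_on_le_integral.
  - by move=> t _; rewrite lee_fin.
  - move=> t _; apply: sume_ge0 => k _.
    by rewrite patchE; case: ifP => // _; rewrite lee_fin g0.
  - apply: ae_cell => // k kN; apply: ae_onS (ug k kN) => t kt utk.
    by rewrite (sum_cells _ h0 kN kt) lee_fin.
by rewrite lee_fin; apply: ler_sum => k _; exact: gc.
Qed.

End Cells.

Section NormBounds.
Context {R : realType} {H : completeNormedModType R}.
Local Notation mu := (@lebesgue_measure R).
Implicit Types (X : nspace R H) (T h t c : R) (u w : R -> H).

Lemma LpNoo_le X T u c : 0 <= c -> ae_on 0 T (fun t => `|nrm X (u t)| <= c) ->
  (LpN X +oo 0 T u <= c%:E)%E.
Proof.
move=> c0 uc; rewrite /LpN unlock mu_setT_gt0; apply/ess_supP.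
move: uc; rewrite /ae_on; apply: filterS => t ut.
rewrite /= /patch; case: ifPn => [|_]; last by rewrite abse0 lee_fin.
by rewrite in_oo => /ut; rewrite /= lee_fin.
Qed.

Lemma LpN2_le X T u c : 0 <= c ->
  (\int[mu]_(t in `]0%R, T[) (nrm X (u t) ^+ 2)%:E <= c%:E)%E ->
  (LpN X 2%:E 0 T u <= (Num.sqrt c)%:E)%E.
Proof.
move=> c0 uc; rewrite LpN2E -powR12_sqrt// -poweR_EFin.
apply: gt0_ler_poweR => //.
- by rewrite in_itv/= leey andbT; apply: integral_ge0 => t _; rewrite lee_fin sqr_ge0.
- by rewrite in_itv/= leey andbT lee_fin.
Qed.

Lemma hat_convex h (x : nat -> H) k t y : 0 < h -> k%:R * h < t < k.+1%:R * h ->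
  let s := (t - k%:R * h) / h in
  [/\ 0 <= s, s <= 1 & hat h x t - y = (1 - s) *: (x k - y) + s *: (x k.+1 - y)].
Proof.
move=> h0 kt s; have kt' := kt; move: kt' => /andP[k1 k2].
have s0 : 0 <= s by apply: divr_ge0; [rewrite subr_ge0 ltW|exact: ltW].
have s1 : s <= 1.
  by rewrite ler_pdivrMr// mul1r lerBlDr; move: (ltW k2); rewrite -natr1 mulrDl mul1r addrC.
split=> //; rewrite /hat (truncn_cell h0 kt) /delta scalerA -/s.
have -> : x k.+1 - x k = (x k.+1 - y) - (x k - y) by rewrite opprB addrA subrK.
by rewrite scalerBl scale1r scalerBr addrAC [X in _ + X]addrC addrA.
Qed.

(** On a cell the error is a convex combination of the distances of two neighbouring nodal values
    from [w t]; each of them is a nodal error, at most [c], plus an oscillation of [w] inside the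
    cell, at most [c']. *)
Lemma hat_error X h N (x : nat -> H) w c c' : normed_subspace X -> 0 < h ->
  (forall k, (k <= N)%N ->
     carrier X (x k - w (k%:R * h)) /\ nrm X (x k - w (k%:R * h)) <= c) ->
  (forall k s t, (k < N)%N -> k%:R * h <= s -> s < t -> t <= k.+1%:R * h ->
     carrier X (w t - w s) /\ nrm X (w t - w s) <= c') ->
  forall k t, (k < N)%N -> k%:R * h < t < k.+1%:R * h ->
    carrier X (hat h x t - w t) /\ nrm X (hat h x t - w t) <= c + c'.
Proof.
move=> XP h0 xc wc k t kN kt; have XL := carrier_lin XP.
have /andP[k1 k2] := kt.
have [s0 s1 ->] := hat_convex x (w t) h0 kt; set s := _ / _ in s0 s1 *.
have [X1 n1] := xc k (ltnW kN); have [X2 n2] := xc k.+1 kN.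
have [Y1 m1] := wc k _ _ kN (lexx _) k1 (ltW k2).
have [Y2 m2] := wc k _ _ kN (ltW k1) k2 (lexx _).
have [X1' n1'] : carrier X (x k - w t) /\ nrm X (x k - w t) <= c + c'.
  have -> : x k - w t = (x k - w (k%:R * h)) - (w t - w (k%:R * h)).
    by rewrite opprB addrA subrK.
  split; first exact: lin_subspaceB.
  by apply: le_trans (nrmB XP X1 Y1) _; exact: lerD.
have [X2' n2'] : carrier X (x k.+1 - w t) /\ nrm X (x k.+1 - w t) <= c + c'.
  have -> : x k.+1 - w t = (x k.+1 - w (k.+1%:R * h)) + (w (k.+1%:R * h) - w t).
    by rewrite addrA subrK.
  split; first exact: lin_subspaceD.
  by apply: le_trans (nrmD XP X2 Y2) _; exact: lerD.
have Z1 := lin_subspaceZ (1 - s) XL X1'; have Z2 := lin_subspaceZ s XL X2'.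
split; first exact: lin_subspaceD.
have s1' : 0 <= 1 - s by rewrite subr_ge0.
apply: le_trans (nrmD XP Z1 Z2) _; rewrite !(nrmZ XP)// !ger0_norm//.
have := ler_wpM2l s1' n1'; have := ler_wpM2l s0 n2'; lra.
Qed.

End NormBounds.

Section CellBounds.
Context {R : realType}.
Local Notation mu := (@lebesgue_measure R).

(** Cauchy-Schwarz on a cell of length [h] gains the factor [h]. Applied to the norm of theta', it
    yields the O(h) bound for the sum of the m_n^2. *)
Lemma sum_sqr_Rintegral_cells (T h : R) N (g : R -> R) : 0 < h -> N%:R * h <= T ->
  square_integrable T g ->
  \sum_(k < N) (\int[mu]_(t in `]k%:R * h, k.+1%:R * h[) g t) ^+ 2
    <= h * \int[mu]_(t in `]0, T[) (g t ^+ 2).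
Proof.
move=> h0 NT [g0 ig ig2].
have := sum_Rintegral_cells h0 NT (fun t => sqr_ge0 (g t)) ig2.
move=> /(ler_wpM2l (ltW h0)); apply: le_trans.
rewrite mulr_sumr; apply: ler_sum => k _.
have kh : k%:R * h < k.+1%:R * h by rewrite ltr_pM2r// ltr_nat.
have i1 : 0 <= k%:R * h by rewrite mulr_ge0// ltW.
have i2 : k.+1%:R * h <= T by apply: le_trans NT; rewrite ler_pM2r// ler_nat.
have := Rintegral_oo_sqr_le kh (integrable_ooS i1 i2 ig) (integrable_ooS i1 i2 ig2).
by have -> : k.+1%:R * h - k%:R * h = h by rewrite -natr1; ring.
Qed.

(** Here [d k] is the dissipation, [al k] the norm of the operator at the average, [g] its norm
    along the exact solution, and [m k] the oscillation of the solution. Since [al k] is at most the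
    mean of [g] over the cell, the terms with [al k] and with [g t] contribute equally, hence the
    factor 4. *)
Lemma integral_operator_error (T h : R) N (e g : R -> R) (d al m c : nat -> R) :
  0 < h -> N%:R * h <= T -> square_integrable T g ->
  (forall k, (k < N)%N -> [/\ 0 <= d k, 0 <= al k, 0 <= m k & 0 <= c k]) ->
  (forall t, 0 <= e t) ->
  (forall k, (k < N)%N ->
     h * al k <= \int[mu]_(t in `]k%:R * h, k.+1%:R * h[) g t) ->
  (forall k, (k < N)%N -> ae_on (k%:R * h) (k.+1%:R * h)
     (fun t => e t <= 2 * d k + 2 * (al k + g t) * m k + c k)) ->
  (\int[mu]_(t in `]0%R, (N%:R * h)%R[) (e t)%:E
    <= (\sum_(k < N) (2 * h * d k
         + 4 * m k * \int[mu]_(t in `]k%:R * h, k.+1%:R * h[) g t + h * c k))%:E)%E.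
Proof.
move=> h0 NT [g0 ig _] pos e0 alg eg.
pose G k t := (2 * d k + 2 * al k * m k + c k) + 2 * m k * g t.
have igk k : (k < N)%N -> integrable_oo (k%:R * h) (k.+1%:R * h) g.
  move=> kN; apply: integrable_ooS ig; first by rewrite mulr_ge0// ltW.
  by apply: le_trans NT; rewrite ler_pM2r// ler_nat.
apply: (@integral_le_cells R h N e G (fun k => 2 * h * d k
  + 4 * m k * \int[mu]_(t in `]k%:R * h, k.+1%:R * h[) g t + h * c k)) => //.
- by move=> k t /pos[d0 al0 m0 c0]; rewrite /G !addr_ge0// !mulr_ge0.
- move=> k kN; apply: integrable_ooD; first exact: integrable_oo_cst.
  by apply: integrable_ooZ; exact: igk.
- by move=> k kN; apply: ae_onS (eg k kN) => t _; rewrite /G; lra.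
move=> k kN.
have kh : k%:R * h <= k.+1%:R * h by rewrite ler_pM2r// ler_nat.
rewrite /G Rintegral_ooD; [|exact: integrable_oo_cst|by apply: integrable_ooZ; exact: igk].
rewrite Rintegral_ooZ; last exact: igk.
rewrite Rintegral_oo_cst//.
have -> : k.+1%:R * h - k%:R * h = h by rewrite -natr1; ring.
have [_ _ m0 _] := pos k kN; have := ler_wpM2r m0 (alg k kN); lra.
Qed.

End CellBounds.

Section OperatorBounds.
Context {R : realType} {H : completeNormedModType R}.
Local Notation mu := (@lebesgue_measure R).
Variable ip : H -> H -> R.
Hypothesis ipP : psd_form setT ip.
Hypothesis ipE : forall x, `|x| ^+ 2 = ip x x.

(** To be read with [x] discrete, [y] the average and [z] the exact value. Only [|y - z|] is small,
    while [A y] and [A z] are just controlled in L^2 in time; hence smallness appears once and not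
    squared. *)
Lemma psd_operator_split (A : operator H) x y z : linear_operator A ->
  psd_form (dom A) (fun x y => ip (A x) y) -> dom A x -> dom A y -> dom A z ->
  ip (A (x - z)) (x - z)
    <= 2 * ip (A (x - y)) (x - y) + 2 * (`|A y| + `|A z|) * `|y - z|.
Proof.
move=> Al AP Dx Dy Dz; have AL := Al.1.
have -> : x - z = (x - y) + (y - z) by rewrite addrA subrK.
apply: le_trans (psd_sqrD_le AP (lin_subspaceB AL Dx Dy) (lin_subspaceB AL Dy Dz)) _.
rewrite lerD2l -mulrA ler_wpM2l//; apply: le_trans (ler_norm _) _.
apply: le_trans (ip_norm_le ipP ipE _ _) _; rewrite ler_wpM2r//.
by rewrite (linopB Al)//; exact: ler_normB.
Qed.

Lemma nonneg_sqrt_sqr (A S : operator H) x : nonneg_sqrt ip A S -> dom A x ->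
  `|S x| ^+ 2 = ip (A x) x.
Proof.
move=> [_ [_ sS] _ dA SA] Dx; have [D1 D2] := (dA x).1 Dx.
by rewrite ipE -(SA x Dx) ((sS x (S x)).2 (conj D1 erefl) (S x) D2).
Qed.

(** By Cauchy-Schwarz on each cell, averaging does not increase the L^2 norm, so the bound is
    uniform in [h]. *)
Lemma discrete_source_bound (T : R) (f : R -> H) : Lp whole 2%:E 0 T f ->
  exists2 Q : R, 0 <= Q & forall h N, 0 < h -> N%:R * h <= T ->
    \sum_(k < N) (h * `|f_ f h k.+1| ^+ 2) <= Q.
Proof.
move=> /Lp2_L1[fr [fE Lfr ifr2]].
have sq := norm_square_integrable Lfr ifr2.
exists (\int[mu]_(t in `]0, T[) (`|fr t| ^+ 2)).
  by apply: Rintegral_ge0 => t _; rewrite sqr_ge0.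
move=> h N h0 NT; rewrite -(ler_pM2l h0).
apply: le_trans (sum_sqr_Rintegral_cells h0 NT sq).
rewrite mulr_sumr; apply: ler_sum => k _.
have i1 : 0 <= k%:R * h by rewrite mulr_ge0// ltW.
have i2 : k.+1%:R * h <= T by apply: le_trans NT; rewrite ler_pM2r// ler_nat.
have [m_ i_] := L1_ooS i1 i2 Lfr; have fE' := ae_on_sub i1 i2 fE.
have NW := @normed_subspace_whole R H.
have bP := bochner_integralP ipP ipE NW m_ i_ fE' (@complete_whole R H).
have W1 : forall x, carrier whole x -> `|x| <= 1 * nrm (@whole R H) x.
  by move=> x _; rewrite mul1r.
have W : weak_integral ip (k%:R * h) (k.+1%:R * h) fr
    (bochner_integral whole (k%:R * h) (k.+1%:R * h) f).
  by move=> z; exact: (is_bochner_ip ipP ipE NW W1 m_ i_ fE' z bP).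
have := weak_integral_norm ipP ipE m_ i_ W.
set b := bochner_integral _ _ _ _; set I := (\int[_]_(_ in _) _) => bI.
rewrite /f_ /= -/b normrZ exprMn ger0_norm ?invr_ge0 ?(ltW h0)//.
have -> : h * (h * (h^-1 ^+ 2 * `|b| ^+ 2)) = `|b| ^+ 2.
  by field; rewrite gt_eqF.
by rewrite ler_pXn2r ?nnegrE//; exact: le_trans bI.
Qed.

End OperatorBounds.

(** * Young inequalities for the two Gronwall arguments *)

Section Arithmetic.
Context {R : realType}.

(** Here [x], [y], [t], [g] are the norms of v_{n+1}, phi_{n+1}, theta_{n+1}, f_{n+1}; [lv], [a],
    [i] are the L-form, the A_2-form and the potential, primed at the new time; [pv], [fv], [cv],
    [pD] are the pairings (v, phi), (f, theta), (cL phi, v), (Phi phi, v). The pairings [pv] and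
    [cv] each cost one [x ^+ 2], hence [2 / cl]; the dissipations [bB] and [bA] are dropped. *)
Lemma energy_arith (h cl Ccl c0 x y t g lv lv' a a' y0 t0 i i' bB bA pv fv cv pD : R) :
  0 < h -> 0 < cl -> 0 <= Ccl -> 0 <= x -> 0 <= y -> 0 <= a' -> 0 <= i' ->
  0 <= bB -> 0 <= bA -> cl * x ^+ 2 <= lv' ->
  i' - i <= h * pD -> y ^+ 2 - y0 ^+ 2 <= 2 * h * pv -> pv <= x * y ->
  - cv <= (c0 + Ccl * y) * x -> fv <= g * t ->
  (lv' - lv) + (a' - a) + (t ^+ 2 - t0 ^+ 2) + 2 * h * bB + 2 * h * bA
    <= 2 * h * fv - 2 * h * (pD + cv) ->
  lv' + a' + y ^+ 2 + t ^+ 2 + 2 * i' + 0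
    <= lv + a + y0 ^+ 2 + t0 ^+ 2 + 2 * i + (2 * c0 ^+ 2 * h + h * g ^+ 2)
       + (2 / cl + 2 + 2 * Ccl ^+ 2) * h * (lv' + a' + y ^+ 2 + t ^+ 2 + 2 * i').
Proof.
move=> h0 cl0 Ccl0 x0 y0' a0 i0 bB0 bA0 lx ip1 e1 e2 e3 e4 st.
have k1 : 2 * x ^+ 2 <= 2 / cl * lv'.
  by rewrite mulrAC ler_pdivlMr// -mulrA ler_wpM2l// mulrC.
have lv0 : 0 <= lv' by apply: le_trans lx; rewrite mulr_ge0 ?sqr_ge0// ltW.
have c1 : 0 <= 2 / cl by rewrite divr_ge0// ltW.
have k2 : 2 * pv <= x ^+ 2 + y ^+ 2 by have := sqr_ge0 (x - y); rewrite sqrrB; lra.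
have k3 : - 2 * cv <= x ^+ 2 + 2 * c0 ^+ 2 + 2 * (Ccl ^+ 2 * y ^+ 2).
  have := sqr_ge0 (x - (c0 + Ccl * y)); have := sqr_ge0 (c0 - Ccl * y).
  by rewrite !sqrrB !sqrrD exprMn; lra.
have k4 : 2 * fv <= g ^+ 2 + t ^+ 2 by have := sqr_ge0 (g - t); rewrite sqrrB; lra.
have k5 : 2 * pv - 2 * cv + 2 * fv <= 2 * c0 ^+ 2 + g ^+ 2
    + (2 / cl + 2 + 2 * Ccl ^+ 2) * (lv' + a' + y ^+ 2 + t ^+ 2 + 2 * i').
  have p1 : 0 <= 2 / cl * (a' + y ^+ 2 + t ^+ 2 + 2 * i').
    by rewrite mulr_ge0// !addr_ge0 ?sqr_ge0// mulr_ge0.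
  have p2 : 0 <= Ccl ^+ 2 * (lv' + a' + t ^+ 2 + 2 * i').
    by rewrite mulr_ge0 ?sqr_ge0// !addr_ge0 ?sqr_ge0// mulr_ge0.
  have := sqr_ge0 y; have := sqr_ge0 t; lra.
have k6 := ler_wpM2l (ltW h0) k5.
have k7 : 0 <= h * bB by rewrite mulr_ge0// ltW.
have k8 : 0 <= h * bA by rewrite mulr_ge0// ltW.
lra.
Qed.

(** Here [x], [y], [t] are the [H] norms of the new E, F, G, [yV] is the V_2 norm of F and [dn] the
    norm of D; [lrho], [ar], [tau] are the quadratic consistency errors, and [pv], [pD] the pairings
    of D with F and with the nonlinear difference. Each pairing costs one [dn ^+ 2], and
    [dn <= x + K * h], hence the constants [4 / cl] and [4 * K ^+ 2]. The dissipations are kept. *)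
Lemma error_arith (h cl om CL C2 K K1 x y yV dn t lE lE' lrho a a' ar qn y0 t0 tau
    bB bA pv pD : R) :
  0 < h -> h <= 1 -> 0 < cl -> 0 < om -> 0 <= CL -> 0 <= C2 -> 0 <= K -> 0 <= K1 ->
  0 <= x -> 0 <= y -> 0 <= yV -> 0 <= dn -> 0 <= lE' -> 0 <= a' ->
  lrho <= CL * (K * h) ^+ 2 -> ar <= C2 * (K * h) ^+ 2 -> tau <= qn ->
  y ^+ 2 - y0 ^+ 2 <= 2 * h * pv -> pv <= dn * y ->
  - pD <= K1 * (yV + K * h) * dn -> dn <= x + K * h ->
  cl * x ^+ 2 <= lE' -> om * yV ^+ 2 <= a' + y ^+ 2 ->
  (lE' - lE - lrho) + (a' - a - ar) + (t ^+ 2 - t0 ^+ 2 - tau)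
    + 2 * h * bB + 2 * h * bA <= 2 * h * 0 - 2 * h * pD ->
  (lE' + a' + y ^+ 2 + t ^+ 2) + (2 * h * bB + 2 * h * bA)
    <= (lE + a + y0 ^+ 2 + t0 ^+ 2)
       + (h ^+ 2 * (CL * K ^+ 2 + C2 * K ^+ 2 + 4 * K ^+ 2 + 2 * K1 ^+ 2 * K ^+ 2) + qn)
       + (4 / cl + 1 + 2 * K1 ^+ 2 / om) * h * (lE' + a' + y ^+ 2 + t ^+ 2).
Proof.
move=> h0 h1 cl0 om0 CL0 C20 K0 K10 x0 y0' yV0 dn0 lE0 a0 e1 e2 e3 e4 e5 e6 e7 e8 e9 st.
have k1 : 4 * x ^+ 2 <= 4 / cl * lE'.
  by rewrite mulrAC ler_pdivlMr// -mulrA ler_wpM2l// mulrC.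
have k2 : 2 * K1 ^+ 2 * yV ^+ 2 <= 2 * K1 ^+ 2 / om * (a' + y ^+ 2).
  have -> : 2 * K1 ^+ 2 / om * (a' + y ^+ 2) = (2 * K1 ^+ 2) * (a' + y ^+ 2) / om by ring.
  rewrite ler_pdivlMr// -[leLHS]mulrA ler_wpM2l ?mulr_ge0 ?sqr_ge0//.
  by rewrite mulrC.
have Kh0 : 0 <= K * h by rewrite mulr_ge0// ltW.
have k3 : dn ^+ 2 <= 2 * x ^+ 2 + 2 * (K * h) ^+ 2.
  have : dn ^+ 2 <= (x + K * h) ^+ 2 by rewrite ler_pXn2r ?nnegrE ?addr_ge0.
  have := sqr_ge0 (x - K * h); rewrite sqrrB sqrrD; lra.
have k4 : 2 * pv <= dn ^+ 2 + y ^+ 2 by have := sqr_ge0 (dn - y); rewrite sqrrB; lra.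
have k5 : - 2 * pD <= 2 * K1 ^+ 2 * yV ^+ 2 + 2 * K1 ^+ 2 * (K * h) ^+ 2 + dn ^+ 2.
  have := sqr_ge0 (K1 * (yV + K * h) - dn); rewrite sqrrB exprMn.
  have := ler_wpM2l (sqr_ge0 K1) (sqr_ge0 (yV - K * h)).
  by rewrite mulr0 sqrrB sqrrD; lra.
have h2 : (K * h) ^+ 2 <= K ^+ 2 * h.
  by rewrite exprMn ler_wpM2l ?sqr_ge0// expr2 ler_piMl// ltW.
have k6 : 2 * pv - 2 * pD <= (4 * K ^+ 2 + 2 * K1 ^+ 2 * K ^+ 2) * h
    + (4 / cl + 1 + 2 * K1 ^+ 2 / om) * (lE' + a' + y ^+ 2 + t ^+ 2).
  have p1 : 0 <= 4 / cl * (a' + y ^+ 2 + t ^+ 2).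
    by rewrite mulr_ge0 ?divr_ge0 ?(ltW cl0)// !addr_ge0 ?sqr_ge0.
  have p2 : 0 <= 2 * K1 ^+ 2 / om * (lE' + t ^+ 2).
    by rewrite mulr_ge0 ?divr_ge0 ?mulr_ge0 ?sqr_ge0 ?(ltW om0)// !addr_ge0 ?sqr_ge0.
  have p3 : 2 * K1 ^+ 2 * (K * h) ^+ 2 <= 2 * K1 ^+ 2 * (K ^+ 2 * h).
    by rewrite ler_wpM2l// mulr_ge0// sqr_ge0.
  have := sqr_ge0 t; lra.
have k7 := ler_wpM2l (ltW h0) k6.
rewrite !exprMn in e1 e2.
lra.
Qed.

Lemma sqrt_rate (a M h x : R) : 0 < a -> 0 <= M -> 0 <= h -> 0 <= x ->
  a * x ^+ 2 <= M * h -> x <= Num.sqrt (M / a) * Num.sqrt h.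
Proof.
move=> a0 M0 h0 x0 xM; rewrite -(ger0_norm x0) -sqrtr_sqr -sqrtrM ?(divr_ge0 M0 (ltW a0))//.
by rewrite ler_wsqrtr// mulrAC ler_pdivlMr// mulrC.
Qed.

Lemma le_sqrt1 (h : R) : 0 <= h -> h <= 1 -> h <= Num.sqrt h.
Proof.
move=> h0 h1; rewrite -{1}(sqr_sqrtr h0) expr2 ler_piMl ?sqrtr_ge0//.
by rewrite -sqrtr1 ler_wsqrtr.
Qed.

End Arithmetic.

(** * Energy bound and error estimate for the scheme *)

Section Scheme.
Context {R : realType} {H : completeNormedModType R}.
Local Notation mu := (@lebesgue_measure R).
Variable ip : H -> H -> R.
Hypothesis ipP : psd_form setT ip.
Hypothesis ipE : forall x, `|x| ^+ 2 = ip x x.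
Variables (X2 : nspace R H) (L : H -> H) (A1 B A2 Phi : operator H).
Variables (cL : H -> H) (T : R) (th0 ph0 v0 : H) (f : R -> H).
Variables (a2 : H -> H -> R) (i : H -> R) (cl CL C2 om Ccl : R).
Hypothesis T0 : 0 < T.
Hypothesis X2P : normed_subspace X2.
Hypothesis LL : linear L.
Hypothesis LP : psd_form setT (fun x y => ip (L x) y).
Hypothesis cl0 : 0 < cl.
Hypothesis Lcl : forall x, cl * `|x| ^+ 2 <= ip (L x) x.
Hypothesis CL0 : 0 <= CL.
Hypothesis LCL : forall x, ip (L x) x <= CL * `|x| ^+ 2.
Hypothesis A1l : linear_operator A1.
Hypothesis A1P : psd_form (dom A1) (fun x y => ip (A1 x) y).
Hypothesis Bl : linear_operator B.
Hypothesis BP : psd_form (dom B) (fun x y => ip (B x) y).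
Hypothesis A2l : linear_operator A2.
Hypothesis a2P : psd_form (carrier X2) a2.
Hypothesis C20 : 0 <= C2.
Hypothesis a2C : forall x, carrier X2 x -> a2 x x <= C2 * nrm X2 x ^+ 2.
Hypothesis om0 : 0 < om.
Hypothesis a2om : forall x, carrier X2 x ->
  om * nrm X2 x ^+ 2 <= a2 x x + `|x| ^+ 2.
Hypothesis A2X2 : dom A2 `<=` carrier X2.
Hypothesis A2a2 : forall x y, dom A2 x -> carrier X2 y -> a2 x y = ip (A2 x) y.
Hypothesis i0 : forall x, carrier X2 x -> 0 <= i x.
Hypothesis Phii : forall x y, carrier X2 x -> carrier X2 y ->
  i x - i y <= ip (Phi x) (x - y).
Hypothesis Ccl0 : 0 <= Ccl.
Hypothesis cLL : forall x y, `|cL x - cL y| <= Ccl * `|x - y|.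
Hypothesis B0 : dom B ph0.
Hypothesis A20 : dom A2 ph0.
Hypothesis Bv0 : dom B v0.

Let X2L := carrier_lin X2P.

Section Discrete.
Variables (h : R) (N : nat) (th ph : nat -> H).
Hypothesis sol : discrete_solution L A1 B A2 Phi cL th0 ph0 v0 f h N th ph.

Let vd := discrete_v v0 h ph.

Lemma discrete_domA2 n : (n <= N)%N -> dom A2 (ph n).
Proof.
case: n => [_|n nN]; first by have [_ -> _] := sol.
by have [_ _ /(_ n nN)[]] := sol.
Qed.

Lemma discrete_domB n : (n <= N)%N -> dom B (ph n).
Proof.
case: n => [_|n nN]; first by have [_ -> _] := sol.
by have [_ _ /(_ n nN)[]] := sol.
Qed.

Lemma discrete_vS n : vd n.+1 = h^-1 *: (ph n.+1 - ph n).
Proof. by []. Qed.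

Lemma discrete_v_domB n : (n <= N)%N -> dom B (vd n).
Proof.
case: n => [//|n nN]; apply: (lin_subspaceZ _ Bl.1).
by apply: lin_subspaceB Bl.1 _ _; apply: discrete_domB => //; exact: ltnW.
Qed.

Lemma discrete_eqs n : (n < N)%N ->
  [/\ dom A1 (th n.+1),
      h^-1 *: (th n.+1 - th n) + vd n.+1 + A1 (th n.+1) = f_ f h n.+1
    & h^-1 *: L (vd n.+1 - vd n) + B (vd n.+1) + A2 (ph n.+1)
        + (Phi (ph n.+1) + cL (ph n.+1)) = th n.+1].
Proof.
move=> nN; have [_ _ /(_ n nN)[D1 D2 D3 e1 e2]] := sol; split=> //.
have LZ c x : L (c *: x) = c *: L x.
  have L0 : L 0 = 0.
    by have := LL (-1) 0 0; rewrite scaleN1r oppr0 addr0 scaleN1r addNr.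
  by rewrite -[c *: x]addr0 LL L0 addr0.
by rewrite -LZ addrA.
Qed.

Lemma discrete_X2 n : (n <= N)%N -> carrier X2 (ph n).
Proof. by move=> nN; apply: A2X2; exact: discrete_domA2. Qed.

End Discrete.

Let KE := 2 / cl + 2 + 2 * Ccl ^+ 2.

(** [r] is chosen before [h] and [N]. The potential enters through the one-sided inequality [Phii],
    so the local Lipschitz bound of [Phi] is not yet involved; it is the radius [r] that later makes
    this bound uniform. *)
Lemma energy_bound (Qf : R) : 0 <= Qf -> exists2 r : R, 0 <= r &
  forall (h : R) N th ph, 0 < h -> KE * h <= 2^-1 -> h * N%:R <= T ->
    discrete_solution L A1 B A2 Phi cL th0 ph0 v0 f h N th ph ->
    \sum_(k < N) (h * `|f_ f h k.+1| ^+ 2) <= Qf ->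
    forall n, (n <= N)%N -> nrm X2 (ph n) <= r.
Proof.
move=> Qf0.
pose S0 := ip (L v0) v0 + a2 ph0 ph0 + `|ph0| ^+ 2 + `|th0| ^+ 2 + 2 * i ph0.
pose c0 := `|cL 0|.
pose M := expR (2 * KE * T) * (S0 + (2 * c0 ^+ 2 * T + Qf)).
have S00 : 0 <= S0.
  have Xp := A2X2 A20.
  rewrite !addr_ge0 ?sqr_ge0 ?mulr_ge0 ?i0// ?(psd_ge0 a2P)//.
  exact: (psd_ge0 LP).
have M0 : 0 <= M.
  have h1 : 0 <= 2 * c0 ^+ 2 * T.
    by apply: mulr_ge0; [rewrite mulr_ge0// sqr_ge0|exact: ltW].
  by rewrite mulr_ge0 ?expR_ge0// addr_ge0// addr_ge0.
exists (Num.sqrt (M / om)); first exact: sqrtr_ge0.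
move=> h N th ph h0 Kh hN sol fQ n nN.
pose vd := discrete_v v0 h ph.
pose S n := ip (L (vd n)) (vd n) + a2 (ph n) (ph n) + `|ph n| ^+ 2 + `|th n| ^+ 2
            + 2 * i (ph n).
pose b n := 2 * c0 ^+ 2 * h + h * `|f_ f h n.+1| ^+ 2.
have KE0 : 0 <= KE by rewrite /KE !addr_ge0// mulr_ge0 ?sqr_ge0 ?invr_ge0 ?(ltW cl0).
have b0 k : 0 <= b k.
  apply: addr_ge0; apply: mulr_ge0; rewrite ?sqr_ge0 ?(ltW h0)//.
  by rewrite mulr_ge0// sqr_ge0.
have step k : (k < N)%N -> S k.+1 + 0 <= S k + b k + KE * h * S k.+1.
  move=> kN; have [D1 e1 e2] := discrete_eqs sol kN.
  have X1 := discrete_X2 sol (ltnW kN); have X1' := discrete_X2 sol kN.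
  have D2 := discrete_domA2 sol kN.
  have vE := discrete_vS h ph k; rewrite -/vd in vE e1 e2.
  (* [scheme_step] is applied to the discrete solution itself, with all three consistency errors
     equal to 0. *)
  have W0 : carrier X2 0 by case: X2L.
  have hA2 : ip (A2 (ph k.+1)) (ph k.+1 - ph k) = a2 (ph k.+1 - ph k) (ph k.+1 + 0).
    have Xd := lin_subspaceB X2L X1' X1.
    by rewrite addr0 (psdC a2P)// A2a2.
  have := scheme_step ipP a2P LP h0 X1 X1' W0 vE (esym (addr0 _)) (esym (addr0 _)) e2 e1 hA2.
  rewrite (psd0l LP)// (psd0l a2P)// (psd0l ipP)// !subr0.
  have bD := psd_ge0 BP (discrete_v_domB sol kN).
  have aD := psd_ge0 A1P D1.
  have hvd : h *: vd k.+1 = ph k.+1 - ph k.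
    by rewrite vE scalerA mulfV ?scale1r// gt_eqF.
  have iphi := Phii X1' X1; rewrite -hvd (psdZr ipP)// in iphi.
  rewrite (psdDl ipP (I : setT (Phi _)))//.
  have n1 : `|ph k.+1| ^+ 2 - `|ph k| ^+ 2 <= 2 * h * ip (vd k.+1) (ph k.+1).
    have := psd_euler ipP (x := ph k) (x' := ph k.+1) (y := 0) I I I.
    by rewrite (psd0l ipP)// addr0 subr0 -!ipE -hvd (psdZl ipP)// mulrA.
  have n2 := ip_norm_le ipP ipE (vd k.+1) (ph k.+1).
  have n3 := ip_norm_le ipP ipE (cL (ph k.+1)) (vd k.+1).
  have n4 := ip_norm_le ipP ipE (f_ f h k.+1) (th k.+1).
  have n5 : `|cL (ph k.+1)| <= c0 + Ccl * `|ph k.+1|.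
    rewrite -[cL (ph k.+1)](subrK (cL 0)) addrC; apply: le_trans (ler_normD _ _) _.
    by rewrite lerD2l; have := cLL (ph k.+1) 0; rewrite subr0.
  have n6 := Lcl (vd k.+1).
  have n7 := a2om X1'; have n7' := i0 X1'.
  have n8 := psd_ge0 a2P X1'.
  rewrite -!ipE.
  move: (ler_norm (ip (vd k.+1) (ph k.+1))) (ler_norm (- ip (cL (ph k.+1)) (vd k.+1)))
    (ler_norm (ip (f_ f h k.+1) (th k.+1))); rewrite normrN => m1 m2 m3 st.
  have {n2 m1}n2 := le_trans m1 n2; have {n3 m2}n3 := le_trans m2 n3.
  have {n4 m3}n4 := le_trans m3 n4.
  rewrite /S /b /KE.
  apply: (@energy_arith R h cl Ccl c0 `|vd k.+1| `|ph k.+1| _ _ _ _ _ _ _ _ _ _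
    (ip (B (vd k.+1)) (vd k.+1)) (ip (A1 (th k.+1)) (th k.+1)) _ _ _ _
    h0 cl0 Ccl0 _ _ n8 n7' bD aD n6 iphi n1 n2 _ n4) => //.
    by apply: le_trans n3 _; rewrite ler_wpM2r.
  by move: st; rewrite !ipE.
have G := @discrete_gronwall R N S (fun=> 0) b (KE * h) _ Kh _ _ _ step n nN.
have {G}G : S n <= M.
  have nT : h * n%:R <= T.
    by apply: le_trans hN; rewrite ler_wpM2l ?ler_nat// ltW.
  have fb : \sum_(k < n) b k <= 2 * c0 ^+ 2 * T + Qf.
    rewrite big_split /= sumr_const card_ord; apply: lerD.
      have -> : (2 * c0 ^+ 2 * h) *+ n = 2 * c0 ^+ 2 * (h * n%:R).
        by rewrite -(mulr_natr _ n) ; ring.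
      by rewrite ler_wpM2l// mulr_ge0// sqr_ge0.
    apply: le_trans fQ; rewrite (big_ord_widen N (fun k => h * `|f_ f h k.+1| ^+ 2) nN).
    rewrite [leRHS](bigID (fun k : 'I_N => (k < n)%N)) /= lerDl.
    by apply: sumr_ge0 => k _; rewrite mulr_ge0 ?sqr_ge0// ltW.
  have := G _ _ _ _; rewrite big1// addr0 => {}G.
  apply: le_trans (G _ _ _ _) _.
  - by rewrite mulr_ge0// ltW.
  - by rewrite /S /vd /=; have [-> -> _] := sol; exact: S00.
  - by [].
  - exact: b0.
  have -> : S 0 = S0 by rewrite /S /vd /=; have [-> -> _] := sol.
  apply: ler_pM; rewrite ?expR_ge0//.
  - by rewrite addr_ge0// sumr_ge0.
  - by rewrite ler_expR -!mulrA !ler_wpM2l.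
  - by rewrite lerD2l.
have X1 := discrete_X2 sol nN.
rewrite -(@ler_pXn2r _ 2)// ?nnegrE ?sqrtr_ge0 ?nrm_ge0//.
rewrite sqr_sqrtr; last by rewrite divr_ge0// ltW.
rewrite ler_pdivlMr// mulrC; apply: le_trans (a2om X1) _; apply: le_trans G.
have : 0 <= ip (L (vd n)) (vd n) by exact: (psd_ge0 LP).
have := i0 X1; have := sqr_ge0 `|th n|; rewrite /S; lra.
Qed.

Section ErrorBound.
Variables (C0 Cp p q K r : R) (wt wp wv : R -> H) (gt gA gB : R -> R).
Hypothesis C00 : 0 <= C0.
Hypothesis Cp0 : 0 <= Cp.
Hypothesis K0 : 0 <= K.
Hypothesis r0 : 0 <= r.
Hypothesis wt0 : wt 0 = th0.
Hypothesis wp0 : wp 0 = ph0.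
Hypothesis wv0 : wv 0 = v0.

(** A Lipschitz constant of [Phi + cL], from the V_2 norm to the norm of [H], between points of V_2
    norm at most [r] and at most [K]. *)
Let K1 := Cp * (1 + r `^ p + K `^ q) + Ccl * C0.
Let KR := 4 / cl + 1 + 2 * K1 ^+ 2 / om.
Let Kb := CL * K ^+ 2 + C2 * K ^+ 2 + 4 * K ^+ 2 + 2 * K1 ^+ 2 * K ^+ 2.

Lemma error_bound (Qt : R) : exists2 M : R, 0 <= M &
  forall (h : R) N th ph (vb pb tb Pb : nat -> H),
    0 < h -> h <= 1 -> KR * h <= 2^-1 -> h * N%:R <= T ->
    let vd := discrete_v v0 h ph in
    let E n := vd n - wv (n%:R * h) in
    let F n := ph n - wp (n%:R * h) in
    let G n := th n - wt (n%:R * h) in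
    discrete_solution L A1 B A2 Phi cL th0 ph0 v0 f h N th ph ->
    (forall n, (n < N)%N -> averaged_solution X2 L A1 B A2 Phi cL f C0 Ccl Cp p q
       wt wp wv K gt gA gB (n%:R * h) (n.+1%:R * h) (vb n) (pb n) (tb n) (Pb n)) ->
    (forall n, (n <= N)%N -> nrm X2 (ph n) <= r) ->
    (forall n, (n <= N)%N -> carrier X2 (wp (n%:R * h))) ->
    \sum_(k < N) (\int[mu]_(y in `]k%:R * h, k.+1%:R * h[) gt y) ^+ 2 <= h * Qt ->
    forall n, (n <= N)%N ->
      (ip (L (E n)) (E n) + a2 (F n) (F n) + `|F n| ^+ 2 + `|G n| ^+ 2)
      + \sum_(k < n) (2 * h * ip (B (vd k.+1 - vb k)) (vd k.+1 - vb k)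
                      + 2 * h * ip (A1 (th k.+1 - tb k)) (th k.+1 - tb k)) <= M * h.
Proof.
have K10 : 0 <= K1 by rewrite /K1 addr_ge0 ?mulr_ge0// !addr_ge0// powR_ge0.
have Kb0 : 0 <= Kb by rewrite /Kb !addr_ge0// !mulr_ge0 ?sqr_ge0.
have KR0 : 0 <= KR.
  by rewrite /KR !addr_ge0// ?mulr_ge0 ?divr_ge0 ?invr_ge0 ?sqr_ge0 ?(ltW cl0) ?(ltW om0).
(* The Gronwall factor times the accumulated sources divided by [h]: errors [h ^+ 2 * Kb] over at
   most [T / h] steps, and the squared integrals of [gt]. The absolute value is there because [Qt]
   is still an arbitrary number. *)
exists (expR (2 * KR * T) * (T * Kb + `|Qt|)).
  by rewrite mulr_ge0 ?expR_ge0// addr_ge0// mulr_ge0// ltW.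
move=> h N th ph vb pb tb Pb h0 h1 Kh hN vd E F G sol avg phr Xwp gtQ.
have LB x y : L x - L y = L (x - y).
  by rewrite [x - y]addrC -(scaleN1r y) LL scaleN1r addrC.
have sD (x y x' y' : H) : (x + y) - (x' + y') = (x - x') + (y - y').
  by rewrite opprD addrACA.
have sB (x y x' y' : H) : (x - y) - (x' - y') = (x - x') - (y - y').
  by rewrite sD -opprD.
have tN n : n.+1%:R * h - n%:R * h = h by rewrite -natr1; ring.
pose S n := ip (L (E n)) (E n) + a2 (F n) (F n) + `|F n| ^+ 2 + `|G n| ^+ 2.
pose dB k := ip (B (vd k.+1 - vb k)) (vd k.+1 - vb k).
pose dA k := ip (A1 (th k.+1 - tb k)) (th k.+1 - tb k).
(* Gronwall's lemma wants nonnegativity at every index, but beyond [N] the arguments need not lie in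
   the domains of [B] and [A1]. *)
pose d k := if (k < N)%N then 2 * h * dB k + 2 * h * dA k else 0.
pose qn k := (\int[mu]_(y in `]k%:R * h, k.+1%:R * h[) gt y) ^+ 2.
pose b k := h ^+ 2 * Kb + qn k.
have dB0 k : (k < N)%N -> 0 <= dB k.
  move=> kN; apply: (psd_ge0 BP); apply: lin_subspaceB Bl.1 _ _.
    exact: (discrete_v_domB sol kN).
  exact: (avg_domB (avg k kN)).
have dA0 k : (k < N)%N -> 0 <= dA k.
  move=> kN; apply: (psd_ge0 A1P); apply: lin_subspaceB A1l.1 _ _.
    by have [] := discrete_eqs sol kN.
  exact: (avg_domA1 (avg k kN)).
have d0 k : 0 <= d k.
  by rewrite /d; case: ifP => // kN; rewrite addr_ge0 ?mulr_ge0 ?dB0 ?dA0// ltW.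
have qn0 k : 0 <= qn k by exact: sqr_ge0.
have b0 k : 0 <= b k by apply: addr_ge0 (qn0 k); apply: mulr_ge0 => //; exact: sqr_ge0.
have XF n : (n <= N)%N -> carrier X2 (F n).
  by move=> nN; apply: lin_subspaceB X2L _ _; [exact: (discrete_X2 sol nN)|exact: Xwp].
have step k : (k < N)%N -> S k.+1 + d k <= S k + b k + KR * h * S k.+1.
  move=> kN; have ak := avg k kN; have [D1 e1 e2] := discrete_eqs sol kN.
  have X1 := discrete_X2 sol (ltnW kN); have X1' := discrete_X2 sol kN.
  have D2 := discrete_domA2 sol kN; have DB := discrete_v_domB sol kN.
  have o2 : k%:R * h <= k.+1%:R * h <= k.+1%:R * h.
    by rewrite lexx andbT ler_pM2r// ler_nat leqnSn.
  pose rho := wv (k.+1%:R * h) - vb k.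
  pose rr := wp (k.+1%:R * h) - pb k.
  pose tau := wt (k.+1%:R * h) - tb k.
  have := avg_osc_v ak o2; rewrite tN -/rho => rhoK.
  have [Xr] := avg_osc_p ak o2; rewrite tN -/rr => rK.
  have := avg_osc_t ak o2; rewrite -/tau => tauK.
  have vE : vd k.+1 - vb k = h^-1 *: (F k.+1 - F k).
    rewrite (avg_v ak) tN /vd discrete_vS -scalerBr; congr (_ *: _).
    exact: sB.
  have vE' : vd k.+1 - vb k = E k.+1 + rho.
    by rewrite /E /rho addrA subrK.
  have QE : th k.+1 - tb k = G k.+1 + tau by rewrite /G /tau addrA subrK.
  have eq2 : h^-1 *: L (E k.+1 - E k) + (B (vd k.+1) - B (vb k))
      + (A2 (ph k.+1) - A2 (pb k)) + (Phi (ph k.+1) + cL (ph k.+1) - Pb k)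
    = th k.+1 - tb k.
    rewrite -e2 -(avg_eq_v ak) tN !sD -scalerBr LB.
    by congr (_ *: L _ + _ + _ + _); rewrite /E sB.
  (* The scheme uses the mean of [f] over the step, so the source cancels exactly and the right-hand
     side is 0. *)
  have eq1 : h^-1 *: (G k.+1 - G k) + (vd k.+1 - vb k)
      + (A1 (th k.+1) - A1 (tb k)) = 0.
    have := avg_eq_theta ak; rewrite tN -[RHS]e1 => /eqP.
    rewrite eq_sym -subr_eq0 !sD -scalerBr => /eqP <-.
    by congr (_ *: _ + _ + _); rewrite /G sB.
  have XFk := XF _ (ltnW kN); have XFk' := XF _ kN.
  have hD : F k.+1 - F k = h *: (vd k.+1 - vb k).
    by rewrite vE scalerA mulfV ?scale1r// gt_eqF.
  (* [F k.+1 - F k] is known to lie in V_2 only, whereas [ph k.+1 - pb k] is in D(A_2); there [A2s]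
     extends [A2], and symmetry exchanges the two arguments. *)
  have hA2 : ip (A2 (ph k.+1) - A2 (pb k)) (F k.+1 - F k)
      = a2 (F k.+1 - F k) (F k.+1 + rr).
    have Xd := lin_subspaceB X2L XFk' XFk.
    have -> : F k.+1 + rr = ph k.+1 - pb k by rewrite /F /rr addrA subrK.
    have Db := avg_domA2 ak.
    have Dd := lin_subspaceB A2l.1 D2 Db.
    by rewrite -(linopB A2l)// (psdC a2P)// ?A2a2//; exact: A2X2.
  have st := scheme_step ipP a2P LP h0 XFk XFk' Xr vE vE' QE eq2 eq1 hA2.
  rewrite -(linopB Bl DB (avg_domB ak)) -(linopB A1l D1 (avg_domA1 ak)) in st.
  rewrite (psd0l ipP (I : setT (th k.+1 - tb k))) in st.
  have n1 : `|F k.+1| ^+ 2 - `|F k| ^+ 2 <= 2 * h * ip (vd k.+1 - vb k) (F k.+1).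
    have := psd_euler ipP (x := F k) (x' := F k.+1) (y := 0) I I I.
    by rewrite (psd0l ipP)// addr0 subr0 -!ipE hD (psdZl ipP)// mulrA.
  have n2 := le_trans (ler_norm _) (ip_norm_le ipP ipE (vd k.+1 - vb k) (F k.+1)).
  have n3 : - ip (Phi (ph k.+1) + cL (ph k.+1) - Pb k) (vd k.+1 - vb k)
      <= K1 * (nrm X2 (F k.+1) + K * h) * `|vd k.+1 - vb k|.
    apply: le_trans (ler_norm _) _; rewrite normrN.
    apply: le_trans (ip_norm_le ipP ipE _ _) _; rewrite ler_wpM2r//.
    have := avg_Phi ak X1' r0 (phr _ kN); rewrite tN; exact.
  have n4 : `|vd k.+1 - vb k| <= `|E k.+1| + K * h.
    by rewrite vE'; apply: le_trans (ler_normD _ _) _; rewrite lerD2l.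
  have n5 : ip (L rho) rho <= CL * (K * h) ^+ 2.
    apply: le_trans (LCL _) _; rewrite ler_wpM2l// ler_pXn2r ?nnegrE//.
    by rewrite mulr_ge0// ltW.
  have n6 : a2 rr rr <= C2 * (K * h) ^+ 2.
    apply: le_trans (a2C Xr) _; rewrite ler_wpM2l// ler_pXn2r ?nnegrE ?nrm_ge0//.
    by rewrite mulr_ge0// ltW.
  have n7 : `|tau| ^+ 2 <= qn k.
    by rewrite /qn ler_pXn2r ?nnegrE//; exact: le_trans tauK.
  rewrite /S /b /d kN /KR /Kb.
  apply: (@error_arith R h cl om CL C2 K K1 `|E k.+1| `|F k.+1| (nrm X2 (F k.+1))
    `|vd k.+1 - vb k| _ _ _ _ _ _ _ _ _ _ _ _ _ _ _
    h0 h1 cl0 om0 CL0 C20 K0 K10 _ _ _ _ _ _ n5 n6 n7 n1 n2 n3 n4) => //.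
  - exact: nrm_ge0.
  - exact: (psd_ge0 LP).
  - exact: (psd_ge0 a2P).
  - exact: a2om.
  by rewrite !ipE.
have F00 : E 0%N = 0 /\ F 0%N = 0 /\ G 0%N = 0.
  have [sth sph _] := sol.
  by rewrite /E /F /G /vd /= sth sph mul0r wv0 wp0 wt0 !subrr.
have S00 : S 0%N = 0.
  have [E0 [F0 G0]] := F00; have [X0 _] := X2L.
  by rewrite /S E0 F0 G0 (psd0l LP)// (psd0l a2P)// normr0 expr0n /= !addr0.
move=> n nN.
have KRh0 : 0 <= KR * h by rewrite mulr_ge0// ltW.
have Gr := discrete_gronwall KRh0 Kh _ d0 b0 step nN.
rewrite S00 add0r lexx in Gr.
have nT : h * n%:R <= T.
  by apply: le_trans hN; rewrite ler_wpM2l ?ler_nat// ltW.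
have bS : \sum_(k < n) b k <= h * (T * Kb + `|Qt|).
  rewrite big_split /= sumr_const card_ord [leRHS]mulrDr; apply: lerD.
    have -> : (h ^+ 2 * Kb) *+ n = h * (h * n%:R * Kb).
      by rewrite -(mulr_natr _ n); ring.
    by rewrite ler_wpM2l ?(ltW h0)// ler_wpM2r.
  apply: (@le_trans _ _ (h * Qt)); last by rewrite ler_wpM2l ?(ltW h0)// ler_norm.
  apply: le_trans gtQ; rewrite (big_ord_widen N (fun k => qn k) nN).
  rewrite [leRHS](bigID (fun k : 'I_N => (k < n)%N)) /= lerDl.
  by apply: sumr_ge0 => k _; rewrite sqr_ge0.
have {Gr}Gr := Gr isT.
apply: (@le_trans _ _ (S n + \sum_(k < n) d k)).
  rewrite lerD2l; apply: ler_sum => k _.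
  by rewrite /d (leq_trans (ltn_ord k) nN).
apply: le_trans Gr _.
have -> : expR (2 * KR * T) * (T * Kb + `|Qt|) * h
  = expR (2 * KR * T) * (h * (T * Kb + `|Qt|)) by ring.
apply: ler_pM; rewrite ?expR_ge0//.
  by apply: sumr_ge0 => k _.
by rewrite ler_expR -!mulrA !ler_wpM2l.
Qed.

End ErrorBound.

Section NodeErrors.
Variables (C0 Cp p q K Qf : R) (wt wp wv : R -> H) (gt gA gB : R -> R).
Hypothesis C00 : 0 <= C0.
Hypothesis Cp0 : 0 <= Cp.
Hypothesis K0 : 0 <= K.
Hypothesis wt0 : wt 0 = th0.
Hypothesis wp0 : wp 0 = ph0.
Hypothesis wv0 : wv 0 = v0.
Hypothesis gt2 : square_integrable T gt.
Hypothesis Xwp : forall t, 0 <= t -> t <= T -> carrier X2 (wp t).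
Hypothesis Qf0 : 0 <= Qf.
Hypothesis fQ : forall h N, 0 < h -> N%:R * h <= T ->
  \sum_(k < N) (h * `|f_ f h k.+1| ^+ 2) <= Qf.
Hypothesis avgE : forall s t, 0 <= s -> s < t -> t <= T ->
  exists vb pb tb Pb, averaged_solution X2 L A1 B A2 Phi cL f C0 Ccl Cp p q
    wt wp wv K gt gA gB s t vb pb tb Pb.

(** The order of the constants matters: the energy bound gives [r], which fixes the Gronwall
    constant of the error estimate, and only then is the threshold for [h] chosen. *)
Lemma node_error : exists h00 M : R, [/\ 0 < h00, 0 <= M &
  forall (h : R) N th ph, 0 < h -> h < h00 -> N%:R * h = T ->
    discrete_solution L A1 B A2 Phi cL th0 ph0 v0 f h N th ph ->
    exists vb pb tb Pb : nat -> H,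
    (forall n, (n < N)%N -> averaged_solution X2 L A1 B A2 Phi cL f C0 Ccl Cp p q
       wt wp wv K gt gA gB (n%:R * h) (n.+1%:R * h) (vb n) (pb n) (tb n) (Pb n)) /\
    let vd := discrete_v v0 h ph in
    let E n := vd n - wv (n%:R * h) in
    let F n := ph n - wp (n%:R * h) in
    let G n := th n - wt (n%:R * h) in
    forall n, (n <= N)%N ->
      (ip (L (E n)) (E n) + a2 (F n) (F n) + `|F n| ^+ 2 + `|G n| ^+ 2)
      + \sum_(k < n) (2 * h * ip (B (vd k.+1 - vb k)) (vd k.+1 - vb k)
                      + 2 * h * ip (A1 (th k.+1 - tb k)) (th k.+1 - tb k)) <= M * h].
Proof.
have [r r0 EB] := energy_bound Qf0.
have [M M0 EB2] := error_bound p q gt gA gB C00 Cp0 K0 r0 wt0 wp0 wv0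
  (\int[mu]_(t in `]0, T[) (gt t ^+ 2)).
set KR := 4 / cl + 1 + _ in EB2.
have KE0 : 0 <= KE by rewrite /KE !addr_ge0// mulr_ge0 ?sqr_ge0 ?invr_ge0 ?(ltW cl0).
have KR0 : 0 <= KR.
  rewrite /KR; move: (_ + _ * C0) => K1; move: (K1 ^+ 2) (sqr_ge0 K1) => w w0.
  by rewrite !addr_ge0// ?divr_ge0 ?mulr_ge0 ?(ltW cl0) ?(ltW om0).
have small (c h : R) : 0 <= c -> 0 < h -> h < (2 * (c + 1))^-1 -> c * h <= 2^-1.
  move=> c0 h0 hc; have c1 : 0 < c + 1 by lra.
  rewrite -[_^-1]mul1r ltr_pdivlMr ?mulr_gt0// in hc; lra.
(* Both Gronwall arguments need their constant times [h] to be at most 1/2; the added 1 keeps the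
   denominators positive. *)
exists (Num.min 1 (Num.min (2 * (KE + 1))^-1 (2 * (KR + 1))^-1)), M; split => //.
  by rewrite !lt_min ltr01 /= !invr_gt0 !mulr_gt0//; lra.
move=> h N th ph h0; rewrite !lt_min => /andP[h1 /andP[hE hR]] NT sol.
have NTle : N%:R * h <= T by rewrite NT.
have NT' : h * N%:R <= T by rewrite mulrC NT.
have kT k : (k <= N)%N -> k%:R * h <= T by move=> kN; rewrite -NT ler_pM2r// ler_nat.
have k0 k : 0 <= k%:R * h by rewrite mulr_ge0// ltW.
have kk k : k%:R * h < k.+1%:R * h by rewrite ltr_pM2r// ltr_nat.
have phr := EB h N th ph h0 (small _ _ KE0 h0 hE) NT' sol (fQ h0 NTle).
have /choice[Z ZP] : forall n, exists z : H * H * H * H, (n < N)%N ->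
    averaged_solution X2 L A1 B A2 Phi cL f C0 Ccl Cp p q wt wp wv K gt gA gB
      (n%:R * h) (n.+1%:R * h) z.1.1.1 z.1.1.2 z.1.2 z.2.
  move=> n; have [nN|nN] := boolP (n < N)%N; last by exists (0, 0, 0, 0).
  have [vb [pb [tb [Pb av]]]] := avgE (k0 n) (kk n) (kT _ nN).
  by exists (vb, pb, tb, Pb).
exists (fun n => (Z n).1.1.1), (fun n => (Z n).1.1.2), (fun n => (Z n).1.2),
  (fun n => (Z n).2); split => //.
move=> vd E F G n nN.
apply: (EB2 h N th ph _ _ _ _ h0 (ltW h1) (small _ _ KR0 h0 hR) NT' sol ZP phr) => //.
  by move=> k kN; apply: Xwp; rewrite ?k0 ?kT.
exact: (sum_sqr_Rintegral_cells h0 NTle gt2).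
Qed.


(** * Rates of the five error terms *)

Section Rates.
Variables (X1 : nspace R H) (sig M h : R) (N : nat) (Lh Bh : operator H).
Variables (theta phi v : R -> H) (th ph vb pb tb Pb : nat -> H).
Hypothesis sig0 : 0 < sig.
Hypothesis A1sig : forall x, dom A1 x ->
  sig * nrm X1 x ^+ 2 <= ip (A1 x) x + `|x| ^+ 2.
Hypothesis hLh : nonneg_sqrt ip (Operator setT L) Lh.
Hypothesis hBh : nonneg_sqrt ip B Bh.
Hypothesis gA2 : square_integrable T gA.
Hypothesis gB2 : square_integrable T gB.
Hypothesis wE : ae_on 0 T (fun t => [/\ wt t = theta t, wp t = phi t, wv t = v t,
  dom B (v t) & `|B (v t)| = gB t]).
Hypothesis A1E : ae_on 0 T (fun t => dom A1 (theta t) /\ `|A1 (theta t)| = gA t).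
Hypothesis osc : forall s t, 0 <= s -> s < t -> t <= T ->
  [/\ `|wv t - wv s| <= K * (t - s),
      carrier X2 (wp t - wp s), nrm X2 (wp t - wp s) <= K * (t - s)
    & `|wt t - wt s| <= \int[mu]_(y in `]s, t[) gt y].
Hypothesis h0 : 0 < h.
Hypothesis h1 : h <= 1.
Hypothesis NT : N%:R * h = T.
Hypothesis M0 : 0 <= M.
Hypothesis sol : discrete_solution L A1 B A2 Phi cL th0 ph0 v0 f h N th ph.
Hypothesis avg : forall n, (n < N)%N ->
  averaged_solution X2 L A1 B A2 Phi cL f C0 Ccl Cp p q
    wt wp wv K gt gA gB (n%:R * h) (n.+1%:R * h) (vb n) (pb n) (tb n) (Pb n).

Let vd := discrete_v v0 h ph.
Let E n := vd n - wv (n%:R * h).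
Let F n := ph n - wp (n%:R * h).
Let G n := th n - wt (n%:R * h).
Let dB k := ip (B (vd k.+1 - vb k)) (vd k.+1 - vb k).
Let dA k := ip (A1 (th k.+1 - tb k)) (th k.+1 - tb k).

Hypothesis err : forall n, (n <= N)%N ->
  (ip (L (E n)) (E n) + a2 (F n) (F n) + `|F n| ^+ 2 + `|G n| ^+ 2)
  + \sum_(k < n) (2 * h * dB k + 2 * h * dA k) <= M * h.

Let Qt := \int[mu]_(t in `]0, T[) (gt t ^+ 2).
Let QA := \int[mu]_(t in `]0, T[) (gA t ^+ 2).
Let QB := \int[mu]_(t in `]0, T[) gB t.

Let NTle : N%:R * h <= T. Proof. by rewrite NT. Qed.
Let k0 k : 0 <= k%:R * h. Proof. by rewrite mulr_ge0// ltW. Qed.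
Let kT k : (k <= N)%N -> k%:R * h <= T.
Proof. by move=> kN; rewrite -NT ler_pM2r// ler_nat. Qed.
Let kh k : k.+1%:R * h - k%:R * h = h. Proof. by rewrite -natr1; ring. Qed.

Let dB0 k : (k < N)%N -> 0 <= dB k.
Proof.
move=> kN; apply: (psd_ge0 BP); apply: lin_subspaceB Bl.1 _ _.
  exact: (discrete_v_domB sol kN).
exact: (avg_domB (avg kN)).
Qed.

Let dA0 k : (k < N)%N -> 0 <= dA k.
Proof.
move=> kN; apply: (psd_ge0 A1P); apply: lin_subspaceB A1l.1 _ _.
  by have [] := discrete_eqs sol kN.
exact: (avg_domA1 (avg kN)).
Qed.

Let XF n : (n <= N)%N -> carrier X2 (F n).
Proof.
move=> nN; apply: lin_subspaceB X2L _ _; first exact: (discrete_X2 sol nN).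
by apply: Xwp; rewrite ?k0 ?kT.
Qed.

Let errs n : (n <= N)%N -> [/\ cl * `|E n| ^+ 2 <= M * h,
  om * nrm X2 (F n) ^+ 2 <= M * h, `|G n| ^+ 2 <= M * h,
  \sum_(k < n) 2 * h * dB k <= M * h & \sum_(k < n) 2 * h * dA k <= M * h].
Proof.
move=> nN; have := err nN; rewrite big_split /=.
have sB : 0 <= \sum_(k < n) 2 * h * dB k.
  apply: sumr_ge0 => k _; apply: mulr_ge0; first by rewrite mulr_ge0// ltW.
  exact: (dB0 (leq_trans (ltn_ord k) nN)).
have sA : 0 <= \sum_(k < n) 2 * h * dA k.
  apply: sumr_ge0 => k _; apply: mulr_ge0; first by rewrite mulr_ge0// ltW.
  exact: (dA0 (leq_trans (ltn_ord k) nN)).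
have := Lcl (E n); have := a2om (XF nN); have := psd_ge0 a2P (XF nN).
have : 0 <= cl * `|E n| ^+ 2 by rewrite mulr_ge0 ?sqr_ge0// ltW.
have := sqr_ge0 `|F n|; have := sqr_ge0 `|G n|.
move: (\sum_(k < n) _) sB (\sum_(k < n) _) sA => sB sB0 sA sA0.
by move=> *; split; lra.
Qed.

(** The square root of [L] is bounded by that of [CL], since its squared norm is the form of [L].
    The oscillation [K * h] of v inside a step is absorbed in the rate because [h <= Num.sqrt h] for
    [h <= 1]. *)
Lemma hat_v_rate :
  (LpN whole +oo 0 T (fun t => Lh (hat h vd t - v t)%R)
   <= (Num.sqrt CL * (Num.sqrt (M / cl) + K) * Num.sqrt h)%:E)%E.
Proof.
have sh := le_sqrt1 (ltW h0) h1.
have c0 : 0 <= Num.sqrt (M / cl) + K by rewrite addr_ge0// sqrtr_ge0.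
apply: LpNoo_le; first by rewrite !mulr_ge0// sqrtr_ge0.
rewrite -NT; apply: ae_cell => // k kN.
have hat_le := hat_error (X := whole) (x := vd) (w := wv) (N := N)
  (c := Num.sqrt (M / cl) * Num.sqrt h) (c' := K * h) normed_subspace_whole h0.
apply: ae_onS (ae_on_sub (k0 k) (kT kN) wE) => t kt [_ _ <- _ _].
have [_ /=] : carrier whole (hat h vd t - wv t) /\
    nrm whole (hat h vd t - wv t) <= Num.sqrt (M / cl) * Num.sqrt h + K * h.
  apply: hat_le kN kt => [n nN|n s s' nN ns ss sn].
    split=> //=; apply: sqrt_rate; rewrite ?(ltW h0) //.
    by have [] := errs nN.
  split=> //=; have [wo _ _ _] := osc (le_trans (k0 n) ns) ss (le_trans sn (kT nN)).
  apply: le_trans wo _; rewrite ler_wpM2l// -(kh n); lra.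
set w := _ - _; move=> wle.
rewrite ger0_norm// -(ger0_norm (normr_ge0 (Lh w))) -sqrtr_sqr -mulrA.
rewrite (nonneg_sqrt_sqr ipE hLh (I : dom (Operator setT L) w)) /=.
apply: le_trans (ler_wsqrtr (LCL w)) _; rewrite sqrtrM// sqrtr_sqr normr_id.
rewrite ler_wpM2l ?sqrtr_ge0// mulrDl; apply: le_trans wle _.
by rewrite lerD2l ler_wpM2l.
Qed.

Lemma hat_phi_rate :
  (LpN X2 +oo 0 T (fun t => hat h ph t - phi t)%R
   <= ((Num.sqrt (M / om) + K) * Num.sqrt h)%:E)%E.
Proof.
have sh := le_sqrt1 (ltW h0) h1.
apply: LpNoo_le; first by rewrite mulr_ge0 ?addr_ge0// sqrtr_ge0.
rewrite -NT; apply: ae_cell => // k kN.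
have hat_le := hat_error (X := X2) (x := ph) (w := wp) (N := N)
  (c := Num.sqrt (M / om) * Num.sqrt h) (c' := K * h) X2P h0.
apply: ae_onS (ae_on_sub (k0 k) (kT kN) wE) => t kt [_ <- _ _ _].
have [Xw wle] : carrier X2 (hat h ph t - wp t) /\
    nrm X2 (hat h ph t - wp t) <= Num.sqrt (M / om) * Num.sqrt h + K * h.
  apply: hat_le kN kt => [n nN|n s s' nN ns ss sn].
    split; first exact: XF.
    apply: sqrt_rate; rewrite ?(ltW h0) ?(nrm_ge0 X2P)//; last by have [] := errs nN.
    exact: XF.
  have [_ X wo _] := osc (le_trans (k0 n) ns) ss (le_trans sn (kT nN)).
  by split=> //; apply: le_trans wo _; rewrite ler_wpM2l// -(kh n); lra.
rewrite ger0_norm ?(nrm_ge0 X2P)// mulrDl; apply: le_trans wle _.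
by rewrite lerD2l ler_wpM2l.
Qed.

Let m k := \int[mu]_(y in `]k%:R * h, k.+1%:R * h[) gt y.

Let m0 k : 0 <= m k.
Proof. by apply: Rintegral_ge0 => t _; have [g0 _ _] := gt2. Qed.

Let sum_m : \sum_(k < N) m k ^+ 2 <= h * Qt.
Proof. exact: (sum_sqr_Rintegral_cells h0 NTle gt2). Qed.

Let Qt0 : 0 <= Qt.
Proof. by apply: Rintegral_ge0 => t _; rewrite sqr_ge0. Qed.

Let QA0 : 0 <= QA.
Proof. by apply: Rintegral_ge0 => t _; rewrite sqr_ge0. Qed.

Let QB0 : 0 <= QB.
Proof. by apply: Rintegral_ge0 => t _; have [g0 _ _] := gB2. Qed.

(** Theta is not Lipschitz in time; its oscillation in step n is at most [m n], and a single
    [m n ^+ 2] is already bounded by the whole sum, hence by [h * Qt]. *)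
Lemma hat_theta_rate :
  (LpN whole +oo 0 T (fun t => hat h th t - theta t)%R
   <= ((Num.sqrt M + Num.sqrt Qt) * Num.sqrt h)%:E)%E.
Proof.
apply: LpNoo_le; first by rewrite mulr_ge0 ?addr_ge0// sqrtr_ge0.
rewrite -NT; apply: ae_cell => // k kN.
have hat_le := hat_error (X := whole) (x := th) (w := wt) (N := N)
  (c := Num.sqrt M * Num.sqrt h) (c' := Num.sqrt Qt * Num.sqrt h) normed_subspace_whole h0.
apply: ae_onS (ae_on_sub (k0 k) (kT kN) wE) => t kt [<- _ _ _ _].
rewrite /= ger0_norm// mulrDl.
apply: (proj2 (hat_le _ _ _ _ kN kt)) => [n nN|n s s' nN ns ss sn].
  split=> //=; rewrite -[M]divr1; apply: sqrt_rate; rewrite ?(ltW h0)// mul1r.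
  by have [] := errs nN.
split=> //=; have [_ _ _ wo] := osc (le_trans (k0 n) ns) ss (le_trans sn (kT nN)).
apply: le_trans wo _.
have [g0 ig ig2] := gt2.
apply: (@le_trans _ _ (m n)).
  apply: Rintegral_oo_subset => //.
  by apply: integrable_ooS ig; rewrite ?k0 ?kT.
rewrite -[Qt]divr1; apply: sqrt_rate; rewrite ?(ltW h0) ?m0 ?Qt0// mul1r [leRHS]mulrC.
apply: le_trans sum_m; rewrite (bigD1 (Ordinal nN)) //= lerDl.
by apply: sumr_ge0 => j _; rewrite sqr_ge0.
Qed.

(** The squared norm collects the dissipation, at most [M * h], and the term [4 * (K * h) * QB], in
    which v oscillates by at most [K * h] and the norm of B v is integrated. *)
Lemma bar_v_rate :
  (LpN whole 2%:E 0 T (fun t => Bh (bar h vd t - v t)%R)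
   <= (Num.sqrt (M + 4 * K * QB) * Num.sqrt h)%:E)%E.
Proof.
rewrite -sqrtrM; last by rewrite addr_ge0// !mulr_ge0.
apply: LpN2_le; first by rewrite mulr_ge0 ?addr_ge0 ?mulr_ge0// ltW.
rewrite -{1}NT.
have := @integral_operator_error R T h N
  (fun t => `|Bh (bar h vd t - v t)| ^+ 2) gB dB (fun k => `|B (vb k)|) (fun=> K * h)
  (fun=> 0) h0 NTle gB2.
move=> /(_ _ _ _ _)/le_trans; apply.
- by move=> k kN; split; rewrite ?dB0// mulr_ge0// ltW.
- by move=> t; rewrite sqr_ge0.
- move=> k kN; have := avg_Bv (avg kN); rewrite kh.
  by rewrite -(ler_pM2l h0) mulrA mulfV ?mul1r// gt_eqF.
- move=> k kN; apply: ae_onS (ae_on_sub (k0 k) (kT kN) wE) => t kt [_ _ wvE Dv vgB].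
  rewrite /bar (truncn_cell h0 kt) addr0.
  have Dk := discrete_v_domB sol kN; have Db := avg_domB (avg kN).
  rewrite (nonneg_sqrt_sqr ipE hBh); last exact: lin_subspaceB Bl.1 _ _.
  apply: le_trans (psd_operator_split ipP ipE Bl BP Dk Db Dv) _.
  rewrite lerD2l vgB ler_wpM2l//.
    by rewrite mulr_ge0// addr_ge0//; have [g0 _ _] := gB2.
  rewrite distrC -wvE -[X in K * X](kh k); apply: (avg_osc_v (avg kN)).
  by have /andP[/ltW-> /ltW->] := kt.
rewrite lee_fin.
have -> : (M + 4 * K * QB) * h = M * h + 4 * (K * h) * QB by ring.
rewrite (eq_bigr (fun k : 'I_N => 2 * h * dB k + 4 * (K * h)
  * \int[mu]_(t in `]k%:R * h, k.+1%:R * h[) gB t)); last first.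
  by move=> k _; rewrite mulr0 addr0.
rewrite big_split /=; apply: lerD; first by have [] := errs (leqnn N).
rewrite -mulr_sumr ler_wpM2l//; first by rewrite !mulr_ge0// ltW.
by have [g0 ig _] := gB2; exact: sum_Rintegral_cells.
Qed.

(** The oscillation [m k] is not O(h), so [4 * m k * I k] is split into
    [2 * I k ^+ 2 + 2 * m k ^+ 2], and both squares sum to O(h). Coercivity of A_1 holds only modulo
    the norm of [H], which adds [2 * M * h + 8 * m k ^+ 2] on each cell; this explains [10 * Qt] and
    [2 * M * T]. *)
Lemma bar_theta_rate :
  (LpN X1 2%:E 0 T (fun t => bar h th t - theta t)%R
   <= (Num.sqrt ((M + 2 * QA + 10 * Qt + 2 * M * T) / sig) * Num.sqrt h)%:E)%E.
Proof.
set C := M + _ + _ + _.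
have C_ge0 : 0 <= C by rewrite /C !addr_ge0// !mulr_ge0// ltW.
rewrite -sqrtrM; last by rewrite divr_ge0// ltW.
apply: LpN2_le; first by rewrite mulr_ge0 ?divr_ge0// ltW.
rewrite -{1}NT.
pose I k := \int[mu]_(t in `]k%:R * h, k.+1%:R * h[) gA t.
have si0 : 0 <= sig^-1 by rewrite invr_ge0 ltW.
have := @integral_operator_error R T h N
  (fun t => nrm X1 (bar h th t - theta t) ^+ 2) gA (fun k => dA k / sig)
  (fun k => `|A1 (tb k)|) (fun k => m k / sig)
  (fun k => (2 * M * h + 8 * m k ^+ 2) / sig) h0 NTle gA2.
move=> /(_ _ _ _ _)/le_trans; apply.
- move=> k kN; split; rewrite ?(mulr_ge0 _ si0) ?dA0 ?m0//.
  by apply: addr_ge0; apply: mulr_ge0; rewrite ?sqr_ge0 ?(ltW h0)// mulr_ge0.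
- by move=> t; rewrite sqr_ge0.
- move=> k kN; have := avg_A1t (avg kN); rewrite kh.
  by rewrite -(ler_pM2l h0) mulrA mulfV ?mul1r// gt_eqF.
- move=> k kN; apply: ae_onS2 (ae_on_sub (k0 k) (kT kN) wE)
    (ae_on_sub (k0 k) (kT kN) A1E) => t kt [wtE _ _ _ _] [Dt tgA].
  rewrite /bar (truncn_cell h0 kt).
  have [Dk _ _] := discrete_eqs sol kN; have Db := avg_domA1 (avg kN).
  have -> : 2 * (dA k / sig) + 2 * (`|A1 (tb k)| + gA t) * (m k / sig)
      + (2 * M * h + 8 * m k ^+ 2) / sig
    = (2 * dA k + 2 * (`|A1 (tb k)| + gA t) * m k + (2 * M * h + 8 * m k ^+ 2)) / sig.
    by ring.
  rewrite ler_pdivlMr// mulrC.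
  apply: le_trans (A1sig (lin_subspaceB A1l.1 Dk Dt)) _.
  have tbm : `|tb k - theta t| <= m k.
    rewrite distrC -wtE; apply: (avg_osc_t (avg kN)).
    by have /andP[/ltW-> /ltW->] := kt.
  apply: lerD.
    apply: le_trans (psd_operator_split ipP ipE A1l A1P Dk Db Dt) _.
    rewrite lerD2l tgA ler_wpM2l// mulr_ge0// addr_ge0//.
    by have [g0 _ _] := gA2.
  have kk : k%:R * h <= k.+1%:R * h by rewrite ler_pM2r// ler_nat.
  have tm : `|wt (k.+1%:R * h) - tb k| <= m k.
    by apply: (avg_osc_t (avg kN)); rewrite kk lexx.
  have le : `|th k.+1 - theta t| <= `|G k.+1| + 2 * m k.
    have -> : th k.+1 - theta t
        = G k.+1 + (wt (k.+1%:R * h) - tb k) + (tb k - theta t).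
      by rewrite /G !subrKA.
    apply: le_trans (ler_normD _ _) _.
    have := ler_normD (G k.+1) (wt (k.+1%:R * h) - tb k); lra.
  have [_ _ GM _ _] := errs kN.
  apply: (@le_trans _ _ ((`|G k.+1| + 2 * m k) ^+ 2)).
    by rewrite ler_pXn2r ?nnegrE// addr_ge0// mulr_ge0.
  have := sqr_ge0 (`|G k.+1| - 2 * m k).
  by rewrite sqrrB sqrrD; lra.
rewrite lee_fin [leRHS]mulrAC.
have sA : \sum_(k < N) I k ^+ 2 <= h * QA by exact: (sum_sqr_Rintegral_cells h0 NTle gA2).
apply: (@le_trans _ _ ((\sum_(k < N) (2 * h * dA k + (2 * I k ^+ 2 + 10 * m k ^+ 2)
    + 2 * M * h * h)) / sig)).
  rewrite mulr_suml; apply: ler_sum => k _ /=; rewrite -/(I k).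
  have -> : 2 * h * (dA k / sig) + 4 * (m k / sig) * I k
      + h * ((2 * M * h + 8 * m k ^+ 2) / sig)
    = (2 * h * dA k + 4 * m k * I k + h * (2 * M * h + 8 * m k ^+ 2)) / sig by ring.
  rewrite ler_wpM2r//.
  have := sqr_ge0 (I k - m k); rewrite sqrrB => s1.
  have := ler_wpM2r (sqr_ge0 (m k)) h1; lra.
rewrite ler_wpM2r// !big_split /= sumr_const card_ord -!mulr_sumr.
have [_ _ _ _ sdA] := errs (leqnn N); rewrite -mulr_sumr in sdA.
have -> : (2 * M * h * h) *+ N = 2 * M * T * h by rewrite -NT -mulr_natr; ring.
have := sum_m; rewrite /C; lra.
Qed.

End Rates.

Lemma convergence_rate (X1 : nspace R H) (sig : R) (Lh Bh : operator H)
    (theta phi v : R -> H) :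
  0 < sig ->
  (forall x, dom A1 x -> sig * nrm X1 x ^+ 2 <= ip (A1 x) x + `|x| ^+ 2) ->
  nonneg_sqrt ip (Operator setT L) Lh -> nonneg_sqrt ip B Bh ->
  square_integrable T gA -> square_integrable T gB ->
  ae_on 0 T (fun t => [/\ wt t = theta t, wp t = phi t, wv t = v t,
    dom B (v t) & `|B (v t)| = gB t]) ->
  ae_on 0 T (fun t => dom A1 (theta t) /\ `|A1 (theta t)| = gA t) ->
  (forall s t, 0 <= s -> s < t -> t <= T ->
    [/\ `|wv t - wv s| <= K * (t - s),
        carrier X2 (wp t - wp s), nrm X2 (wp t - wp s) <= K * (t - s)
      & `|wt t - wt s| <= \int[mu]_(y in `]s, t[) gt y]) ->
  exists h00 M : R, [/\ 0 < h00, 0 < M &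
  forall (h : R) N th ph, 0 < h -> h < h00 -> N%:R * h = T ->
    discrete_solution L A1 B A2 Phi cL th0 ph0 v0 f h N th ph ->
    let vd := discrete_v v0 h ph in
    (LpN whole +oo 0 T (fun t => Lh (hat h vd t - v t)%R)
     + LpN whole 2%:E 0 T (fun t => Bh (bar h vd t - v t)%R)
     + LpN X2 +oo 0 T (fun t => hat h ph t - phi t)%R
     + LpN whole +oo 0 T (fun t => hat h th t - theta t)%R
     + LpN X1 2%:E 0 T (fun t => bar h th t - theta t)%R
     <= (M * Num.sqrt h)%:E)%E].
Proof.
move=> sig0 A1sig hLh hBh gA2 gB2 wE A1E osc.
have [h00 [M [h000 M0 NE]]] := node_error.
pose M1 := Num.sqrt CL * (Num.sqrt (M / cl) + K).
pose M2 := Num.sqrt (M + 4 * K * \int[mu]_(t in `]0, T[) gB t).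
pose M3 := Num.sqrt (M / om) + K.
pose M4 := Num.sqrt M + Num.sqrt (\int[mu]_(t in `]0, T[) (gt t ^+ 2)).
pose M5 := Num.sqrt ((M + 2 * (\int[mu]_(t in `]0, T[) (gA t ^+ 2))
  + 10 * (\int[mu]_(t in `]0, T[) (gt t ^+ 2)) + 2 * M * T) / sig).
have [M10 M20 M30 M40 M50] : [/\ 0 <= M1, 0 <= M2, 0 <= M3, 0 <= M4 & 0 <= M5].
  by split; rewrite /M1 /M2 /M3 /M4 /M5 ?mulr_ge0 ?addr_ge0 ?sqrtr_ge0.
(* The bound by 1 gives [h <= 1], and the summand 1 makes the constant strictly positive. *)
exists (Num.min h00 1), (1 + (M1 + M2 + M3 + M4 + M5)).
split; first by rewrite lt_min h000 ltr01.
  by rewrite ltr_wpDr// !addr_ge0.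
move=> h N th ph h0; rewrite lt_min => /andP[hh h1] NT sol; cbv zeta.
have [vb [pb [tb [Pb [avg err]]]]] := NE h N th ph h0 hh NT sol.
apply: (@le_trans _ _ (M1 * Num.sqrt h + M2 * Num.sqrt h + M3 * Num.sqrt h
    + M4 * Num.sqrt h + M5 * Num.sqrt h)%:E); last first.
  by rewrite lee_fin -!mulrDl ler_wpM2r ?sqrtr_ge0// lerDr.
rewrite !EFinD; apply: leeD; [apply: leeD; [apply: leeD; [apply: leeD|]|]|].
- exact: (hat_v_rate hLh wE osc h0 (ltW h1) NT M0 sol avg err).
- exact: (bar_v_rate hBh gB2 wE h0 NT M0 sol avg err).
- exact: (hat_phi_rate wE osc h0 (ltW h1) NT M0 sol avg err).
- exact: (hat_theta_rate wE osc h0 NT M0 sol avg err).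
- exact: (bar_theta_rate sig0 A1sig gA2 wE A1E h0 (ltW h1) NT M0 sol avg err).
Qed.

End NodeErrors.

End Scheme.

(** * From the standing assumptions to the rate *)

Theorem theorem1p3 (R : realType) (T : R) (hT : 0 < T)
    (H : completeNormedModType R) (ip : H -> H -> R)
    (V : set H) (ipV : H -> H -> R) (V1 V2 : set H)
    (L : H -> H) (A1 B A2 Phi : operator H) (A1s Bs A2s : H -> H -> R)
    (cL : H -> H) (th0 ph0 v0 : H) (f : R -> H)
    (X := hilbert_space V ipV) (X1 := NSpace V1 (nrm X))
    (X2 := NSpace V2 (nrm X))
    (C1 : gelfand_triple ip V ipV)
    (C2 : closed_dense_reflexive_subspace X V1 /\
          closed_dense_reflexive_subspace X V2)
    (C3 : bounded_symmetric_coercive ip L)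
    (C4 : A1_assumption ip X1 A1 A1s)
    (C5 : A1_regularity ip X1 A1 A1s)
    (C6 : B_A2_assumption ip X2 B A2)
    (C7 : Phi_growth_assumption ip X Phi)
    (C8 : Phi_potential_assumption ip X Phi)
    (C9 : yosida_assumption ip Phi B A2)
    (C10 : B_extension_assumption ip X2 B Bs)
    (C11 : A2_extension_assumption ip X2 A2 A2s)
    (C12 : phi_regularity ip X2 L B A2 Bs A2s Phi cL)
    (C13 : lipschitz_assumption cL)
    (C14 : [/\ V1 th0, (dom B `&` dom A2) ph0, (dom B `&` V2) v0
             & Lp whole 2%:E 0 T f])
    (hf : exists f', W1p whole 1%E T f f')
    (Lh Bh : operator H)
    (hLh : nonneg_sqrt ip (Operator setT L) Lh) (hBh : nonneg_sqrt ip B Bh)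
    (h0 : R) (h0_01 : 0 < h0 < 1)
    (hh0 : forall N : nat, 0 < T / N%:R < h0 ->
       discrete_uniquely_solvable L A1 B A2 Phi cL th0 ph0 v0 f (T / N%:R) N)
    (theta phi v : R -> H)
    (hsol : solution_P X1 X2 L A1 B A2 Phi cL T th0 ph0 v0 f theta phi)
    (hv : weak_derivative whole T phi v) :
  exists h00 M : R, [/\ 0 < h00 < h0, 0 < M &
    forall N : nat, let h := T / N%:R in 0 < h < h00 ->
    forall th ph : nat -> H,
      discrete_solution L A1 B A2 Phi cL th0 ph0 v0 f h N th ph ->
      let vd := discrete_v v0 h ph in
      (LpN whole +oo 0 T (fun t => Lh (hat h vd t - v t)%R)
       + LpN whole 2%:E 0 T (fun t => Bh (bar h vd t - v t)%R)
       + LpN X2 +oo 0 T (fun t => hat h ph t - phi t)%R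
       + LpN whole +oo 0 T (fun t => hat h th t - theta t)%R
       + LpN X1 2%:E 0 T (fun t => bar h th t - theta t)%R
       <= (M * Num.sqrt h)%:E)%E].
Proof.
have [[ip_ ipE] [Vlin ipV_ Vc] _ [C0 VC0] _] := C1.
have [_ [W2lin V2V W2c _ _]] := C2.
have [LL [CL LCL] Lsym [cl cl0 Lcl]] := C3.
have [A1P A1X1 [A1b A1m A1s'] A1ext A1co] := C4.
have [[BP A2P] _ _ _ A2X2] := C6.
have [_ _ _ [p [q [Cp [p0 q0 Cp0 PhiL]]]]] := C7.
have [i [i0 Phii]] := C8.
have [A2b A2m A2sym A2ext A2co] := C11.
have [Ccl Ccl0 cLL] := C13.
have [_ [B0 A20] [Bv0 _] fL] := C14.
have ipP : psd_form setT ip by case: ip_ => ? ? ? _; split.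
have ipVP : psd_form V ipV by case: ipV_ => ? ? ? _; split.
have X2P : normed_subspace X2 by exact: (normed_subspace_psd W2lin V2V ipVP).
have X2c : complete_in X2.
  move=> u Xu cu; have [x Vx ux] := Vc u (fun n => V2V _ (Xu n)) cu.
  by exists x => //; exact: W2c ux.
have X2C x : carrier X2 x -> `|x| <= `|C0| * nrm X2 x.
  move=> Xx; apply: le_trans (VC0 x (V2V _ Xx)) _.
  by rewrite ler_wpM2r ?sqrtr_ge0// ler_norm.
have V2ph0 := A2X2 _ A20.
have cLL' x y : `|cL x - cL y| <= Ccl * `|x - y| by exact: (cLL (x, y)).
have PhiL2 x y : carrier X2 x -> carrier X2 y ->
    `|Phi x - Phi y| <= Cp * (1 + nrm X2 x `^ p + nrm X2 y `^ q) * nrm X2 (x - y).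
  by move=> /V2V Vx /V2V Vy; exact: PhiL.
have [wt [wp [wv [K [gt [gA [gB [[wt0 wp0 wv0 K0] [gt2 gA2 gB2] [wE A1E] osc avg]]]]]]]] :=
  exact_solution ipP ipE hT X2P X2c X2C LL LCL Lsym A1P BP A2P (ltW Cp0) (ltW p0) (ltW q0)
    PhiL2 (ltW Ccl0) cLL' fL hsol V2ph0 (normr_ge0 _) hv.
have LP : psd_form setT (fun x y => ip (L x) y).
  split=> //.
  - by move=> x y _ _; rewrite Lsym (psdC ipP).
  - by move=> c x y z _ _ _; rewrite LL (psdDl ipP)// (psdZl ipP).
  - by move=> x _; apply: le_trans (Lcl x); rewrite mulr_ge0 ?sqr_ge0// ltW.
have LCL' x : ip (L x) x <= `|CL| * `|x| ^+ 2.
  apply: le_trans (ler_norm _) _; apply: le_trans (ip_norm_le ipP ipE _ _) _.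
  rewrite expr2 mulrA ler_wpM2r//; apply: le_trans (LCL x) _.
  by rewrite ler_wpM2r// ler_norm.
have [A1l A1mm A1sa] := A1P; have [Bl Bmm Bsa] := BP; have [A2l _ _] := A2P.
have A1psd := operator_psd A1l ipP A1mm A1sa.
have Bpsd := operator_psd Bl ipP Bmm Bsa.
have a2P := to_dual_psd X2P A2b A2m A2sym.
have [CA CA0 a2C] := to_dual_bound X2P A2b.
have a2C' x : carrier X2 x -> A2s x x <= CA * nrm X2 x ^+ 2.
  by move=> Xx; apply: le_trans (ler_norm _) _; rewrite expr2 mulrA; exact: a2C.
(* The parameter 1 matches the term |F_n|^2 in the error functional, which makes up for the
   coercivity modulo [H]. *)
have [om om0 a2om] := A2co 1 ltr01.
have a2om' x : carrier X2 x -> om * nrm X2 x ^+ 2 <= A2s x x + `|x| ^+ 2.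
  by move=> /a2om; rewrite mul1r.
have [sig sig0 A1sig] := A1co 1 ltr01.
have A1sig' x : dom A1 x -> sig * nrm X1 x ^+ 2 <= ip (A1 x) x + `|x| ^+ 2.
  by move=> Dx; have := A1sig x (A1X1 _ Dx); rewrite mul1r (A1ext x Dx x (A1X1 _ Dx)).
have A2a2 x y : dom A2 x -> carrier X2 y -> A2s x y = ip (A2 x) y.
  by move=> Dx Xy; exact: A2ext.
have i02 x : carrier X2 x -> 0 <= i x by move=> /V2V; exact: i0.
have Phii2 x y : carrier X2 x -> carrier X2 y -> i x - i y <= ip (Phi x) (x - y).
  by move=> /V2V Vx /V2V Vy; exact: Phii.
have [Qf Qf0 fQ] := discrete_source_bound ipP ipE fL.
have Xwp t : 0 <= t -> t <= T -> carrier X2 (wp t).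
  rewrite le_eqVlt => /orP[/eqP <- _|t0 tT]; first by rewrite wp0.
  have [_ Xd _ _] := osc 0 t (lexx _) t0 tT.
  by rewrite -(subrK (wp 0) (wp t)); apply: lin_subspaceD => //; rewrite wp0.
have [h00 [M [h000 M0 rate]]] := convergence_rate ipP ipE hT X2P LL LP cl0 Lcl
  (normr_ge0 CL) LCL' A1l A1psd Bl Bpsd A2l a2P CA0 a2C' om0 a2om' A2X2 A2a2 i02 Phii2
  (ltW Ccl0) cLL' B0 A20 Bv0 (normr_ge0 C0) (ltW Cp0) K0 wt0 wp0 wv0 gt2 Xwp Qf0 fQ avg
  sig0 A1sig' hLh hBh gA2 gB2 wE A1E osc.
have h0_gt0 : 0 < h0 by case/andP: h0_01.
(* Halving [h0] makes the required inequality with [h0] strict. *)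
exists (Num.min (h0 / 2) h00), M; split=> //.
  by rewrite lt_min h000 divr_gt0//= gt_min; apply/orP; left; lra.
move=> N h /andP[hgt0]; rewrite lt_min => /andP[_ hlt] th ph sol.
apply: (rate h N th ph hgt0 hlt _ sol).
(* For [N = 0] the convention for division by zero gives [h = 0], which the assumption [0 < h]
   excludes. *)
rewrite /h mulrC divfK//; apply/eqP => N0.
by move: hgt0; rewrite /h N0 invr0 mulr0 ltxx.
Qed.
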